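(* Let $G$ be a finite abelian group, let $p$ be the smallest prime divisor of $|G|$, and let $\Bbbk$ be an algebraically closed field of characteristic $0$. (I) Let $\triangleleft,\triangleleft'$ be two actions of $C_p$ on $G$, let $\tau\in H^2_c(\triangleleft)$, $\tau'\in H^2_c(\triangleleft')$, and suppose the extensions $H(\tau,\triangleleft)$ and $H(\tau',\triangleleft')$ of $\Bbbk C_p$ by $\Bbbk^G$ are noncocommutative. Then $H(\tau,\triangleleft)$ and $H(\tau',\triangleleft')$ are isomorphic as Hopf algebras if and only if (i) there exist $\alpha\in A_p=\mathrm{Aut}(C_p)$ and a $C_p$-isomorphism $\lambda:(G,\triangleleft)\to(G,\triangleleft'^{\alpha})$ such that (ii) $\tau'=\tau.(\lambda\alpha^{-1})$ in $H^2_c(\triangleleft')$. (II) For every action $\triangleleft$ of $C_p$ on $G$ there is a bijection between the orbits of $\mathcal{G}(\triangleleft)$ in $H^2_c(\triangleleft)$ not contained in $H^2_{\mathrm{cc}}(\triangleleft)$ and the isomorphism types of noncocommutative Hopf algebras in $\mathrm{Ext}_{[\triangleleft]}(\Bbbk C_p,\Bbbk^G)$.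
   Context: Actions. $C_p=\langle t\rangle$ is the cyclic group of order $p$. An action $\triangleleft$ of $C_p$ on $G$ is a right action by group automorphisms. For $\alpha\in A_p=\mathrm{Aut}(C_p)$, $\triangleleft^{\alpha}$ is the action $a\triangleleft^{\alpha}x=a\triangleleft\alpha(x)$. Automorphisms of $G$ are written on the right. A $C_p$-isomorphism $\lambda:(G,\triangleleft)\to(G,\triangleleft')$ is a group automorphism $\lambda$ of $G$ with $(a\triangleleft x)\lambda=a\lambda\triangleleft' x$; the set of these is $I(\triangleleft,\triangleleft')$, and two actions are equivalent ($\simeq$) if $I(\triangleleft,\triangleleft')\neq\emptyset$. Put $\mathbb{A}(\triangleleft)=I(\triangleleft,\triangleleft)$, $C(\triangleleft)=\{\alpha\in A_p:\triangleleft^{\alpha}\simeq\triangleleft\}$, and $[\triangleleft]=\{\triangleleft':\triangleleft'\simeq\triangleleft^{\alpha}\text{ for some }\alpha\in A_p\}$. Cohomology. $\Bbbk^G$ is the algebra of functions $G\to\Bbbk$ with basis of idempotents $p_a$, $a\in G$; $C_p$ acts on functions by $(y.\phi)(x_1,\dots,x_n,a_1,\dots,a_m)=\phi(x_1,\dots,x_n,a_1\triangleleft y,\dots,a_m\triangleleft y)$, $y,x_i\in C_p$, $a_j\in G$. $Z^2_c(\triangleleft)$ is the group (under pointwise product) of functions $\tau:C_p\times G\times G\to\Bbbk^{\times}$, written $\tau(x)=\tau(x,\cdot,\cdot)$, such that each $\tau(x)$ is a $2$-cocycle of $G$ with values in $\Bbbk^\times$ (trivial action) and $\tau(xy)=\tau(x)\,(x.\tau(y))$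 for all $x,y\in C_p$. For $\eta:C_p\times G\to\Bbbk^\times$ let $(\delta_G\eta)(x,a,b)=\eta(x,a)\eta(x,b)\eta(x,ab)^{-1}$. $B^2_c(\triangleleft)$ is the group of all $\delta_G\eta$ with $\eta(xy)=\eta(x)(x.\eta(y))$; $B^2_{\mathrm{cc}}(\triangleleft)$ is the group of all $\delta_G\eta$ (arbitrary $\eta$) lying in $Z^2_c(\triangleleft)$. $H^2_c(\triangleleft)=Z^2_c(\triangleleft)/B^2_c(\triangleleft)$ and $H^2_{\mathrm{cc}}(\triangleleft)=B^2_{\mathrm{cc}}(\triangleleft)/B^2_c(\triangleleft)\subset H^2_c(\triangleleft)$. The same symbol is used for a cocycle and its class. Extensions. An extension of $\Bbbk C_p$ by $\Bbbk^G$ is a sequence of Hopf maps $\Bbbk^G\overset{\iota}{\rightarrowtail}H\overset{\pi}{\twoheadrightarrow}\Bbbk C_p$ with $\iota$ injective, $\pi$ surjective, $\iota(\Bbbk^G)$ normal in $H$ and $\ker\pi=\iota(\Bbbk^G)^+H$. $H(\tau,\triangleleft)$ is the Hopf algebra with basis $\{p_a x: a\in G,x\in C_p\}$, product $(fx)(f'y)=f(x.f')xy$ and coproduct $\Delta(fx)=\sum_{a,b\in G}\tau(x,a,b)f_1p_ax\otimes f_2p_bx$, counit $\varepsilon(fx)=f(1_G)$, for $f,f'\in\Bbbk^G$, $x,y\in C_p$, where $\tau$ is a normalized representative of its class (up to equivalence of extensions it depends only on the class in $H^2_c(\triangleleft)$); up to equivalence every extension of $\Bbbk C_p$ by $\Bbbk^G$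 is of this form. $\mathrm{Ext}_{[\triangleleft]}(\Bbbk C_p,\Bbbk^G)$ is the set of equivalence classes of extensions whose action belongs to $[\triangleleft]$. Isomorphism types are taken with respect to Hopf algebra isomorphism. Group actions on cohomology. For an automorphism $\lambda$ of $G$ and $\alpha\in A_p$: $(\tau.\lambda)(x,a,b)=\tau(x,a\lambda^{-1},b\lambda^{-1})$, $(\tau.\alpha)(x,a,b)=\tau(\alpha(x),a,b)$, and $\tau.(\lambda\alpha^{-1})=(\tau.\lambda).\alpha^{-1}$. If $\triangleleft$ is nontrivial, $\mathcal{G}(\triangleleft)$ is the subgroup of $\mathrm{Aut}(G)$ generated by $\mathbb{A}(\triangleleft)$ and one element $\lambda_\alpha\in I(\triangleleft,\triangleleft^{\alpha})$ for each $\alpha\in C(\triangleleft)$ (so $\mathcal{G}(\triangleleft)=\bigcup_{\alpha\in C(\triangleleft)}I(\triangleleft,\triangleleft^{\alpha})$, a disjoint union); an element $\lambda\in I(\triangleleft,\triangleleft^\alpha)$ acts on $H^2_c(\triangleleft)$ by $\tau\mapsto\tau.(\lambda\alpha^{-1})$. If $\triangleleft$ is trivial, $\mathcal{G}(\triangleleft)=\mathrm{Aut}(G)\times A_p$ with $(\phi,\alpha)$ acting by $\tau\mapsto\tau.(\phi\alpha^{-1})$. *)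

(* Defs.v *)
From HB Require Import structures.
From mathcomp Require Import all_boot all_fingroup all_algebra.
From mathcomp Require Import boolp classical_sets functions.

Set Implicit Arguments.
Unset Strict Implicit.
Unset Printing Implicit Defensive.

Import GRing.Theory.
Local Open Scope ring_scope.

(* A finite list [s] of pairs stands for the tensor \sum_(i <- s) i.1 (x) i.2.
   By the universal property, two such tensors are equal iff every bilinear
   map takes the same value on both. *)
Definition tensor_eq (k : fieldType) (U V : lmodType k) (s t : seq (U * V)) :=
  forall (W : lmodType k) (f : U -> V -> W), bilinear_for *:%R *:%R f ->
  \sum_(i <- s) f i.1 i.2 = \sum_(i <- t) f i.1 i.2.

Definition trilinear (k : fieldType) (U V V' W : lmodType k)
    (f : U -> V -> V' -> W) :=
  [/\ forall v w, linear (fun u => f u v w),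
      forall u w, linear (fun v => f u v w) &
      forall u v, linear (f u v)].

Definition tensor3_eq (k : fieldType) (U V V' : lmodType k)
    (s t : seq (U * V * V')) :=
  forall (W : lmodType k) (f : U -> V -> V' -> W), trilinear f ->
  \sum_(i <- s) f i.1.1 i.1.2 i.2 = \sum_(i <- t) f i.1.1 i.1.2 i.2.

(* [comul h] is a list of pairs representing \Delta(h) in the above sense; only
   its class for [tensor_eq] is meaningful. *)
HB.mixin Record Algebra_isHopf (k : fieldType) H of GRing.Algebra k H := {
  comul : H -> seq (H * H);
  counit : H -> k;
  antipode : H -> H;
  comul_linear : forall (a : k) (u v : H), tensor_eq
    (comul (a *: u + v)) ([seq (a *: i.1, i.2) | i <- comul u] ++ comul v);
  comulA : forall h : H, tensor3_eq
    [seq (j.1, j.2, i.2) | i <- comul h, j <- comul i.1]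
    [seq (i.1, j.1, j.2) | i <- comul h, j <- comul i.2];
  comul1 : tensor_eq (comul 1) [:: (1, 1)];
  comulM : forall u v : H, tensor_eq (comul (u * v))
    [seq (i.1 * j.1, i.2 * j.2) | i <- comul u, j <- comul v];
  counit_linear : scalar counit;
  counit1 : counit 1 = 1;
  counitM : {morph counit : u v / u * v};
  counitl : forall h : H, \sum_(i <- comul h) counit i.1 *: i.2 = h;
  counitr : forall h : H, \sum_(i <- comul h) counit i.2 *: i.1 = h;
  antipode_linear : linear antipode;
  antipodel : forall h : H,
    \sum_(i <- comul h) antipode i.1 * i.2 = (counit h)%:A;
  antipoder : forall h : H,
    \sum_(i <- comul h) i.1 * antipode i.2 = (counit h)%:A
}.

#[short(type="hopfAlgType")]
HB.structure Definition HopfAlgebra (k : fieldType) :=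
  {H of Algebra_isHopf k H & GRing.Algebra k H}.

(* Compatibility with the antipodes is automatic. *)
Definition hopf_map (k : fieldType) (H K : hopfAlgType k)
    (f : {lrmorphism H -> K}) :=
  (forall h, tensor_eq (comul (f h)) [seq (f i.1, f i.2) | i <- comul h])
  /\ (forall h, counit (f h) = counit h).

Definition hopf_isomorphic (k : fieldType) (H K : hopfAlgType k) :=
  exists2 f : {lrmorphism H -> K}, hopf_map f & bijective f.

Definition cocommutative (k : fieldType) (H : hopfAlgType k) :=
  forall h : H, tensor_eq (comul h) [seq (i.2, i.1) | i <- comul h].

Section LinearHelpers.
Context (k : fieldType).

Lemma linear_factsP (U W : lmodType k) (f : U -> W) : linear f ->
  [/\ forall u v, f (u + v) = f u + f v, forall a u, f (a *: u) = a *: f u &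
      forall I (r : seq I) (P : pred I) (F : I -> U),
        f (\sum_(i <- r | P i) F i) = \sum_(i <- r | P i) f (F i)].
Proof.
move=> lin_f.
pose g : {linear U -> W} := HB.pack f (GRing.isLinear.Build k U W *:%R f lin_f).
split=> [u v|a u|I r P F]; [exact: (linearD g)|exact: (linearZ_LR g)|].
exact: (linear_sum g).
Qed.

Section Bilinear.
Context (U V W : lmodType k) (f : U -> V -> W) (bf : bilinear_for *:%R *:%R f).

Lemma bilZl a u v : f (a *: u) v = a *: f u v.
Proof. by case: (linear_factsP (bf.1 v)) => _ ->. Qed.
Lemma bilZr a u v : f u (a *: v) = a *: f u v.
Proof. by case: (linear_factsP (bf.2 u)) => _ ->. Qed.
Lemma bilDl u u' v : f (u + u') v = f u v + f u' v.
Proof. by case: (linear_factsP (bf.1 v)) => ->. Qed.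
Lemma bilDr u v v' : f u (v + v') = f u v + f u v'.
Proof. by case: (linear_factsP (bf.2 u)) => ->. Qed.
Lemma bil_suml I (r : seq I) (P : pred I) F v :
  f (\sum_(i <- r | P i) F i) v = \sum_(i <- r | P i) f (F i) v.
Proof. by case: (linear_factsP (bf.1 v)) => _ _; apply. Qed.
Lemma bil_sumr I (r : seq I) (P : pred I) F u :
  f u (\sum_(i <- r | P i) F i) = \sum_(i <- r | P i) f u (F i).
Proof. by case: (linear_factsP (bf.2 u)) => _ _; apply. Qed.
End Bilinear.

Section Trilinear.
Context (U V V' W : lmodType k) (f : U -> V -> V' -> W) (tf : trilinear f).

Lemma triZ1 a u v w : f (a *: u) v w = a *: f u v w.
Proof. by case: tf => l _ _; case: (linear_factsP (l v w)) => _ ->. Qed.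
Lemma triZ2 a u v w : f u (a *: v) w = a *: f u v w.
Proof. by case: tf => _ l _; case: (linear_factsP (l u w)) => _ ->. Qed.
Lemma triZ3 a u v w : f u v (a *: w) = a *: f u v w.
Proof. by case: tf => _ _ l; case: (linear_factsP (l u v)) => _ ->. Qed.
End Trilinear.

End LinearHelpers.

Section FunctionAlgebra.
Context (k : fieldType) (gT : finGroupType).

Definition fun_alg := {ffun gT -> k^o}.
HB.instance Definition _ := GRing.Lmodule.on fun_alg.
Implicit Types u v w : fun_alg.

Definition fun_one : fun_alg := [ffun=> 1].
Definition fun_mul u v : fun_alg := [ffun a => u a * v a].

Fact fun_mulA : associative fun_mul.
Proof. by move=> u v w; apply/ffunP=> a; rewrite !ffunE mulrA. Qed.
Fact fun_mul1 : left_id fun_one fun_mul.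
Proof. by move=> u; apply/ffunP=> a; rewrite !ffunE mul1r. Qed.
Fact fun_mulr1 : right_id fun_one fun_mul.
Proof. by move=> u; apply/ffunP=> a; rewrite !ffunE mulr1. Qed.
Fact fun_mulDl : left_distributive fun_mul +%R.
Proof. by move=> u v w; apply/ffunP=> a; rewrite !ffunE mulrDl. Qed.
Fact fun_mulDr : right_distributive fun_mul +%R.
Proof. by move=> u v w; apply/ffunP=> a; rewrite !ffunE mulrDr. Qed.
Fact fun_one_neq0 : fun_one != 0.
Proof. by apply/eqP=> /ffunP/(_ 1%g)/eqP; rewrite !ffunE oner_eq0. Qed.
HB.instance Definition _ := GRing.Zmodule_isNzRing.Build fun_alg
  fun_mulA fun_mul1 fun_mulr1 fun_mulDl fun_mulDr fun_one_neq0.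

Fact fun_scaleAl (c : k) u v : c *: (u * v) = (c *: u) * v.
Proof. by apply/ffunP=> a; rewrite !ffunE /= /GRing.scale /= mulrA. Qed.
HB.instance Definition _ :=
  GRing.Lmodule_isLalgebra.Build k fun_alg fun_scaleAl.
Fact fun_scaleAr (c : k) u v : c *: (u * v) = u * (c *: v).
Proof. by apply/ffunP=> a; rewrite !ffunE /= /GRing.scale /= mulrCA. Qed.
HB.instance Definition _ :=
  GRing.Lalgebra_isAlgebra.Build k fun_alg fun_scaleAr.

Definition idem (a : gT) : fun_alg := [ffun b => (b == a)%:R].

Definition fun_comul u : seq (fun_alg * fun_alg) :=
  [seq (u (t.1 * t.2)%g *: idem t.1, idem t.2) | t : gT * gT].
Definition fun_counit u : k := u 1%g.
Definition fun_antipode u : fun_alg := [ffun a => u a^-1%g].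

Lemma fun_idem_sum u : u = \sum_a u a *: idem a.
Proof.
apply/ffunP=> b; rewrite sum_ffunE (bigD1 b) //= big1 ?addr0 => [|a ab].
  by rewrite !ffunE eqxx /GRing.scale /= mulr1.
by rewrite !ffunE eq_sym (negPf ab) /GRing.scale /= mulr0.
Qed.

Lemma fun_idemM a b : idem a * idem b = (a == b)%:R *: idem a.
Proof.
apply/ffunP=> c; rewrite !ffunE /GRing.scale /=.
have [->|ne] := eqVneq a b; last first.
  have [->|_] := eqVneq c a; last by rewrite mul0r mulr0.
  by rewrite (negPf ne) mulr0 mul0r.
by case: eqP; rewrite ?mulr0 ?mulr1.
Qed.

Lemma fun_comulE (W : zmodType) (f : fun_alg -> fun_alg -> W) u :
  \sum_(i <- fun_comul u) f i.1 i.2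
  = \sum_a \sum_b f (u (a * b)%g *: idem a) (idem b).
Proof. by rewrite big_image /= pair_big. Qed.

Fact fun_comul_linear (c : k) u v : tensor_eq (fun_comul (c *: u + v))
  ([seq (c *: i.1, i.2) | i <- fun_comul u] ++ fun_comul v).
Proof.
move=> W f bf; rewrite big_cat /= !(fun_comulE f) big_map.
rewrite (fun_comulE (fun x y => f (c *: x) y)) -big_split /=.
apply: eq_bigr => a _; rewrite -big_split; apply: eq_bigr => b _ /=.
by rewrite !ffunE scalerA -(bilDl bf) -scalerDl.
Qed.

Fact fun_comulA u : tensor3_eq
  [seq (j.1, j.2, i.2) | i <- fun_comul u, j <- fun_comul i.1]
  [seq (i.1, j.1, j.2) | i <- fun_comul u, j <- fun_comul i.2].
Proof.
move=> W f tf; rewrite !big_allpairs_dep /=.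
under eq_bigr => i _ do rewrite (fun_comulE (fun x y => f x y i.2)).
rewrite (fun_comulE (fun x y =>
  \sum_a \sum_b f (x (a * b)%g *: idem a) (idem b) y)).
under [RHS]eq_bigr => i _ do rewrite (fun_comulE (f i.1)).
rewrite (fun_comulE (fun x y =>
  \sum_a \sum_b f x (y (a * b)%g *: idem a) (idem b))).
transitivity (\sum_a \sum_b \sum_c
  u (a * b * c)%g *: f (idem a) (idem b) (idem c)).
  rewrite exchange_big /=; under eq_bigr do rewrite exchange_big /=.
  rewrite exchange_big; apply: eq_bigr => a _ /=.
  under eq_bigr do rewrite exchange_big /=.
  rewrite exchange_big; apply: eq_bigr => b _ /=.
  apply: eq_bigr => c _; rewrite (bigD1 (a * b)%g) //= big1 ?addr0.
    by rewrite !ffunE eqxx triZ1 // mulr1n [u _ *: 1]mulr1.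
  move=> d /negPf; rewrite eq_sym => nd.
  by rewrite !ffunE nd triZ1 // mulr0n scaler0 scale0r.
apply: eq_bigr => a _; rewrite [RHS]exchange_big; apply: eq_bigr => b _ /=.
rewrite [RHS]exchange_big; apply: eq_bigr => c _ /=.
rewrite [RHS](bigD1 (b * c)%g) //= big1 ?addr0.
  by rewrite !ffunE eqxx triZ1 // mulr1n scale1r mulgA.
move=> d /negPf; rewrite eq_sym => nd.
by rewrite !ffunE nd triZ2 // mulr0n scale0r.
Qed.

Fact fun_comul1 : tensor_eq (fun_comul 1) [:: (1, 1)].
Proof.
move=> W f bf; rewrite (fun_comulE f) big_seq1 /=.
rewrite [X in f X _]fun_idem_sum (bil_suml bf); apply: eq_bigr => a _.
rewrite [X in f _ X]fun_idem_sum (bil_sumr bf); apply: eq_bigr => b _.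
by rewrite !ffunE !scale1r.
Qed.

Fact fun_comulM u v : tensor_eq (fun_comul (u * v))
  [seq (i.1 * j.1, i.2 * j.2) | i <- fun_comul u, j <- fun_comul v].
Proof.
move=> W f bf; rewrite (fun_comulE f) !big_allpairs_dep /=.
under [RHS]eq_bigr => i _ do
  rewrite (fun_comulE (fun x y => f (i.1 * x) (i.2 * y))).
rewrite (fun_comulE (fun x y =>
  \sum_a \sum_b f (x * (v (a * b)%g *: idem a)) (y * idem b))).
apply: eq_bigr => a _; apply: eq_bigr => b _.
rewrite (bigD1 a) //= [X in _ + X]big1 ?addr0 => [|c nc]; last first.
  apply: big1 => d _; rewrite -scalerAl -scalerAr [idem a * _]fun_idemM.
  by rewrite (negPf (contra_neq esym nc)) mulr0n !(bilZl bf) scale0r !scaler0.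
rewrite (bigD1 b) //= big1 ?addr0 => [|c nc]; last first.
  rewrite [idem b * _]fun_idemM (negPf (contra_neq esym nc)).
  by rewrite mulr0n (bilZr bf) scale0r.
by rewrite -scalerAl -scalerAr !fun_idemM !eqxx !scale1r scalerA !ffunE.
Qed.

Fact fun_counit_linear : scalar fun_counit.
Proof. by move=> a u v; rewrite /fun_counit !ffunE. Qed.
Fact fun_counit1 : fun_counit 1 = 1.
Proof. by rewrite /fun_counit ffunE. Qed.
Fact fun_counitM : {morph fun_counit : u v / u * v}.
Proof. by move=> u v; rewrite /fun_counit ffunE. Qed.

Fact fun_counitl u : \sum_(i <- fun_comul u) fun_counit i.1 *: i.2 = u.
Proof.
rewrite (fun_comulE (fun x y => fun_counit x *: y)) (bigD1 1%g) //=.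
rewrite [X in _ + X]big1 ?addr0 => [|a na]; last first.
  apply: big1 => b _; rewrite /fun_counit !ffunE eq_sym (negPf na).
  by rewrite mulr0n scaler0 scale0r.
rewrite [RHS]fun_idem_sum; apply: eq_bigr => b _.
by rewrite /fun_counit !ffunE eqxx mul1g mulr1n [u b *: 1]mulr1.
Qed.

Fact fun_counitr u : \sum_(i <- fun_comul u) fun_counit i.2 *: i.1 = u.
Proof.
rewrite (fun_comulE (fun x y => fun_counit y *: x)) [RHS]fun_idem_sum.
apply: eq_bigr => a _; rewrite (bigD1 1%g) //= big1 ?addr0 => [|b nb].
  by rewrite /fun_counit !ffunE eqxx mulg1 mulr1n scale1r.
by rewrite /fun_counit !ffunE eq_sym (negPf nb) mulr0n scale0r.
Qed.

Fact fun_antipode_linear : linear fun_antipode.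
Proof. by move=> a u v; apply/ffunP=> b; rewrite !ffunE. Qed.

Fact fun_antipodel u :
  \sum_(i <- fun_comul u) fun_antipode i.1 * i.2 = (fun_counit u)%:A.
Proof.
rewrite (fun_comulE (fun x y => fun_antipode x * y)) exchange_big /=.
rewrite [RHS]fun_idem_sum; apply: eq_bigr => b _.
rewrite (bigD1 b^-1%g) //= big1 ?addr0 => [|a na]; apply/ffunP=> c.
  rewrite !ffunE mulVg /GRing.scale /= mulr1.
  by have [->|_] := eqVneq c b; rewrite ?eqxx ?mulr0 // !mulr1.
rewrite !ffunE /GRing.scale /=; have [->|_] := eqVneq c b; last by rewrite mulr0.
by rewrite eq_sym (negPf na) mulr0 mul0r.
Qed.

Fact fun_antipoder u :
  \sum_(i <- fun_comul u) i.1 * fun_antipode i.2 = (fun_counit u)%:A.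
Proof.
rewrite (fun_comulE (fun x y => x * fun_antipode y)).
rewrite [RHS]fun_idem_sum; apply: eq_bigr => a _.
rewrite (bigD1 a^-1%g) //= big1 ?addr0 => [|b nb]; apply/ffunP=> c.
  rewrite !ffunE mulgV /GRing.scale /= mulr1.
  by have [->|_] := eqVneq c a; rewrite ?eqxx ?mulr0 ?mul0r // !mulr1.
rewrite !ffunE /GRing.scale /=; have [->|_] := eqVneq c a.
  by rewrite eq_sym (negPf nb) mulr0.
by rewrite mulr0 mul0r.
Qed.

HB.instance Definition _ := Algebra_isHopf.Build k fun_alg
  fun_comul_linear fun_comulA fun_comul1 fun_comulM
  fun_counit_linear fun_counit1 fun_counitM fun_counitl fun_counitr
  fun_antipode_linear fun_antipodel fun_antipoder.

End FunctionAlgebra.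

Section GroupAlgebra.
Context (k : fieldType) (C : finGroupType).

Definition grp_alg := {ffun C -> k^o}.
HB.instance Definition _ := GRing.Lmodule.on grp_alg.
Implicit Types u v w : grp_alg.

Definition grp_elt (x : C) : grp_alg := [ffun y => (y == x)%:R].
Definition grp_mul u v : grp_alg :=
  [ffun z => \sum_(x : C) u x * v (x^-1 * z)%g].

Fact grp_mulA : associative grp_mul.
Proof.
move=> u v w; apply/ffunP=> z; rewrite !ffunE.
under eq_bigr => x _ do rewrite ffunE mulr_sumr.
under [RHS]eq_bigr => y _ do rewrite ffunE mulr_suml.
rewrite [RHS]exchange_big; apply: eq_bigr => x _ /=.
rewrite [RHS](reindex_inj (mulgI x)); apply: eq_bigr => y _.
by rewrite mulKg invMg !mulgA mulrA.
Qed.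
Fact grp_mul1 : left_id (grp_elt 1%g) grp_mul.
Proof.
move=> u; apply/ffunP=> z; rewrite !ffunE (bigD1 1%g) //= big1 ?addr0.
  by rewrite ffunE eqxx mulr1n mul1r invg1 mul1g.
by move=> x /negPf nx; rewrite ffunE nx mulr0n mul0r.
Qed.
Fact grp_mulr1 : right_id (grp_elt 1%g) grp_mul.
Proof.
move=> u; apply/ffunP=> z; rewrite !ffunE (bigD1 z) //= big1 ?addr0.
  by rewrite ffunE mulVg eqxx mulr1n mulr1.
by move=> x nx; rewrite ffunE -eq_mulVg1 (negPf nx) mulr0n mulr0.
Qed.
Fact grp_mulDl : left_distributive grp_mul +%R.
Proof.
move=> u v w; apply/ffunP=> z; rewrite !ffunE -big_split.
by apply: eq_bigr => x _; rewrite !ffunE mulrDl.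
Qed.
Fact grp_mulDr : right_distributive grp_mul +%R.
Proof.
move=> u v w; apply/ffunP=> z; rewrite !ffunE -big_split.
by apply: eq_bigr => x _; rewrite !ffunE mulrDr.
Qed.
Fact grp_elt1_neq0 : grp_elt 1%g != 0.
Proof. by apply/eqP=> /ffunP/(_ 1%g)/eqP; rewrite !ffunE eqxx oner_eq0. Qed.
HB.instance Definition _ := GRing.Zmodule_isNzRing.Build grp_alg
  grp_mulA grp_mul1 grp_mulr1 grp_mulDl grp_mulDr grp_elt1_neq0.

Fact grp_scaleAl (c : k) u v : c *: (u * v) = (c *: u) * v.
Proof.
apply/ffunP=> z; rewrite !ffunE scaler_sumr; apply: eq_bigr => x _.
by rewrite !ffunE -mulrA.
Qed.
HB.instance Definition _ :=
  GRing.Lmodule_isLalgebra.Build k grp_alg grp_scaleAl.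
Fact grp_scaleAr (c : k) u v : c *: (u * v) = u * (c *: v).
Proof.
apply/ffunP=> z; rewrite !ffunE scaler_sumr; apply: eq_bigr => x _.
by rewrite !ffunE [RHS]mulrCA.
Qed.
HB.instance Definition _ :=
  GRing.Lalgebra_isAlgebra.Build k grp_alg grp_scaleAr.

Definition grp_comul u : seq (grp_alg * grp_alg) :=
  [seq (u x *: grp_elt x, grp_elt x) | x : C].
Definition grp_counit u : k := \sum_(x : C) u x.
Definition grp_antipode u : grp_alg := [ffun x => u x^-1%g].

Lemma grp_elt_sum u : u = \sum_x u x *: grp_elt x.
Proof.
apply/ffunP=> y; rewrite sum_ffunE (bigD1 y) //= big1 ?addr0 => [|x xy].
  by rewrite !ffunE eqxx mulr1n [u y *: 1]mulr1.
by rewrite !ffunE eq_sym (negPf xy) mulr0n scaler0.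
Qed.

Lemma grp_eltM x y : grp_elt x * grp_elt y = grp_elt (x * y)%g.
Proof.
apply/ffunP=> z; rewrite !ffunE (bigD1 x) //= big1 ?addr0 => [|w nw].
  by rewrite !ffunE eqxx mulr1n mul1r -(inj_eq (mulgI x)) mulKVg.
by rewrite !ffunE (negPf nw) mulr0n mul0r.
Qed.

Lemma grp_comulE (W : zmodType) (f : grp_alg -> grp_alg -> W) u :
  \sum_(i <- grp_comul u) f i.1 i.2
  = \sum_x f (u x *: grp_elt x) (grp_elt x).
Proof. by rewrite big_image. Qed.

Lemma grp_eltE x y : grp_elt x y = (y == x)%:R. Proof. exact: ffunE. Qed.

Fact grp_comul_linear (c : k) u v : tensor_eq (grp_comul (c *: u + v))
  ([seq (c *: i.1, i.2) | i <- grp_comul u] ++ grp_comul v).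
Proof.
move=> W f bf; rewrite big_cat /= !(grp_comulE f) big_map.
rewrite (grp_comulE (fun x y => f (c *: x) y)) -big_split /=.
apply: eq_bigr => x _.
by rewrite !ffunE scalerA -(bilDl bf) -scalerDl.
Qed.

Fact grp_comulA u : tensor3_eq
  [seq (j.1, j.2, i.2) | i <- grp_comul u, j <- grp_comul i.1]
  [seq (i.1, j.1, j.2) | i <- grp_comul u, j <- grp_comul i.2].
Proof.
move=> W f tf; rewrite !big_allpairs_dep /=.
under eq_bigr => i _ do rewrite (grp_comulE (fun x y => f x y i.2)).
rewrite (grp_comulE (fun x y =>
  \sum_a f (x a *: grp_elt a) (grp_elt a) y)).
under [RHS]eq_bigr => i _ do rewrite (grp_comulE (f i.1)).
rewrite (grp_comulE (fun x y => \sum_a f x (y a *: grp_elt a) (grp_elt a))).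
apply: eq_bigr => x _; apply: eq_bigr => y _.
rewrite !ffunE triZ1 // [RHS]triZ1 // triZ2 //.
have [->|_] := eqVneq y x; first by rewrite mulr1n [u x *: 1]mulr1 scale1r.
by rewrite mulr0n scaler0 !scale0r scaler0.
Qed.

Fact grp_comul1 : tensor_eq (grp_comul 1) [:: (1, 1)].
Proof.
move=> W f bf; rewrite (grp_comulE f) big_seq1 /= (bigD1 1%g) //=.
rewrite big1 ?addr0 => [|x /negPf nx]; first by rewrite ffunE eqxx scale1r.
by rewrite ffunE nx mulr0n (bilZl bf) scale0r.
Qed.

Fact grp_comulM u v : tensor_eq (grp_comul (u * v))
  [seq (i.1 * j.1, i.2 * j.2) | i <- grp_comul u, j <- grp_comul v].
Proof.
move=> W f bf; rewrite (grp_comulE f) !big_allpairs_dep /=.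
under [RHS]eq_bigr => i _ do
  rewrite (grp_comulE (fun x y => f (i.1 * x) (i.2 * y))).
rewrite (grp_comulE (fun x y =>
  \sum_a f (x * (v a *: grp_elt a)) (y * grp_elt a))).
under eq_bigr => z _ do rewrite (bilZl bf) ffunE scaler_suml.
rewrite exchange_big; apply: eq_bigr => x _ /=.
rewrite (reindex_inj (mulgI x)); apply: eq_bigr => y _.
by rewrite mulKg -scalerAl -scalerAr !grp_eltM scalerA (bilZl bf).
Qed.

Fact grp_counit_linear : scalar grp_counit.
Proof.
move=> a u v; rewrite /grp_counit mulr_sumr -big_split.
by apply: eq_bigr => x _; rewrite !ffunE.
Qed.
Lemma grp_counit_elt x : grp_counit (grp_elt x) = 1.
Proof.
rewrite /grp_counit (bigD1 x) //= big1 ?addr0 => [|y /negPf ny].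
  by rewrite ffunE eqxx.
by rewrite ffunE ny.
Qed.
Fact grp_counit1 : grp_counit 1 = 1.
Proof. exact: grp_counit_elt. Qed.
Fact grp_counitM : {morph grp_counit : u v / u * v}.
Proof.
move=> u v; rewrite /grp_counit mulr_suml.
under eq_bigr do rewrite ffunE.
rewrite exchange_big; apply: eq_bigr => x _ /=.
rewrite mulr_sumr (reindex_inj (mulgI x)); apply: eq_bigr => y _.
by rewrite mulKg.
Qed.

Lemma grp_counitZ c u : grp_counit (c *: u) = c * grp_counit u.
Proof. by rewrite /grp_counit mulr_sumr; apply: eq_bigr => x _; rewrite ffunE. Qed.

Fact grp_counitl u : \sum_(i <- grp_comul u) grp_counit i.1 *: i.2 = u.
Proof.
rewrite (grp_comulE (fun x y => grp_counit x *: y)) [RHS]grp_elt_sum.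
by apply: eq_bigr => x _; rewrite grp_counitZ grp_counit_elt mulr1.
Qed.

Fact grp_counitr u : \sum_(i <- grp_comul u) grp_counit i.2 *: i.1 = u.
Proof.
rewrite (grp_comulE (fun x y => grp_counit y *: x)) [RHS]grp_elt_sum.
by apply: eq_bigr => x _; rewrite grp_counit_elt scale1r.
Qed.

Fact grp_antipode_linear : linear grp_antipode.
Proof. by move=> a u v; apply/ffunP=> b; rewrite !ffunE. Qed.

Lemma grp_antipode_elt c x :
  grp_antipode (c *: grp_elt x) = c *: grp_elt x^-1%g.
Proof. by apply/ffunP=> y; rewrite !ffunE -(inj_eq invg_inj) invgK. Qed.

Fact grp_antipodel u :
  \sum_(i <- grp_comul u) grp_antipode i.1 * i.2 = (grp_counit u)%:A.
Proof.
rewrite (grp_comulE (fun x y => grp_antipode x * y)) scaler_suml.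
apply: eq_bigr => x _.
by rewrite grp_antipode_elt -scalerAl grp_eltM mulVg.
Qed.

Fact grp_antipoder u :
  \sum_(i <- grp_comul u) i.1 * grp_antipode i.2 = (grp_counit u)%:A.
Proof.
rewrite (grp_comulE (fun x y => x * grp_antipode y)) scaler_suml.
apply: eq_bigr => x _.
have -> : grp_antipode (grp_elt x) = grp_elt x^-1%g.
  by rewrite -[grp_elt x]scale1r grp_antipode_elt scale1r.
by rewrite -scalerAl grp_eltM mulgV.
Qed.

HB.instance Definition _ := Algebra_isHopf.Build k grp_alg
  grp_comul_linear grp_comulA grp_comul1 grp_comulM
  grp_counit_linear grp_counit1 grp_counitM grp_counitl grp_counitr
  grp_antipode_linear grp_antipodel grp_antipoder.

End GroupAlgebra.

Section Cohomology.
Context (k : fieldType) (gT C : finGroupType).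

(* The actions of C on gT by automorphisms are the terms of type
   [groupAction [set: C] [set: gT]]; the notions below only involve the
   underlying functions, so that they apply to [twist to alpha] as well. *)
Implicit Types (to : gT -> C -> gT) (l : {perm gT}) (alpha : {perm C}).

Definition twist to alpha : gT -> C -> gT := fun a x => to a (alpha x).

Definition isoms to to' : {set {perm gT}} :=
  [set l in Aut [set: gT] | [forall a, forall x, l (to a x) == to' (l a) x]].

Definition act_equiv to to' : bool := isoms to to' != finset.set0.

Definition twist_stab to : {set {perm C}} :=
  [set alpha in Aut [set: C] | act_equiv (twist to alpha) to].

(* The subgroup written \mathcal{G}(to) when [to] is nontrivial; [repr A] is
   an element of the nonempty set A. *)
Definition calG to : {set {perm gT}} :=
  <<isoms to to :|: [set repr (isoms to (twist to alpha))
                    | alpha in twist_stab to]>>%g.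

Definition trivial_act to : bool := [forall a, forall x, to a x == a].

Definition cochain := C -> gT -> gT -> k.
Implicit Types (tau : cochain) (eta : C -> gT -> k).

Definition cocycle2 (s : gT -> gT -> k) : Prop :=
  (forall a b, s a b != 0) /\
  (forall a b c, s a b * s (a * b)%g c = s b c * s a (b * c)%g).

Definition Z2c to : set cochain := fun tau =>
  (forall x, cocycle2 (tau x)) /\
  (forall x y a b, tau (x * y)%g a b = tau x a b * tau y (to a x) (to b x)).

Definition deltaG eta : cochain :=
  fun x a b => eta x a * eta x b * (eta x (a * b)%g)^-1.

Definition B2c to : set cochain := fun tau => exists eta,
  [/\ forall x a, eta x a != 0,
      forall x y a, eta (x * y)%g a = eta x a * eta y (to a x) &
      tau = deltaG eta].

Definition B2cc to : set cochain := fun tau => Z2c to tau /\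
  exists eta, (forall x a, eta x a != 0) /\ tau = deltaG eta.

(* The elements of H^2_c are the cosets of B^2_c, as sets of cochains. *)
Definition cocycle_class to tau : set cochain :=
  ((fun (s : cochain) x a b => (tau x a b * s x a b : k)) @` B2c to)%classic.

Definition H2c to : set (set cochain) := (cocycle_class to @` Z2c to)%classic.
Definition H2cc to : set (set cochain) := (cocycle_class to @` B2cc to)%classic.

Definition act_perm tau l : cochain :=
  fun x a b => tau x ((l^-1)%g a) ((l^-1)%g b).
Definition act_Aut tau alpha : cochain := fun x => tau (alpha x).
(* tau.(l alpha^-1) *)
Definition act_pair l alpha tau : cochain :=
  act_Aut (act_perm tau l) alpha^-1%g.

(* When [to] is nontrivial, [l] lies in I(to, to^alpha) for a unique alpha. *)
Definition calG_orbit to (c : set cochain) : set (set cochain) := fun c' =>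
  exists (l : {perm gT}) (alpha : {perm C}),
    (if trivial_act to then (l \in Aut [set: gT]) && (alpha \in Aut [set: C])
     else [&& l \in calG to, alpha \in twist_stab to &
              l \in isoms to (twist to alpha)])
    /\ c' = (act_pair l alpha @` c)%classic.

Definition noncc_orbits to : set (set (set cochain)) := fun O =>
  (exists2 c, H2c to c & O = calG_orbit to c) /\ ~ (O `<=` H2cc to)%classic.

Definition normalized tau : Prop :=
  forall x a, tau x a 1%g = 1 /\ tau x 1%g a = 1.

Record normalized_cocycle to := NormalizedCocycle {
  ncocycle :> C -> gT -> gT -> k;
  ncocycle_Z2c : Z2c to ncocycle;
  ncocycle_normalized : normalized ncocycle
}.

End Cohomology.

Arguments noncc_orbits k [gT C] to _.

(* The algebra underlying H(tau, to), which does not depend on tau: [u] stands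
   for the sum of the [u (a, x) *: p_a x]. *)
Definition smash_alg (k : fieldType) (gT C : finGroupType)
  (to : groupAction [set: C] [set: gT]) : Type := {ffun gT * C -> k^o}.

Section Smash.
Context (k : fieldType) (gT C : finGroupType).
Context (to : groupAction [set: C] [set: gT]).
Local Notation smash := (smash_alg k to).

Lemma toM a x y : to a (x * y)%g = to (to a x) y.
Proof. by rewrite actMin ?finset.in_setT. Qed.
Lemma toMl a b x : to (a * b)%g x = (to a x * to b x)%g.
Proof. by rewrite gactM ?finset.in_setT. Qed.
Lemma toV a x : to a^-1%g x = ((to a x)^-1)%g.
Proof. by rewrite gactV ?finset.in_setT. Qed.
Lemma toK a x : to (to a x)^-1%g x^-1%g = (a^-1)%g.
Proof. by rewrite -toV -toM mulgV act1. Qed.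

HB.instance Definition _ := GRing.Lmodule.copy smash {ffun gT * C -> k^o}.
Implicit Types u v w : smash.

(* the basis element p_a x *)
Definition smash_elt (a : gT) (x : C) : smash := [ffun i => (i == (a, x))%:R].

(* p_a x * p_b y = p_a (x.p_b) x y = [a <| x = b] p_a x y *)
Definition smash_mul u v : smash :=
  [ffun i => \sum_(x : C) u (i.1, x) * v (to i.1 x, (x^-1 * i.2)%g)].
Definition smash_one : smash := [ffun i => (i.2 == 1%g)%:R].

Fact smash_mulA : associative smash_mul.
Proof.
move=> u v w; apply/ffunP=> -[a z]; rewrite !ffunE.
under eq_bigr => x _ do rewrite ffunE mulr_sumr.
under [RHS]eq_bigr => y _ do rewrite ffunE mulr_suml.
rewrite [RHS]exchange_big; apply: eq_bigr => x _ /=.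
rewrite [RHS](reindex_inj (mulgI x)); apply: eq_bigr => y _.
by rewrite mulKg invMg !mulgA mulrA toM.
Qed.
Fact smash_mul1 : left_id smash_one smash_mul.
Proof.
move=> u; apply/ffunP=> -[a z]; rewrite !ffunE (bigD1 1%g) //= big1 ?addr0.
  by rewrite ffunE eqxx mulr1n mul1r invg1 mul1g act1.
by move=> x /negPf nx; rewrite ffunE nx mulr0n mul0r.
Qed.
Fact smash_mulr1 : right_id smash_one smash_mul.
Proof.
move=> u; apply/ffunP=> -[a z]; rewrite !ffunE (bigD1 z) //= big1 ?addr0.
  by rewrite ffunE mulVg eqxx mulr1n mulr1.
by move=> x nx; rewrite ffunE -eq_mulVg1 (negPf nx) mulr0n mulr0.
Qed.
Fact smash_mulDl : left_distributive smash_mul +%R.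
Proof.
move=> u v w; apply/ffunP=> z; rewrite !ffunE -big_split.
by apply: eq_bigr => x _; rewrite !ffunE mulrDl.
Qed.
Fact smash_mulDr : right_distributive smash_mul +%R.
Proof.
move=> u v w; apply/ffunP=> z; rewrite !ffunE -big_split.
by apply: eq_bigr => x _; rewrite !ffunE mulrDr.
Qed.
Fact smash_one_neq0 : smash_one != 0.
Proof. by apply/eqP=> /ffunP/(_ 1%g)/eqP; rewrite !ffunE eqxx oner_eq0. Qed.
HB.instance Definition _ := GRing.Zmodule_isNzRing.Build smash
  smash_mulA smash_mul1 smash_mulr1 smash_mulDl smash_mulDr smash_one_neq0.

Fact smash_scaleAl (c : k) u v : c *: (u * v) = (c *: u) * v.
Proof.
apply/ffunP=> z; rewrite !ffunE scaler_sumr; apply: eq_bigr => x _.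
by rewrite !ffunE -mulrA.
Qed.
HB.instance Definition _ :=
  GRing.Lmodule_isLalgebra.Build k smash smash_scaleAl.
Fact smash_scaleAr (c : k) u v : c *: (u * v) = u * (c *: v).
Proof.
apply/ffunP=> z; rewrite !ffunE scaler_sumr; apply: eq_bigr => x _.
by rewrite !ffunE [RHS]mulrCA.
Qed.
HB.instance Definition _ :=
  GRing.Lalgebra_isAlgebra.Build k smash smash_scaleAr.

Lemma smash_elt_sum u : u = \sum_a \sum_x u (a, x) *: smash_elt a x.
Proof.
rewrite pair_big /=; apply/ffunP=> y.
rewrite sum_ffunE (bigD1 y) //= big1 ?addr0 => [|x xy].
  by rewrite !ffunE -surjective_pairing eqxx mulr1n [u y *: 1]mulr1.
by rewrite !ffunE -surjective_pairing eq_sym (negPf xy) mulr0n scaler0.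
Qed.

Lemma smash_eltM a x b y :
  smash_elt a x * smash_elt b y
  = (b == to a x)%:R *: smash_elt a (x * y)%g.
Proof.
apply/ffunP=> -[c z]; rewrite !ffunE (bigD1 x) //= big1 ?addr0 => [|w nw].
  rewrite !ffunE !xpair_eqE eqxx andbT -(inj_eq (mulgI x)) mulKVg.
  have [->|_] := eqVneq c a; last by rewrite mul0r scaler0.
  rewrite mul1r eq_sym; case: (b == _); first by rewrite mulr1n scale1r.
  by rewrite mulr0n scale0r.
by rewrite !ffunE xpair_eqE (negPf nw) andbF mulr0n mul0r.
Qed.

End Smash.

Definition crossed_alg (k : fieldType) (gT C : finGroupType)
  (to : groupAction [set: C] [set: gT]) (tau : normalized_cocycle k to) : Type :=
  smash_alg k to.

Section CrossedHopf.
Context (k : fieldType) (gT C : finGroupType).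
Context (to : groupAction [set: C] [set: gT]).
Context (tau : normalized_cocycle k to).
Local Notation crossed := (crossed_alg tau).

HB.instance Definition _ := GRing.Algebra.copy crossed (smash_alg k to).
Implicit Types u v w : crossed.
Local Notation sb a x := (smash_elt k to a x : crossed).

(* \Delta(p_c x) is the sum of the tau(x, a, b) p_a x (x) p_b x over the pairs
   (a, b) with a b = c; an index t is (x, a, b). *)
Definition crossed_comul u : seq (crossed * crossed) :=
  [seq ((tau t.1.1 t.1.2 t.2 * u ((t.1.2 * t.2)%g, t.1.1)) *: sb t.1.2 t.1.1,
        sb t.2 t.1.1) | t : C * gT * gT].
Definition crossed_counit u : k := \sum_(x : C) u (1%g, x).
(* S(p_a x) = tau(x, a, a^-1)^-1 p_{(a <| x)^-1} x^-1 *)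
Definition crossed_antipode u : crossed := [ffun i =>
  let x := (i.2^-1)%g in let a := to (i.1^-1)%g i.2 in
  (tau x a a^-1%g)^-1 * u (a, x)].

Let tau_neq0 x a b : tau x a b != 0.
Proof. by have [+ _] := ncocycle_Z2c tau => /(_ x)[]. Qed.
Let tau_cocycle x a b c :
  tau x a b * tau x (a * b)%g c = tau x b c * tau x a (b * c)%g.
Proof. by have [+ _] := ncocycle_Z2c tau => /(_ x)[]. Qed.
Let tauM x y a b : tau (x * y)%g a b = tau x a b * tau y (to a x) (to b x).
Proof. by have [_] := ncocycle_Z2c tau. Qed.
Let tau1 a b : tau 1%g a b = 1.
Proof.
have := tauM 1%g 1%g a b; rewrite mulg1 !act1 => E.
by apply: (mulfI (tau_neq0 1%g a b)); rewrite -E mulr1.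
Qed.
Let tau1l x a : tau x 1%g a = 1.
Proof. by have [] := ncocycle_normalized tau x a. Qed.
Let tau1r x a : tau x a 1%g = 1.
Proof. by have [] := ncocycle_normalized tau x a. Qed.
Let tauV x a : tau x a^-1%g a = tau x a a^-1%g.
Proof. by have := tau_cocycle x a a^-1%g a; rewrite mulgV mulVg tau1l tau1r !mulr1. Qed.

Lemma crossed_comulE (W : zmodType) (f : crossed -> crossed -> W) u :
  \sum_(i <- crossed_comul u) f i.1 i.2
  = \sum_x \sum_a \sum_b
      f ((tau x a b * u ((a * b)%g, x)) *: sb a x) (sb b x).
Proof. by rewrite big_image /= !pair_big. Qed.

Fact crossed_comul_linear (c : k) u v : tensor_eq (crossed_comul (c *: u + v))
  ([seq (c *: i.1, i.2) | i <- crossed_comul u] ++ crossed_comul v).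
Proof.
move=> W f bf; rewrite big_cat /= !(crossed_comulE f) big_map.
rewrite (crossed_comulE (fun x y => f (c *: x) y)) -big_split /=.
apply: eq_bigr => x _; rewrite -big_split; apply: eq_bigr => a _ /=.
rewrite -big_split; apply: eq_bigr => b _ /=.
rewrite !ffunE scalerA -(bilDl bf) -scalerDl; congr (f (_ *: _) _).
by rewrite mulrDr [c * _]mulrCA.
Qed.

Lemma crossed_comul_eltE (W : lmodType k) (f : crossed -> crossed -> W) c d x :
  bilinear_for *:%R *:%R f ->
  \sum_(i <- crossed_comul (c *: sb d x)) f i.1 i.2
  = \sum_a (c * tau x a (a^-1 * d)%g) *: f (sb a x) (sb (a^-1 * d)%g x).
Proof.
move=> bf; rewrite crossed_comulE (bigD1 x) //= [X in _ + X]big1 ?addr0.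
  apply: eq_bigr => a _; rewrite (bigD1 (a^-1 * d)%g) //= big1 ?addr0.
    rewrite mulKVg !ffunE eqxx mulr1n [c *: 1]mulr1 (bilZl bf).
    by rewrite mulrC.
  move=> b nb; rewrite !ffunE xpair_eqE -(inj_eq (mulgI a^-1%g)) mulKg.
  by rewrite (negPf nb) mulr0n scaler0 mulr0 (bilZl bf) scale0r.
move=> y ny; apply: big1 => a _; apply: big1 => b _.
by rewrite !ffunE xpair_eqE (negPf ny) andbF mulr0n scaler0 mulr0
  (bilZl bf) scale0r.
Qed.

Fact crossed_comulA u : tensor3_eq
  [seq (j.1, j.2, i.2) | i <- crossed_comul u, j <- crossed_comul i.1]
  [seq (i.1, j.1, j.2) | i <- crossed_comul u, j <- crossed_comul i.2].
Proof.
move=> W f tf; rewrite !big_allpairs_dep /=.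
have [l1 l2 l3] := tf.
have bf1 w : bilinear_for *:%R *:%R (fun x y => f x y w).
  by split=> v; [apply: l1|apply: l2].
have bf3 w : bilinear_for *:%R *:%R (f w).
  by split=> v; [apply: l2|apply: l3].
rewrite (crossed_comulE (fun x y => \sum_(j <- crossed_comul x) f j.1 j.2 y)).
rewrite (crossed_comulE (fun x y => \sum_(j <- crossed_comul y) f x j.1 j.2)).
apply: eq_bigr => x _.
under eq_bigr => d _ do under eq_bigr => c _ do
  rewrite (@crossed_comul_eltE _ (fun x y => f x y _)) //.
under [RHS]eq_bigr => a _ do under eq_bigr => d _ do
  rewrite -[X in crossed_comul X]scale1r (@crossed_comul_eltE _ (f _)) //.
under eq_bigr => d _ do rewrite exchange_big /=.
rewrite exchange_big; apply: eq_bigr => a _ /=.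
rewrite (reindex_inj (mulgI a)) /= [RHS](eq_bigr (fun d => \sum_c
  (tau x a d * u ((a * d)%g, x) * tau x c (c^-1 * d)%g)
   *: f (sb a x) (sb c x) (sb (c^-1 * d)%g x))); last first.
  by move=> d _; apply: eq_bigr => c _; rewrite mul1r triZ1 // scalerA mulrC.
rewrite [RHS]exchange_big; apply: eq_bigr => b _ /=.
rewrite [RHS](reindex_inj (mulgI b)); apply: eq_bigr => c _ /=.
rewrite !mulKg !mulgA; congr (_ *: _).
rewrite mulrAC [RHS]mulrAC; congr (_ * _); rewrite mulrC tau_cocycle.
by rewrite mulrC.
Qed.

Lemma crossed_one_sum : (1 : crossed) = \sum_a sb a 1%g.
Proof.
rewrite [LHS]smash_elt_sum; apply: eq_bigr => a _.
rewrite (bigD1 1%g) //= big1 ?addr0 => [|x /negPf nx].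
  by rewrite ffunE eqxx scale1r.
by rewrite ffunE /= nx mulr0n scale0r.
Qed.

Fact crossed_comul1 : tensor_eq (crossed_comul 1) [:: (1, 1)].
Proof.
move=> W f bf; rewrite (crossed_comulE f) big_seq1 /=.
rewrite [X in f X _]crossed_one_sum [X in f _ X]crossed_one_sum (bil_suml bf) (bigD1 1%g) //=.
rewrite [X in _ + X]big1 ?addr0 => [|x /negPf nx]; last first.
  apply: big1 => a _; apply: big1 => b _.
  by rewrite ffunE /= nx mulr0n mulr0 (bilZl bf) scale0r.
apply: eq_bigr => a _; rewrite (bil_sumr bf); apply: eq_bigr => b _.
by rewrite tau1 ffunE eqxx mul1r scale1r.
Qed.

Fact crossed_comulM u v : tensor_eq (crossed_comul (u * v))
  [seq (i.1 * j.1, i.2 * j.2) | i <- crossed_comul u, j <- crossed_comul v].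
Proof.
move=> W f bf; rewrite (crossed_comulE f) !big_allpairs_dep /=.
under [RHS]eq_bigr => i _ do
  rewrite (crossed_comulE (fun x y => f (i.1 * x) (i.2 * y))).
rewrite (crossed_comulE (fun i j => \sum_x \sum_a \sum_b
  f (i * ((tau x a b * v ((a * b)%g, x)) *: sb a x)) (j * sb b x))).
transitivity (\sum_x \sum_a \sum_b \sum_y
  (tau (x * y)%g a b * (u ((a * b)%g, x) * v (to (a * b)%g x, y)))
  *: f (sb a (x * y)%g) (sb b (x * y)%g)).
  under eq_bigr => z _ do under eq_bigr => a _ do under eq_bigr => b _ do
    rewrite (bilZl bf) ffunE mulr_sumr scaler_suml.
  under eq_bigr => z _ do under eq_bigr => a _ do rewrite exchange_big /=.
  under eq_bigr => z _ do rewrite exchange_big /=.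
  rewrite exchange_big; apply: eq_bigr => x _ /=.
  rewrite (reindex_inj (mulgI x)) exchange_big; apply: eq_bigr => a _ /=.
  rewrite exchange_big; apply: eq_bigr => b _ /=.
  by apply: eq_bigr => y _; rewrite mulKg.
apply: eq_bigr => x _; apply: eq_bigr => a _; apply: eq_bigr => b _.
apply: eq_bigr => y _; rewrite (bigD1 (to a x)) //=.
rewrite [X in _ + X]big1 ?addr0 => [|c /negPf nc]; last first.
  apply: big1 => d _; rewrite -scalerAl -scalerAr smash_eltM nc mulr0n.
  by rewrite scale0r !scaler0 -(scale0r 0) (bilZl bf) scale0r.
rewrite (bigD1 (to b x)) //= big1 ?addr0 => [|d /negPf nd]; last first.
  by rewrite smash_eltM nd mulr0n (bilZr bf) scale0r.
rewrite -scalerAl -scalerAr !smash_eltM !eqxx !mulr1n !scale1r !(bilZl bf).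
by rewrite scalerA tauM toMl mulrACA.
Qed.

Fact crossed_counit_linear : scalar crossed_counit.
Proof.
move=> a u v; rewrite /crossed_counit mulr_sumr -big_split.
by apply: eq_bigr => x _; rewrite !ffunE.
Qed.
Lemma crossed_counit_elt c a x : crossed_counit (c *: sb a x) = c * (a == 1%g)%:R.
Proof.
rewrite /crossed_counit (bigD1 x) //= big1 ?addr0 => [|y /negPf ny].
  by rewrite !ffunE xpair_eqE eqxx andbT eq_sym.
by rewrite !ffunE xpair_eqE ny andbF mulr0n scaler0.
Qed.
Fact crossed_counit1 : crossed_counit 1 = 1.
Proof.
rewrite /crossed_counit (bigD1 1%g) //= big1 ?addr0 => [|y /negPf ny].
  by rewrite !ffunE eqxx.
by rewrite !ffunE ny.
Qed.
Fact crossed_counitM : {morph crossed_counit : u v / u * v}.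
Proof.
move=> u v; rewrite /crossed_counit mulr_suml.
under eq_bigr do rewrite ffunE.
rewrite exchange_big; apply: eq_bigr => x _ /=.
rewrite mulr_sumr (reindex_inj (mulgI x)); apply: eq_bigr => y _.
by rewrite mulKg gact1 ?finset.in_setT.
Qed.

Fact crossed_counitl u :
  \sum_(i <- crossed_comul u) crossed_counit i.1 *: i.2 = u.
Proof.
rewrite (crossed_comulE (fun x y => crossed_counit x *: y)).
rewrite [RHS]smash_elt_sum [RHS]exchange_big; apply: eq_bigr => x _ /=.
rewrite (bigD1 1%g) //= [X in _ + X]big1 ?addr0 => [|a /negPf na]; last first.
  by apply: big1 => b _; rewrite crossed_counit_elt na mulr0 scale0r.
by apply: eq_bigr => b _; rewrite crossed_counit_elt eqxx tau1l mulr1 mul1r mul1g.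
Qed.

Fact crossed_counitr u :
  \sum_(i <- crossed_comul u) crossed_counit i.2 *: i.1 = u.
Proof.
rewrite (crossed_comulE (fun x y => crossed_counit y *: x)).
rewrite [RHS]smash_elt_sum [RHS]exchange_big; apply: eq_bigr => x _ /=.
apply: eq_bigr => a _; rewrite (bigD1 1%g) //= big1 ?addr0 => [|b /negPf nb].
  rewrite -[sb 1%g x]scale1r crossed_counit_elt eqxx tau1r mul1r mulg1.
  by rewrite mulr1n scale1r mul1r.
by rewrite -[sb b x]scale1r crossed_counit_elt nb mulr0 scale0r.
Qed.

Fact crossed_antipode_linear : linear crossed_antipode.
Proof.
move=> a u v; apply/ffunP=> b; rewrite !ffunE /=.
have -> i : (a *: u + v) i = a * u i + v i by rewrite !ffunE.
by rewrite mulrDr; congr (_ + _); rewrite [LHS]mulrCA.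
Qed.

Lemma crossed_antipode_elt c a x : crossed_antipode (c *: sb a x)
  = (c * (tau x a a^-1%g)^-1) *: sb (to a x)^-1%g x^-1%g.
Proof.
apply/ffunP=> -[b y]; rewrite !ffunE /=.
have -> i : (c *: sb a x) i = c * (i == (a, x))%:R by rewrite !ffunE.
rewrite !xpair_eqE.
have -> : (y^-1 == x)%g = (y == x^-1)%g by rewrite -(inj_eq invg_inj) invgK.
have [->|_] := eqVneq y x^-1%g; last by rewrite !andbF scaler0 !mulr0.
rewrite invgK !andbT.
have -> : (to b^-1%g x^-1%g == a) = (b == (to a x)^-1%g).
  apply/eqP/eqP=> [<-|->].
    by rewrite -toM mulVg act1 invgK.
  by rewrite invgK -toM mulgV act1.
have [->|_] := eqVneq b _; last by rewrite scaler0 !mulr0.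
by rewrite invgK -toM mulgV act1 /GRing.scale /= !mulr1 mulrC.
Qed.

Fact crossed_antipodel u :
  \sum_(i <- crossed_comul u) crossed_antipode i.1 * i.2
  = (crossed_counit u)%:A.
Proof.
rewrite (crossed_comulE (fun x y => crossed_antipode x * y)) scaler_suml.
apply: eq_bigr => x _; rewrite crossed_one_sum scaler_sumr.
rewrite [RHS](reindex_inj (inj_comp invg_inj (act_inj to x))) /=.
apply: eq_bigr => a _.
rewrite (bigD1 a^-1%g) //= big1 ?addr0 => [|b nb]; last first.
  rewrite crossed_antipode_elt -scalerAl smash_eltM toK.
  by rewrite (negPf nb) mulr0n scale0r scaler0.
rewrite crossed_antipode_elt -scalerAl smash_eltM toK eqxx.
by rewrite mulVg mulgV mulr1n scale1r mulrAC mulfV // mul1r.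
Qed.

Fact crossed_antipoder u :
  \sum_(i <- crossed_comul u) i.1 * crossed_antipode i.2
  = (crossed_counit u)%:A.
Proof.
rewrite (crossed_comulE (fun x y => x * crossed_antipode y)) scaler_suml.
apply: eq_bigr => x _; rewrite crossed_one_sum scaler_sumr.
apply: eq_bigr => a _.
have antE b : crossed_antipode (sb b x)
    = (tau x b b^-1%g)^-1 *: sb (to b x)^-1%g x^-1%g.
  by rewrite -[sb b x]scale1r crossed_antipode_elt mul1r.
rewrite (bigD1 a^-1%g) //= big1 ?addr0 => [|b nb]; last first.
  rewrite antE -scalerAl -scalerAr smash_eltM -toV (inj_eq (act_inj to x)).
  rewrite -(inj_eq invg_inj) invgK (negPf nb).
  by rewrite mulr0n scale0r !scaler0.
rewrite antE -scalerAl -scalerAr smash_eltM -toV invgK eqxx mulgV.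
by rewrite mulgV mulr1n scale1r scalerA mulrAC tauV mulfV // mul1r.
Qed.

HB.instance Definition _ := Algebra_isHopf.Build k crossed
  crossed_comul_linear crossed_comulA crossed_comul1 crossed_comulM
  crossed_counit_linear crossed_counit1 crossed_counitM
  crossed_counitl crossed_counitr
  crossed_antipode_linear crossed_antipodel crossed_antipoder.

End CrossedHopf.

Record extension (k : fieldType) (gT C : finGroupType) := Extension {
  ext_hopf :> hopfAlgType k;
  ext_inc : {lrmorphism fun_alg k gT -> ext_hopf};
  ext_proj : {lrmorphism ext_hopf -> grp_alg k C};
  ext_inc_hopf : hopf_map ext_inc;
  ext_proj_hopf : hopf_map ext_proj;
  ext_inc_inj : injective ext_inc;
  ext_proj_surj : forall v, exists h, ext_proj h = v;
  (* the image of k^G is stable under both adjoint actions *)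
  ext_normal : forall (h : ext_hopf) u,
    (exists v, \sum_(i <- comul h) i.1 * ext_inc u * antipode i.2 = ext_inc v)
    /\
    (exists v, \sum_(i <- comul h) antipode i.1 * ext_inc u * i.2 = ext_inc v);
  ext_ker : forall h : ext_hopf, ext_proj h = 0 <->
    exists2 s : seq (fun_alg k gT * ext_hopf),
      {in s, forall i, counit i.1 = 0} & h = \sum_(i <- s) ext_inc i.1 * i.2
}.

Section Extensions.
Context (k : fieldType) (gT C : finGroupType).
Implicit Types (E : extension k gT C) (to : groupAction [set: C] [set: gT]).

Definition ext_equiv E E' : Prop := exists2 f : {lrmorphism E -> E'},
  hopf_map f /\ bijective f &
  (forall u, f (ext_inc E u) = ext_inc E' u)
  /\ (forall h, ext_proj E' (f h) = ext_proj E h).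

(* The action of C on k^G attached to a (cleft) extension through a
   convolution-invertible right kC-comodule section chi : kC -> E, namely
   x.u = chi(x) u chi(x)^-1; as the elements of C are group-like, convolution
   invertibility means that every chi(x) is a unit. The action on the points
   of G is then read off from (x.u)(a) = u(a <| x). *)
Definition ext_action E to : Prop := exists chi chiV : C -> E, forall x,
  [/\ chi x * chiV x = 1, chiV x * chi x = 1,
      tensor_eq [seq (i.1, ext_proj E i.2) | i <- comul (chi x)]
                [:: (chi x, grp_elt k x)] &
      forall u : fun_alg k gT,
        chi x * ext_inc E u * chiV x = ext_inc E [ffun a => u (to a x)]].

(* to' \in [to] *)
Definition act_class to to' : Prop :=
  exists2 alpha, alpha \in Aut [set: C] & act_equiv to' (twist to alpha).

(* Ext_[to](kC, k^G), the set of equivalence classes. The carriers of Hopf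
   algebras are too large for the universe of [set], hence bare predicates. *)
Definition Ext_class to : (extension k gT C -> Prop) -> Prop := fun X =>
  exists E to', [/\ act_class to to', ext_action E to' & X = ext_equiv E].

(* An isomorphism type is given as the class of all Hopf algebras isomorphic to
   a fixed one. *)
Definition Ext_noncocomm_types to : (hopfAlgType k -> Prop) -> Prop := fun T =>
  exists X E, [/\ Ext_class to X, X E, ~ cocommutative E &
                  T = @hopf_isomorphic k E].

End Extensions.

Arguments Ext_noncocomm_types k [gT C] to _.

Section CrossedExtension.
Context (k : fieldType) (gT C : finGroupType).
Context (to : groupAction [set: C] [set: gT]).
Context (tau : normalized_cocycle k to).
Local Notation H := (crossed_alg tau).
Local Notation sb a x := (smash_elt k to a x : H).

Definition crossed_inc (u : fun_alg k gT) : H := [ffun i => u i.1 * (i.2 == 1%g)%:R].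
Fact crossed_inc_linear : linear crossed_inc.
Proof. move=> c u v; apply/ffunP => i; rewrite !ffunE mulrDl. by congr (_ + _); rewrite [RHS]mulrA. Qed.
Fact crossed_inc_monoid : monoid_morphism crossed_inc.
Proof.
split=> [|u v]; apply/ffunP => -[a z]; rewrite !ffunE /= ?mul1r //.
rewrite (bigD1 1%g) //= big1 => [|x /negPf nx]; last by rewrite !ffunE /= nx !(mulr0,mul0r).
by rewrite !ffunE /= eqxx act1 invg1 mul1g mulr1 addr0 mulrA.
Qed.
HB.instance Definition _ :=
  GRing.isLinear.Build k (fun_alg k gT) H *:%R crossed_inc crossed_inc_linear.
HB.instance Definition _ := GRing.isMonoidMorphism.Build (fun_alg k gT) H crossed_inc crossed_inc_monoid.

Definition crossed_proj (h : H) : grp_alg k C := [ffun x => h (1%g, x)].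
Fact crossed_proj_linear : linear crossed_proj.
Proof. by move=> c u v; apply/ffunP => i; rewrite !ffunE. Qed.
Fact crossed_proj_monoid : monoid_morphism crossed_proj.
Proof.
split=> [|u v]; apply/ffunP => z; rewrite !ffunE //=.
by apply: eq_bigr => x _; rewrite !ffunE gact1 ?finset.in_setT.
Qed.
HB.instance Definition _ := GRing.isLinear.Build k H (grp_alg k C) *:%R crossed_proj crossed_proj_linear.
HB.instance Definition _ := GRing.isMonoidMorphism.Build H (grp_alg k C) crossed_proj crossed_proj_monoid.

Definition crossed_section (x : C) : H := [ffun i => (i.2 == x)%:R].
Lemma crossed_sectionE x : crossed_section x = \sum_a sb a x.
Proof.
apply/ffunP=> -[b y]; rewrite sum_ffunE !ffunE (bigD1 b) //= big1 ?addr0.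
  by rewrite ffunE xpair_eqE eqxx.
by move=> a /negPf na; rewrite ffunE xpair_eqE eq_sym na.
Qed.
Lemma crossed_incE u : crossed_inc u = \sum_a u a *: sb a 1%g.
Proof.
apply/ffunP=> -[b y]; rewrite sum_ffunE !ffunE (bigD1 b) //= big1 ?addr0.
  by rewrite !ffunE xpair_eqE eqxx.
by move=> a /negPf na; rewrite !ffunE xpair_eqE eq_sym na scaler0.
Qed.
Lemma crossed_sectionM x y : crossed_section x * crossed_section y = crossed_section (x * y)%g.
Proof.
apply/ffunP=> -[a z]; rewrite !ffunE (bigD1 x) //= big1 ?addr0.
  by rewrite !ffunE /= eqxx mul1r -(inj_eq (mulgI x)) mulKVg.
by move=> w /negPf nw; rewrite !ffunE /= nw mul0r.
Qed.
Lemma crossed_section_inc x u : crossed_section x * crossed_inc u = crossed_inc [ffun a => u (to a x)] * crossed_section x.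
Proof.
apply/ffunP=> -[a z]; rewrite !ffunE (bigD1 x) //= big1 ?addr0; last first.
  by move=> w /negPf nw; rewrite !ffunE /= nw mul0r.
rewrite [RHS](bigD1 1%g) //= [X in _ + X]big1 ?addr0; last first.
  by move=> w /negPf nw; rewrite !ffunE /= nw mulr0 mul0r.
rewrite !ffunE /= !eqxx mul1r mulr1 invg1 mul1g; congr (_ * _%:R).
by rewrite -eq_mulVg1 eq_sym.
Qed.
Let nt1 x a : tau x a 1%g = 1.
Proof. by have [] := ncocycle_normalized tau x a. Qed.
Let tau1 a b : tau 1%g a b = 1.
Proof.
have [h E] := ncocycle_Z2c tau.
have := E 1%g 1%g a b; rewrite mulg1 !act1 => E'.
apply: (mulfI ((h 1%g).1 a b)); rewrite -E'. by rewrite mulr1.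
Qed.

Lemma crossed_inc_hopf : hopf_map (crossed_inc : {lrmorphism _ -> _}).
Proof.
split=> [u W f bf|u]; last first.
  rewrite /counit /= /crossed_counit (bigD1 1%g) //= big1 ?addr0.
    by rewrite ffunE eqxx mulr1.
  by move=> x /negPf nx; rewrite ffunE /= nx mulr0.
rewrite [LHS](crossed_comulE f) big_map /comul /= (fun_comulE (fun x y => f (crossed_inc x) (crossed_inc y))).
rewrite (bigD1 1%g) //= [X in _ + X]big1 ?addr0; last first.
  move=> x /negPf nx; apply: big1 => a _; apply: big1 => b _.
  by rewrite ffunE /= nx !mulr0 (bilZl bf) scale0r.
apply: eq_bigr => a _; apply: eq_bigr => b _.
have E c : crossed_inc (idem k c) = sb c 1%g.
  by apply/ffunP=> -[d y]; rewrite !ffunE xpair_eqE /=; case: (d == c); rewrite ?mul1r ?mul0r.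
by rewrite linearZ /= !E tau1 ffunE /= eqxx mul1r mulr1.
Qed.

Lemma crossed_proj_hopf : hopf_map (crossed_proj : {lrmorphism _ -> _}).
Proof.
split=> [u W f bf|u]; last first.
  by rewrite /counit /=; apply: eq_bigr => x _; rewrite ffunE.
rewrite [LHS](grp_comulE f) big_map /comul /= (crossed_comulE (fun x y => f (crossed_proj x) (crossed_proj y))).
apply: eq_bigr => x _.
have E a : crossed_proj (sb a x) = (a == 1%g)%:R *: grp_elt k x.
  apply/ffunP=> y; rewrite !ffunE xpair_eqE eq_sym.
  by case: (a == 1%g); rewrite ?scale1r ?scale0r.
rewrite (bigD1 1%g) //= [X in _ + X]big1 ?addr0; last first.
  move=> a /negPf na; apply: big1 => b _.
  by rewrite linearZ /= E na scale0r scaler0 -(scale0r 0) (bilZl bf) scale0r.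
rewrite (bigD1 1%g) //= big1 ?addr0; last first.
  by move=> a /negPf na; rewrite E na (bilZr bf) scale0r.
by rewrite linearZ /= !E eqxx !scale1r ffunE nt1 mul1r mulg1.
Qed.

Lemma crossed_inc_inj : injective crossed_inc.
Proof. by move=> u v /ffunP E; apply/ffunP => a; have := E (a, 1%g); rewrite !ffunE /= eqxx !mulr1. Qed.
Lemma crossed_proj_surj v : exists h, crossed_proj h = v.
Proof. by exists [ffun i => v i.2]; apply/ffunP=> x; rewrite !ffunE. Qed.

Lemma crossed_inc_supp (h : H) : (forall a x, x != 1%g -> h (a, x) = 0) -> exists v, h = crossed_inc v.
Proof.
move=> hs; exists [ffun a => h (a, 1%g)]; apply/ffunP=> -[a x]; rewrite !ffunE /=.
have [->|nx] := eqVneq x 1%g; first by rewrite mulr1.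
by rewrite hs // mulr0.
Qed.
Lemma crossed_antipode_elt1 b x : crossed_antipode (sb b x : H) = (tau x b b^-1%g)^-1 *: sb (to b x)^-1%g x^-1%g.
Proof. by rewrite -[sb b x]scale1r crossed_antipode_elt mul1r. Qed.

(* h lies in the span of the p_a x *)
Definition homog (x : C) (h : H) := forall a y, y != x -> h (a, y) = 0.
Lemma homogM x y h g : homog x h -> homog y g -> homog (x * y)%g (h * g).
Proof.
move=> dh dg a z nz; rewrite ffunE big1 // => w _ /=.
have [E|nw] := eqVneq w x; last by rewrite dh ?mul0r.
rewrite dg ?mulr0 //; apply: contraNneq nz => <-; by rewrite E mulKVg.
Qed.
Lemma homog_elt (a : gT) (x : C) : homog x (sb a x).
Proof. by move=> b y /negPf ny; rewrite ffunE xpair_eqE ny andbF. Qed.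
Lemma homogZ c x h : homog x h -> homog x (c *: h).
Proof. by move=> d a y ny; rewrite ffunE d // scaler0. Qed.
Lemma homog_inc u : homog 1%g (crossed_inc u).
Proof. by move=> a y /negPf ny; rewrite ffunE ny mulr0. Qed.
Lemma homog_sum I (r : seq I) (F : I -> H) x : (forall i, homog x (F i)) -> homog x (\sum_(i <- r) F i).
Proof. by move=> d a y ny; rewrite sum_ffunE big1 // => i _; apply: d. Qed.

Lemma crossed_normal (h : H) u :
    (exists v, \sum_(i <- comul h) i.1 * crossed_inc u * antipode i.2 = crossed_inc v)
    /\
    (exists v, \sum_(i <- comul h) antipode i.1 * crossed_inc u * i.2 = crossed_inc v).
Proof.
split; apply: crossed_inc_supp => a y; move: a y; apply: (_ : homog 1%g _).
  rewrite /comul /antipode /= (crossed_comulE (fun x y => x * crossed_inc u * crossed_antipode y)).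
  apply: homog_sum => x; apply: homog_sum => b; apply: homog_sum => c.
  rewrite crossed_antipode_elt1;
  have := homogM (homogM (homogZ (tau x b c * h ((b*c)%g,x)) (@homog_elt b x)) (homog_inc u)) (homogZ (tau x c c^-1%g)^-1 (@homog_elt (to c x)^-1%g x^-1%g)).
  by rewrite mulg1 mulgV; apply.
rewrite /comul /antipode /= (crossed_comulE (fun x y => crossed_antipode x * crossed_inc u * y)).
apply: homog_sum => x; apply: homog_sum => b; apply: homog_sum => c.
rewrite crossed_antipode_elt;
have := homogM (homogM (homogZ (tau x b c * h ((b*c)%g,x) * (tau x b b^-1%g)^-1) (@homog_elt (to b x)^-1%g x^-1%g)) (homog_inc u)) (@homog_elt c x).
by rewrite mulg1 mulVg; apply.
Qed.

Lemma crossed_ker (h : H) : crossed_proj h = 0 <->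
    exists2 s : seq (fun_alg k gT * H),
      {in s, forall i, counit i.1 = 0} & h = \sum_(i <- s) crossed_inc i.1 * i.2.
Proof.
split=> [ph|[s cs ->]].
  exists [:: (1 - idem k 1%g, h)] => [i|].
    by rewrite inE => /eqP -> /=; rewrite /counit /= /fun_counit !ffunE eqxx subrr.
  rewrite big_seq1 /=; apply/ffunP => -[a z]; rewrite !ffunE (bigD1 1%g) //= big1 ?addr0; last first.
    by move=> w /negPf nw; rewrite !ffunE /= nw mulr0 mul0r.
  rewrite !ffunE /= eqxx mulr1 act1 invg1 mul1g.
  have [->|na] := eqVneq a 1%g; last by rewrite subr0 mul1r.
  by rewrite subrr mul0r; move/ffunP/(_ z): ph; rewrite !ffunE.
rewrite linear_sum /= big_seq big1 // => i /cs ci.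
rewrite [LHS](rmorphM (crossed_proj : {rmorphism _ -> _})).
suff E : crossed_proj (crossed_inc i.1) = 0.
  transitivity (0 * crossed_proj i.2); last by rewrite mul0r.
  by congr (_ * _).
apply/ffunP=> y; rewrite !ffunE /=; by move: ci; rewrite /counit /= /fun_counit => ->; rewrite mul0r.
Qed.

Definition crossed_ext : extension k gT C :=
 @Extension k gT C H crossed_inc crossed_proj crossed_inc_hopf crossed_proj_hopf crossed_inc_inj crossed_proj_surj crossed_normal crossed_ker.

Lemma crossed_ext_action : ext_action crossed_ext to.
Proof.
exists crossed_section, (fun x => crossed_section x^-1%g) => x; split=> [|||u].
- by rewrite crossed_sectionM mulgV.
- by rewrite crossed_sectionM mulVg.
- move=> W f bf; rewrite big_map big_seq1 /= /comul /= (crossed_comulE (fun a b => f a (crossed_proj b))).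
  rewrite {2}crossed_sectionE (bil_suml bf) (bigD1 x) //= [X in _ + X]big1 ?addr0; last first.
    move=> y /negPf ny; apply: big1 => a _; apply: big1 => b _.
    by rewrite ffunE /= ny mulr0 (bilZl bf) scale0r.
  apply: eq_bigr => a _.
  have Ep b : crossed_proj (sb b x) = (b == 1%g)%:R *: grp_elt k x.
    apply/ffunP=> y; rewrite !ffunE xpair_eqE eq_sym.
    by case: (b == 1%g); rewrite ?scale1r ?scale0r.
  rewrite (bigD1 1%g) //= big1 ?addr0; last first.
    by move=> b /negPf nb; rewrite Ep nb (bilZr bf) scale0r.
  by rewrite Ep eqxx scale1r nt1 ffunE eqxx mul1r scale1r.
by rewrite [crossed_section x * _]crossed_section_inc -mulrA crossed_sectionM mulgV mulr1.
Qed.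
End CrossedExtension.

Definition in_bijection (A B : Type) (P : A -> Prop) (Q : B -> Prop) : Prop :=
  exists F : A -> B,
    [/\ forall a, P a -> Q (F a),
        forall a a', P a -> P a' -> F a = F a' -> a = a' &
        forall b, Q b -> exists2 a, P a & F a = b].

(* Main.v *)
From HB Require Import structures.
Require Import Defs.
From mathcomp Require Import all_boot all_fingroup all_algebra.
From mathcomp Require Import cyclic ring.
From mathcomp Require Import boolp classical_sets functions.

(* Let H = H(tau, to). The p_a x with fixed x span a subcoalgebra which is
   cocommutative iff tau(x) is symmetric, i.e. (as k^* is divisible) iff tau(x)
   is a coboundary. If H is not cocommutative, then, C being of prime order, no
   tau(x) with x <> 1 is symmetric, which forces every Hopf map k^G -> H to have its
   image in k^G. So an isomorphism between two such Hopf algebras respects k^G, hence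
   also the quotient kC; it maps x to eta(x) alpha(x) for units eta(x) of k^G, and
   comparing products and coproducts gives (i) and (ii).

   For the bijection one also needs that every extension whose action is to
   is isomorphic to some H(tau, to). Extensions of kC by k^G in general come from a
   matched pair, which has a second action, of G on the set C and fixing 1; its
   orbits on C minus {1} have fewer than p elements and lengths dividing #|G|, so
   it is trivial by the choice of p. *)

Set Implicit Arguments.
Unset Strict Implicit.
Unset Printing Implicit Defensive.

Import GRing.Theory.
Local Open Scope ring_scope.

(** * Linear algebra over a closed field *)

(** The Hopf algebra of an extension comes without a basis or a dimension, and tensors exist only
    through bilinear maps, so an extension must be given coordinates before a cocycle can be read
    off. The coaction of kC grades it by C; its part of degree 1 is identified with k^G, using
    normality and the description of the kernel of pi, and a unit chi(x) of each degree x then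
    yields the basis p_a chi(x). After that, identities between coproducts are compared coefficient
    by coefficient. Algebraic closedness enters twice: through common eigenvectors, which make
    symmetric cocycles coboundaries, and through p-th roots, which make chi multiplicative. *)

(** Induction on the rank of a nonzero subspace V stable under all [L i]: either every [L i] is
    scalar on V, and any nonzero vector of V will do, or some [L i] has an eigenspace meeting V in a
    proper nonzero subspace, which is again stable because the matrices commute. *)
Lemma commuting_eigenvector (k : closedFieldType) n (I : Type)
    (L : I -> 'M[k]_n) :
  (0 < n)%N -> (forall i j, comm_mx (L i) (L j)) ->
  exists2 v : 'rV_n, v != 0 & forall i, exists c, v *m L i = c *: v.
Proof.
move=> n_gt0 Lcomm.
suff H r (V : 'M_n) : (\rank V <= r)%N -> V != 0 ->
    (forall i, stablemx V (L i)) ->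
    exists2 v : 'rV_n, v != 0 & forall i, exists c, v *m L i = c *: v.
  apply: (H n 1%:M) => [||i]; first exact: rank_leq_row.
  - by rewrite -mxrank_eq0 mxrank1 -lt0n.
  - by rewrite stablemx_full ?row_full_unit ?unitmx1.
elim: r V => [|r IH] V rV V0 stV.
  by move: V0; rewrite -mxrank_eq0 -leqn0 rV.
have [scV|/existsNP[i nsc]] := pselect (forall i, exists c, V *m L i = c *: V).
  have /rowV0Pn[j Vj j0] := V0; exists j => // i.
  have [c Vc] := scV i; exists c.
  by have /submxP[D ->] := Vj; rewrite -mulmxA Vc -scalemxAr.
have [a [u u0 ua]] : exists a, exists2 u : 'rV_n, u != 0 &
    (u <= V)%MS && (u *m L i == a *: u).
  have /closed_rootP[a] :
      size (char_poly (row_base V *m L i *m pinvmx (row_base V))) != 1%N.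
    by rewrite size_char_poly eqSS -lt0n lt0n mxrank_eq0.
  rewrite -eigenvalue_root_char => /eigenvalueP[w wa w0].
  exists a, (w *m row_base V).
    by rewrite mulmx_free_eq0 ?row_base_free.
  rewrite mulmx_sub ?eq_row_base //=; apply/eqP.
  by rewrite scalemxAl -wa -[RHS]mulmxA mulmxKpV ?mulmxA ?stablemx_row_base.
case/andP: ua => uV /eqP ua.
pose W := (V :&: eigenspace (L i) a)%MS.
apply: (IH W).
- rewrite -ltnS; apply: leq_trans rV; apply: rank_ltmx.
  rewrite ltmxE capmxSl /= sub_capmx submx_refl /=; apply/negP => /eigenspaceP E.
  by apply: nsc; exists a.
- apply/rowV0Pn; exists u => //; rewrite sub_capmx uV.
  exact/eigenspaceP.
- move=> j; rewrite (submx_trans (capmxMr _ _ _)) // capmxS //.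
  exact: comm_mx_stable_eigenspace.
Qed.

Lemma closed_root_exists (k : closedFieldType) n (z : k) :
  (0 < n)%N -> exists w, w ^+ n = z.
Proof.
move=> n_gt0; have /closed_rootP[w] : size ('X^n - z%:P) != 1%N.
  by rewrite size_XnsubC // eqSS -lt0n.
by rewrite rootE !hornerE subr_eq0 => /eqP; exists w.
Qed.

(* A common eigenvector of the twisted group algebra of s, which is commutative,
   yields a character of it. *)
Lemma sym_cocycle_coboundary (k : closedFieldType) (gT : finGroupType)
    (s : gT -> gT -> k) :
  abelian [set: gT] -> cocycle2 s -> (forall a b, s a b = s b a) ->
  exists2 e : gT -> k, forall a, e a != 0 &
    forall a b, s a b = e a * e b * (e (a * b)%g)^-1.
Proof.
move=> abG [s0 sA] sC.
have mulC (a b : gT) : (a * b = b * a)%g.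
  by apply: (centsP abG); rewrite finset.in_setT.
pose n := #|gT|.
(* Left multiplication by u_a in the twisted group algebra, where u_a u_b = s(a, b) u_{ab}, acting
   on row vectors. *)
pose L a : 'M[k]_n := \matrix_(i, j)
  (s a (enum_val i) * (enum_val j == (a * enum_val i)%g)%:R).
have LM a b : L a *m L b = s b a *: L (b * a)%g.
  apply/matrixP => i j; rewrite !mxE.
  rewrite (bigD1 (enum_rank (a * enum_val i)%g)) //= big1 ?addr0.
    rewrite !mxE enum_rankK eqxx mulr1 !mulgA !mulrA; congr (_ * _).
    by rewrite sA mulrC.
  move=> l nl; rewrite !mxE (_ : enum_val l == _ = false) ?mulr0 ?mul0r //.
  by apply: contraNF nl => /eqP <-; rewrite enum_valK.
have n_gt0 : (0 < n)%N by apply/card_gt0P; exists 1%g.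
have Lcomm a b : comm_mx (L a) (L b) by rewrite /comm_mx !LM sC mulC.
have [v v0 Lv] := commuting_eigenvector n_gt0 Lcomm.
have [e eP] := choice Lv.
have s1 b : s 1%g b = s 1%g 1%g.

  by have := sA 1%g 1%g b; rewrite !mul1g => /(mulIf (s0 1%g b)).
have L1 : L 1%g = (s 1%g 1%g)%:M.
  apply/matrixP => i j; rewrite !mxE mul1g s1 (inj_eq enum_val_inj) eq_sym.
  by case: eqP; rewrite ?mulr1 ?mulr0.
have eM a b : e a * e b = s a b * e (a * b)%g.
  apply/eqP; rewrite -subr_eq0.
  have : (e a * e b - s a b * e (a * b)%g) *: v == 0.
    rewrite scalerBl subr_eq0 -scalerA -eP scalemxAl -eP -mulmxA LM.
    by rewrite -scalemxAr eP scalerA sC mulC.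
  by rewrite scaler_eq0 (negPf v0) orbF.
have e1 : e 1%g = s 1%g 1%g.
  apply/eqP; rewrite -subr_eq0.
  have : (e 1%g - s 1%g 1%g) *: v == 0.
    by rewrite scalerBl subr_eq0 -eP L1 mul_mx_scalar.
  by rewrite scaler_eq0 (negPf v0) orbF.
have e0 a : e a != 0.
  have : e a * e a^-1%g != 0 by rewrite eM mulgV e1 mulf_neq0.
  by apply: contraNneq => ->; rewrite mul0r.
by exists e => // a b; rewrite eM mulfK.
Qed.

(** V may be infinite-dimensional, so Zorn's lemma takes the place of a basis: a maximal subspace A
    avoiding v satisfies V = A + k v, and the coefficient of v is the form. *)
Lemma linear_form_neq0 (k : fieldType) (V : lmodType k) (v : V) :
  v != 0 -> exists2 l : V -> k, scalar l & l v != 0.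
Proof.
move=> v0.
(* The empty set satisfies [P], as it must, being the union of the empty chain; that A contains 0
   then comes from maximality. *)
pose P (A : set V) := (forall c x y, A x -> A y -> A (c *: x + y)) /\ ~ A v.
have [A [[Alin Av] Amax]] : exists A, P A /\ forall B, (A `<` B)%classic -> ~ P B.
  apply: Zorn_bigcup => F FP Ftot; split=> [c x y [X FX Xx] [Y FY Yy]|[X FX Xv]].
    have [XY|YX] := Ftot _ _ FX FY.
      by exists Y => //; apply: (FP _ FY).1 => //; apply: XY.
    by exists X => //; apply: (FP _ FX).1 => //; apply: YX.
  by have [_] := FP _ FX; apply.
have A0 : A 0.
  apply: contrapT => nA0.
  have nA x : ~ A x by move=> Ax; apply: nA0; rewrite -(subrr x) addrC -scaleN1r; apply: Alin.
  apply: (Amax [set 0]%classic).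
    by split=> [x /nA //|/(_ 0 erefl)/nA].
  split=> [c x y -> ->|/esym vz]; first by rewrite scaler0 addr0.
  by rewrite -vz eqxx in v0.
have AZ c x : A x -> A (c *: x) by move=> Ax; rewrite -[_ *: x]addr0; apply: Alin.
have AD x y : A x -> A y -> A (x + y) by rewrite -{2}[x]scale1r; apply: Alin.
have dec w : exists c, A (w - c *: v).
  apply: contrapT => /forallNP nw.
  have nAw : ~ A w by move=> Aw; apply: (nw 0); rewrite scale0r subr0.
  apply: (Amax [set x | exists c, A (x - c *: w)]%classic).
    split=> [x Ax|/(_ w)]; first by exists 0; rewrite scale0r subr0.
    by move=> /(_ _)/nAw; apply; exists 1; rewrite scale1r subrr.
  split=> [c x y [d Ad] [e Ae]|[c Ac]].
    exists (c * d + e); rewrite scalerDl -scalerA opprD addrACA -scalerBr.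
    exact: Alin.
  have [c0|c0] := eqVneq c 0; first by apply: Av; move: Ac; rewrite c0 scale0r subr0.
  apply: (nw c^-1); rewrite (_ : _ - _ = - c^-1 *: (v - c *: w)); first exact: AZ.
  by rewrite scalerBr !scaleNr scalerA mulVf // scale1r opprK addrC.
have [l lP] := choice dec.
have uni w c d : A (w - c *: v) -> A (w - d *: v) -> c = d.
  move=> Ac Ad; apply/eqP; rewrite -subr_eq0; apply/negP => cd; apply: Av.
  rewrite (_ : v = (c - d)^-1 *: (- 1 *: (w - c *: v) + (w - d *: v))).
    by apply: AZ; apply: Alin.
  rewrite scaleN1r opprB addrA subrK -scalerBl scalerA mulVf ?scale1r //.
  exact/negP.
exists l.
  move=> c x y; apply: (uni (c *: x + y)) (lP _) _.
  rewrite scalerDl -scalerA opprD addrACA -scalerBr; exact: Alin.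
rewrite (uni v (l v) 1) ?oner_neq0 //; last by rewrite scale1r subrr.
Qed.

(** * Hopf algebra isomorphisms *)

Section HopfIsomorphism.
Context (k : fieldType).
Implicit Types H K L : hopfAlgType k.

Lemma bilinear_comp (U V U' V' W : lmodType k) (f : U -> V -> W)
    (g : U' -> U) (h : V' -> V) :
  bilinear_for *:%R *:%R f -> linear g -> linear h ->
  bilinear_for *:%R *:%R (fun u v => f (g u) (h v)).
Proof.
move=> bf lg lh; split=> [v c u u'|u c v v'] /=.
  by rewrite lg (bilDl bf) (bilZl bf).
by rewrite lh (bilDr bf) (bilZr bf).
Qed.

Lemma hopf_isomorphicI H K (f : H -> K) : linear f -> monoid_morphism f ->
  (forall h, tensor_eq (comul (f h)) [seq (f i.1, f i.2) | i <- comul h]) ->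
  (forall h, counit (f h) = counit h) -> bijective f -> hopf_isomorphic H K.
Proof.
move=> flin fmon fcomul fcounit fbij.
pose g : {lrmorphism H -> K} := HB.pack f
  (GRing.isLinear.Build k H K *:%R f flin)
  (GRing.isMonoidMorphism.Build H K f fmon).
by exists g.
Qed.

Lemma hopf_isomorphic_refl H : hopf_isomorphic H H.
Proof.
apply: (@hopf_isomorphicI H H id) => //; last by exists id.
by move=> h W f bf; rewrite big_map.
Qed.

Lemma hopf_isomorphic_sym H K : hopf_isomorphic H K -> hopf_isomorphic K H.
Proof.
case=> f [fcomul fcounit] [g fK gK]; apply: (@hopf_isomorphicI K H g).
- exact: can2_linear fK gK.
- exact: can2_monoid_morphism fK gK.
- move=> h W B bB; rewrite -{2}[h]gK big_map /=.
  rewrite (fcomul (g h) _ (fun x y => B (g x) (g y))) ?big_map /=.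
    by apply: eq_bigr => i _; rewrite !fK.
  by apply: bilinear_comp => //; apply: can2_linear fK gK.
- by move=> h; rewrite -[in RHS](gK h) fcounit.
- by exists f.
Qed.

Lemma hopf_map_comp H K L (f : {lrmorphism H -> K}) (g : {lrmorphism K -> L}) :
  hopf_map f -> hopf_map g -> hopf_map (g \o f : {lrmorphism H -> L}).
Proof.
move=> [fcomul fcounit] [gcomul gcounit]; split=> [h W B bB|h]; last first.
  by rewrite /= gcounit fcounit.
rewrite (gcomul _ _ _ bB) !big_map /=.
rewrite (fcomul h _ (fun x y => B (g x) (g y))) ?big_map //.
by apply: bilinear_comp => //; apply: linearP.
Qed.

Lemma hopf_isomorphic_trans H K L :
  hopf_isomorphic H K -> hopf_isomorphic K L -> hopf_isomorphic H L.
Proof.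
case=> f fH fbij [g gH gbij].
by exists (g \o f : {lrmorphism H -> L}); [exact: hopf_map_comp|exact: bij_comp].
Qed.

Lemma hopf_isomorphic_types H K : hopf_isomorphic H K ->
  @hopf_isomorphic k H = @hopf_isomorphic k K.
Proof.
move=> HK; apply/funext => L; apply/propext; split.
  by apply: hopf_isomorphic_trans; apply: hopf_isomorphic_sym.
exact: hopf_isomorphic_trans.
Qed.

Lemma cocommutative_iso H K :
  hopf_isomorphic H K -> cocommutative H -> cocommutative K.
Proof.
case=> f [fcomul _] [g _ gK] cH h W B bB.
have bB' : bilinear_for *:%R *:%R (fun x y => B y x) by split; [exact: bB.2|exact: bB.1].
rewrite -[h]gK big_map (fcomul _ _ _ bB) (fcomul _ _ _ bB') !big_map /=.
rewrite (cH (g h) _ (fun x y => B (f x) (f y))) ?big_map //.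
by apply: bilinear_comp => //; apply: linearP.
Qed.

End HopfIsomorphism.

(** * Cocycles and the action of pairs of automorphisms *)

Lemma AutTP (gT : finGroupType) (l : {perm gT}) :
  reflect {morph l : a b / (a * b)%g} (l \in Aut [set: gT]).
Proof.
rewrite inE; apply: (iffP andP) => [[_ /morphicP lM] a b|lM].
  by apply: lM; rewrite finset.in_setT.
split; last by apply/morphicP => a b _ _; exact: lM.
by apply/fintype.subsetP => a _; rewrite finset.in_setT.
Qed.

Section Cohomology.
Context (k : fieldType) (gT C : finGroupType).
Implicit Types (to : groupAction [set: C] [set: gT]).
Implicit Types (l m : {perm gT}) (alpha beta : {perm C}).
Implicit Types (tau : cochain k gT C) (eta : C -> gT -> k).

Lemma isomsP (to to' : gT -> C -> gT) l :
  reflect ({morph l : a b / (a * b)%g} /\ forall a x, l (to a x) = to' (l a) x)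
          (l \in isoms to to').
Proof.
rewrite inE; apply: (iffP andP) => -[/AutTP lM H]; split=> //.
  by move=> a x; apply/eqP; move/forallP/(_ a)/forallP: H; apply.
by apply/forallP => a; apply/forallP => x; apply/eqP.
Qed.

(** With the inverses and identities below, the pairs (l, alpha) become the arrows of a groupoid
    whose objects are the actions. Composition is from left to right, as for permutations. *)
Lemma isoms_mul to to' to'' l m alpha beta :
  l \in isoms to (twist to' alpha) -> m \in isoms to' (twist to'' beta) ->
  (l * m)%g \in isoms to (twist to'' (alpha * beta)%g).
Proof.
move=> /isomsP[lM lE] /isomsP[mM mE]; apply/isomsP; split=> [a b|a x].
  by rewrite !permM lM mM.
by rewrite !permM lE /twist mE /twist permM.
Qed.

Lemma isoms_inv to to' l alpha : l \in isoms to (twist to' alpha) ->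
  (l^-1)%g \in isoms to' (twist to alpha^-1%g).
Proof.
move=> /isomsP[lM lE]; apply/isomsP; split=> [a b|a x].
  by apply: (@perm_inj _ l); rewrite lM !permKV.
by apply: (@perm_inj _ l); rewrite permKV lE /twist !permKV.
Qed.

Lemma isoms1 to : 1%g \in isoms to (twist to 1%g).
Proof. by apply/isomsP; split=> [a b|a x]; rewrite /twist !perm1. Qed.

Lemma act_pairM tau l m alpha beta : act_pair m beta (act_pair l alpha tau)
  = act_pair (l * m)%g (alpha * beta)%g tau.
Proof.
apply/funext => x; apply/funext => a; apply/funext => b.
by rewrite /act_pair /act_Aut /act_perm !invMg !permM.
Qed.

Lemma act_pair1 tau : act_pair 1%g 1%g tau = tau.
Proof.
apply/funext => x; apply/funext => a; apply/funext => b.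
by rewrite /act_pair /act_Aut /act_perm !invg1 !perm1.
Qed.

Lemma act_pairK tau l alpha :
  act_pair l^-1%g alpha^-1%g (act_pair l alpha tau) = tau.
Proof. by rewrite act_pairM !mulgV act_pair1. Qed.

Lemma act_pairKV tau l alpha :
  act_pair l alpha (act_pair l^-1%g alpha^-1%g tau) = tau.
Proof. by rewrite act_pairM !mulVg act_pair1. Qed.

(** These are the 1-cocycles of C with values in the units of k^G; their images under [deltaG] form
    [B2c]. *)
Definition cochain1 to eta :=
  (forall x a, eta x a != 0) /\
  (forall x y a, eta (x * y)%g a = eta x a * eta y (to a x)).

Lemma cochain1_one to : cochain1 to (fun _ _ => 1).
Proof. by split=> *; rewrite ?oner_neq0 ?mulr1. Qed.

Lemma cochain1_div to eta eta' : cochain1 to eta -> cochain1 to eta' ->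
  cochain1 to (fun x a => eta x a / eta' x a).
Proof.
move=> [e0 eM] [e0' eM']; split=> [x a|x y a].
  by rewrite mulf_neq0 ?invr_eq0.
by rewrite eM eM' invfM mulrACA.
Qed.

Lemma deltaG_div eta eta' x a b :
  deltaG (fun x a => eta x a / eta' x a) x a b
  = deltaG eta x a b / deltaG eta' x a b.
Proof. by rewrite /deltaG !invfM !invrK; ring. Qed.

Lemma deltaG_neq0 eta x a b : (forall x a, eta x a != 0) ->
  deltaG eta x a b != 0.
Proof. by move=> e0; rewrite !mulf_neq0 ?invr_eq0. Qed.

Lemma deltaG1 x a b : @deltaG k gT C (fun _ _ => 1) x a b = 1.
Proof. by rewrite /deltaG invr1 !mulr1. Qed.

Lemma cocycle_classP to tau tau' :
  cocycle_class to tau = cocycle_class to tau' <->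
  exists2 eta, cochain1 to eta &
    forall x a b, tau' x a b = tau x a b * deltaG eta x a b.
Proof.
split=> [E|[eta eta1 E]].
  have : cocycle_class to tau' tau'.
    exists (deltaG (fun _ _ => 1)).
      by exists (fun _ _ => 1); have [] := cochain1_one to.
    apply/funext => x; apply/funext => a; apply/funext => b.
    by rewrite deltaG1 mulr1.
  rewrite -E => -[s [eta [e0 eM ->]] <-]; exists eta => //.
apply/seteqP; split=> _ [s [eta' [e0 eM ->]] <-].
  have [d0 dM] := cochain1_div (conj e0 eM) eta1.
  exists (deltaG (fun x a => eta' x a / eta x a)).
    by exists (fun x a => eta' x a / eta x a).
  apply/funext => x; apply/funext => a; apply/funext => b.
  have nz := @deltaG_neq0 eta x a b eta1.1.
  by rewrite deltaG_div E; field; exact: nz.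
have [d0 dM] := cochain1_div (cochain1_one to) eta1.
have [f0 fM] := cochain1_div (conj e0 eM) (conj d0 dM).
exists (deltaG (fun x a => eta' x a / (1 / eta x a))).
  by exists (fun x a => eta' x a / (1 / eta x a)).
apply/funext => x; apply/funext => a; apply/funext => b.
by rewrite !deltaG_div E deltaG1; field; rewrite (deltaG_neq0 _ _ _ eta1.1) oner_neq0.
Qed.

Lemma cochain1_act to to' l alpha eta : l \in isoms to (twist to' alpha) ->
  alpha \in Aut [set: C] -> cochain1 to eta ->
  cochain1 to' (fun x a => eta ((alpha^-1)%g x) ((l^-1)%g a)).
Proof.
move=> /isoms_inv/isomsP[_ lE] Aa [e0 eM]; split=> // x y a.
have /AutTP -> : (alpha^-1)%g \in Aut [set: C] by rewrite groupV.
by rewrite eM lE.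
Qed.

Lemma act_pair_delta l alpha eta : l \in Aut [set: gT] ->
  act_pair l alpha (deltaG eta)
  = deltaG (fun x a => eta ((alpha^-1)%g x) ((l^-1)%g a)).
Proof.
move=> Al; apply/funext => x; apply/funext => a; apply/funext => b.
have /AutTP lM : (l^-1)%g \in Aut [set: gT] by rewrite groupV.
by rewrite /act_pair /act_Aut /act_perm /deltaG lM.
Qed.

Lemma isoms_Aut (to to' : gT -> C -> gT) l :
  l \in isoms to to' -> l \in Aut [set: gT].
Proof. by rewrite inE => /andP[]. Qed.

Lemma B2c_act to to' l alpha tau : l \in isoms to (twist to' alpha) ->
  alpha \in Aut [set: C] -> B2c to tau -> B2c to' (act_pair l alpha tau).
Proof.
move=> li Aa [eta [e0 eM ->]]; rewrite act_pair_delta ?(isoms_Aut li) //.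
have [d0 dM] := cochain1_act li Aa (conj e0 eM).
by exists (fun x a => eta ((alpha^-1)%g x) ((l^-1)%g a)).
Qed.

Lemma cocycle_class_act to to' l alpha tau :
  l \in isoms to (twist to' alpha) -> alpha \in Aut [set: C] ->
  (act_pair l alpha @` cocycle_class to tau)%classic
  = cocycle_class to' (act_pair l alpha tau).
Proof.
move=> li Aa; apply/seteqP; split=> [_ [_ [s Bs <-] <-]|_ [s Bs <-]].
  by exists (act_pair l alpha s) => //; exact: B2c_act Bs.
exists (fun x a b => tau x a b * act_pair l^-1%g alpha^-1%g s x a b).
  exists (act_pair l^-1%g alpha^-1%g s) => //.
  by apply: B2c_act Bs; rewrite ?groupV // isoms_inv.
rewrite -{2}[s](act_pairKV _ l alpha); apply/funext => x; apply/funext => a.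
by apply/funext => b.
Qed.

Lemma Z2c_act to to' l alpha tau : l \in isoms to (twist to' alpha) ->
  alpha \in Aut [set: C] -> Z2c to tau -> Z2c to' (act_pair l alpha tau).
Proof.
move=> li Aa [tc tM].
have /isomsP[lM lE] := isoms_inv li.
have /AutTP aM : (alpha^-1)%g \in Aut [set: C] by rewrite groupV.
rewrite /act_pair /act_Aut /act_perm; split=> [x|x y a b].
  split=> [a b|a b c]; first exact: (tc _).1.
  by rewrite !lM (tc _).2.
by rewrite aM tM !lE.
Qed.

Lemma B2cc_act to to' l alpha tau : l \in isoms to (twist to' alpha) ->
  alpha \in Aut [set: C] -> B2cc to tau -> B2cc to' (act_pair l alpha tau).
Proof.
move=> li Aa [Zt [eta [e0 Et]]]; split; first exact: Z2c_act Zt.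
exists (fun x a => eta ((alpha^-1)%g x) ((l^-1)%g a)).
by rewrite Et act_pair_delta // (isoms_Aut li).
Qed.

Lemma normalized_act l alpha tau : l \in Aut [set: gT] ->
  normalized tau -> normalized (act_pair l alpha tau).
Proof.
move=> Al nt x a; have /AutTP lM : (l^-1)%g \in Aut [set: gT] by rewrite groupV.
have l1 : (l^-1)%g 1%g = 1%g by apply: (mulgI ((l^-1)%g 1%g)); rewrite -lM !mulg1.
by rewrite /act_pair /act_Aut /act_perm l1; exact: nt.
Qed.

Lemma Z2c_delta to tau eta : cochain1 to eta -> Z2c to tau ->
  Z2c to (fun x a b => tau x a b * deltaG eta x a b).
Proof.
move=> [e0 eM] [tc tM]; split=> [x|x y a b].
  split=> [a b|a b c]; first by rewrite mulf_neq0 ?(tc x).1 ?deltaG_neq0.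
  rewrite mulrACA [RHS]mulrACA (tc x).2 /deltaG mulgA; congr (_ * _).
  by field; rewrite !e0.
by rewrite /deltaG !eM toMl tM; field; rewrite !e0.
Qed.

End Cohomology.

(** * Orbits and the Hopf algebras H(tau, to) *)

Section Orbits.
Context (k : fieldType) (gT C : finGroupType).
Context (to : groupAction [set: C] [set: gT]).
Implicit Types (l : {perm gT}) (alpha : {perm C}) (c : set (cochain k gT C)).

(** Both cases of the definition get the same description. For a trivial action, every automorphism
    of G is equivariant for every alpha. Otherwise let r be the representative chosen in I(to,
    to^alpha): as l r^-1 lies in I(to, to), l is a product of two generators of [calG]. *)
Lemma calG_orbitP c c' : calG_orbit to c c' <->
  exists l alpha, [/\ alpha \in Aut [set: C], l \in isoms to (twist to alpha) &
    c' = (act_pair l alpha @` c)%classic].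
Proof.
rewrite /calG_orbit; case: (boolP (trivial_act to)) => [/forallP triv|ntriv];
  split=> -[l [alpha]].
- case=> /andP[/AutTP lM Aa] ->; exists l, alpha; split=> //.
  apply/isomsP; split=> // a x.
  by rewrite /twist !(eqP (forallP (triv _) _)).
- case=> Aa li ->; exists l, alpha.
  by rewrite (isoms_Aut li) Aa.
- case=> /and3P[_ Aa li] ->; exists l, alpha; split=> //.
  by move: Aa; rewrite inE => /andP[].
case=> Aa li ->; exists l, alpha; rewrite li andbT; split=> //.
have st : alpha \in twist_stab to.
  rewrite inE Aa; apply/set0Pn; exists (l^-1)%g.
  have /isomsP[lM lE] := isoms_inv li; apply/isomsP; split=> // a x.
  by rewrite /twist lE /twist permK.
rewrite st andbT; pose r := repr (isoms to (twist to alpha)).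
have ri : r \in isoms to (twist to alpha) by apply: (mem_repr l).
rewrite -[l](mulgKV r); apply: groupM; apply: mem_gen; rewrite finset.in_setU.
  have := isoms_mul li (isoms_inv ri).
  rewrite mulgV => /isomsP[lM lE]; apply/orP; left; apply/isomsP.
  by split=> // a x; rewrite lE /twist perm1.
by apply/orP; right; apply/imsetP; exists alpha.
Qed.

Lemma calG_orbit_refl c : calG_orbit to c c.
Proof.
apply/calG_orbitP; exists 1%g, 1%g; split; rewrite ?group1 ?isoms1 //.
apply/seteqP; split=> [t ct|_ [t ct <-]]; last by rewrite act_pair1.
by exists t => //; rewrite act_pair1.
Qed.

Lemma calG_orbit_sub c c' :
  calG_orbit to c c' -> (calG_orbit to c' `<=` calG_orbit to c)%classic.
Proof.
move=> /calG_orbitP[l [alpha [Aa li ->]]] _ /calG_orbitP[m [beta [Ab mi ->]]].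
apply/calG_orbitP; exists (l * m)%g, (alpha * beta)%g; split.
- exact: groupM.
- exact: isoms_mul mi.
apply/seteqP; split=> [_ [_ [t ct <-] <-]|_ [t ct <-]].
  by exists t => //; rewrite act_pairM.
by exists (act_pair l alpha t); [exists t|rewrite act_pairM].
Qed.

Lemma calG_orbit_sym c c' : calG_orbit to c c' -> calG_orbit to c' c.
Proof.
move=> /calG_orbitP[l [alpha [Aa li ->]]].
apply/calG_orbitP; exists (l^-1)%g, (alpha^-1)%g; split.
- by rewrite groupV.
- exact: isoms_inv.
apply/seteqP; split=> [t ct|_ [_ [t ct <-] <-]]; last by rewrite act_pairK.
by exists (act_pair l alpha t); [exists t|rewrite act_pairK].
Qed.

Lemma calG_orbit_eq c c' : calG_orbit to c c' -> calG_orbit to c = calG_orbit to c'.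
Proof.
move=> cc'; apply/seteqP; split; apply: calG_orbit_sub => //.
exact: calG_orbit_sym.
Qed.

(** The cocycle identity makes tau(x, 1, a) and tau(x, a, 1) equal to tau(x, 1, 1), so the
    coboundary of the constant functions tau(x, 1, 1)^-1 normalizes tau. They satisfy [cochain1]
    because the action fixes 1. *)
Lemma normalize_cocycle tau : Z2c to tau ->
  exists tau' : normalized_cocycle k to, cocycle_class to tau' = cocycle_class to tau.
Proof.
move=> Zt; have [tc tM] := Zt.
pose eta (x : C) (a : gT) := (tau x 1%g 1%g)^-1.
have eta1 : cochain1 to eta.
  split=> [x a|x y a]; first by rewrite invr_eq0 (tc x).1.
  by rewrite /eta tM invfM gact1 ?finset.in_setT.
have t1 x a : tau x 1%g a = tau x 1%g 1%g.
  by have := (tc x).2 1%g 1%g a; rewrite !mul1g => /(mulIf ((tc x).1 1%g a)).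
have t2 x a : tau x a 1%g = tau x 1%g 1%g.
  by have := (tc x).2 a 1%g 1%g; rewrite !mulg1 => /(mulIf ((tc x).1 a 1%g)).
have nt : normalized (fun x a b => tau x a b * deltaG eta x a b).
  move=> x a; rewrite /deltaG /eta (t1 x a) (t2 x a).
  by split; field; rewrite (tc x).1 oner_neq0.
exists (NormalizedCocycle (Z2c_delta eta1 Zt) nt).
by apply/esym/cocycle_classP; exists eta.
Qed.

(** The pairs preserve [B2cc], so an orbit lies in [H2cc] as soon as one of its classes does; and
    [B2cc] is stable under multiplication by [B2c]. *)
Lemma noncc_orbitP tau : Z2c to tau ->
  ~ (calG_orbit to (cocycle_class to tau) `<=` @H2cc k gT C to)%classic <-> ~ B2cc to tau.
Proof.
move=> Zt; split=> [H Bt|nB H]; [apply: H|apply: nB].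
  move=> _ /calG_orbitP[l [alpha [Aa li ->]]]; exists (act_pair l alpha tau).
    exact: B2cc_act Bt.
  by rewrite (cocycle_class_act _ li).
have [t [_ [eta [e0 Et]]]] := H _ (@calG_orbit_refl _).
case/cocycle_classP=> eta' [e0' _] E; split=> //.
exists (fun x a => eta x a * eta' x a); split=> [x a|]; first by rewrite mulf_neq0.
apply/funext => x; apply/funext => a; apply/funext => b.
by rewrite E Et /deltaG; field; rewrite ?e0 ?e0'.
Qed.

End Orbits.

(** * Isomorphisms and cocommutativity of the algebras H(tau, to) *)

Section CrossedAlgebras.
Context (k : fieldType) (gT C : finGroupType).

(** The isomorphism sends p_a x to eta(alpha x, l a) p_{l a} alpha(x). It respects products because
    eta is a 1-cocycle, coproducts by the relation between tau and tau', and counits because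
    normalization forces eta(x, 1) = 1. *)
Lemma crossed_isomorphic (to to' : groupAction [set: C] [set: gT])
    (tau : normalized_cocycle k to) (tau' : normalized_cocycle k to')
    (l : {perm gT}) (alpha : {perm C}) (eta : C -> gT -> k) :
  alpha \in Aut [set: C] -> l \in isoms to (twist to' alpha) ->
  cochain1 to' eta ->
  (forall x a b, tau' x a b = act_pair l alpha tau x a b * deltaG eta x a b) ->
  hopf_isomorphic (crossed_alg tau) (crossed_alg tau').
Proof.
move=> /[dup] Aa /AutTP aM /[dup] li /isomsP[lM lE] [e0 eM] tE.
have /AutTP aVM : (alpha^-1)%g \in Aut [set: C] by rewrite groupV.
have /isomsP[lVM lVE] := isoms_inv li.
have e1 a : eta 1%g a = 1.
  have := eM 1%g 1%g a; rewrite mulg1 act1 => E.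
  by apply: (mulfI (e0 1%g a)); rewrite -E mulr1.
have a1 : (alpha^-1)%g 1%g = 1%g.
  by apply: (mulgI ((alpha^-1)%g 1%g)); rewrite -aVM !mulg1.
have l1 : (l^-1)%g 1%g = 1%g.
  by apply: (mulgI ((l^-1)%g 1%g)); rewrite -lVM !mulg1.
have tn x a : tau' x 1%g a = 1 by have [] := ncocycle_normalized tau' x a.
have tn' x a : tau x 1%g a = 1 by have [] := ncocycle_normalized tau x a.
have en x : eta x 1%g = 1.
  have := tE x 1%g 1%g; rewrite tn /act_pair /act_Aut /act_perm l1 tn' mul1r.
  by rewrite /deltaG mulg1 mulfK.
pose f (h : crossed_alg tau) : crossed_alg tau' :=
  [ffun i => eta i.2 i.1 * h ((l^-1)%g i.1, (alpha^-1)%g i.2)].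
have fE c a x : f (c *: (smash_elt k to a x : crossed_alg tau)) =
    (c * eta (alpha x) (l a)) *: (smash_elt k to' (l a) (alpha x) : crossed_alg tau').
  apply/ffunP => -[b y]; rewrite !ffunE !xpair_eqE /=.
  rewrite -[b == _](can_eq (permK l^-1%g)) -[y == _](can_eq (permK alpha^-1%g)) !permK.
  have [E1|_] := eqVneq _ a; last by rewrite /= !scaler0 !mulr0.
  have [E2|_] := eqVneq _ x; last by rewrite !andbF !scaler0 !mulr0.
  rewrite -E1 -E2 !permKV /GRing.scale /= !mulr1; exact: mulrC.
have flin : linear f.
  move=> c u v; apply/ffunP => i; rewrite !ffunE.
  by rewrite mulrDr; congr (_ + _); rewrite [LHS]mulrCA.
apply: (@hopf_isomorphicI _ (crossed_alg tau) (crossed_alg tau') f) => //.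
- split=> [|u v]; apply/ffunP=> -[a z]; rewrite !ffunE /=.
    rewrite -[(alpha^-1)%g z == _](inj_eq (@perm_inj _ alpha)) permKV.
    rewrite (_ : alpha 1%g = 1%g); last by rewrite -a1 permKV.
    by case: eqP => [->|_]; rewrite ?e1 ?mulr1 ?mulr0.
  rewrite mulr_sumr (reindex_inj (@perm_inj _ alpha^-1%g)); apply: eq_bigr => y _ /=.
  rewrite !ffunE /= -{1}[z](mulKVg y) eM lVE /twist aVM.
  have -> : ((alpha^-1)%g y^-1%g = ((alpha^-1)%g y)^-1)%g.
    by apply: (mulgI ((alpha^-1)%g y)); rewrite -aVM !mulgV.
  by ring.
- move=> h W B bB; rewrite [LHS](crossed_comulE B) big_map /=.
  rewrite (crossed_comulE (fun x y => B (f x) (f y))).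
  rewrite (reindex_inj (@perm_inj _ alpha)); apply: eq_bigr => x _ /=.
  rewrite (reindex_inj (@perm_inj _ l)); apply: eq_bigr => a _ /=.
  rewrite (reindex_inj (@perm_inj _ l)); apply: eq_bigr => b _ /=.
  rewrite fE -[in RHS](scale1r (smash_elt _ _ b x)) fE mul1r (bilZr bB) !(bilZl bB).
  rewrite scalerA; congr (_ *: _); rewrite tE !ffunE /=.
  rewrite /act_pair /act_Aut /act_perm /deltaG -!lM !permK.
  by field; rewrite e0.
- move=> h; rewrite /counit /= /crossed_counit.
  rewrite (reindex_inj (@perm_inj _ alpha)); apply: eq_bigr => x _ /=.
  by rewrite ffunE /= en mul1r l1 permK.
pose g (h : crossed_alg tau') : crossed_alg tau :=
  [ffun i => (eta (alpha i.2) (l i.1))^-1 * h (l i.1, alpha i.2)].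
exists g => h; apply/ffunP => -[a x]; rewrite !ffunE /=.
  by rewrite !permK mulKf.
by rewrite !permKV mulVKf.
Qed.

(** Products of two coordinate functions are the bilinear maps used from here on to turn equalities
    of coproducts into equalities of scalars. *)
Lemma crossed_comul_coef (to : groupAction [set: C] [set: gT])
    (tau : normalized_cocycle k to) (h : crossed_alg tau) x a y b :
  \sum_(i <- comul h) (i.1 : smash_alg k to) (a, x) * (i.2 : smash_alg k to) (b, y)
  = (x == y)%:R * (tau x a b * h ((a * b)%g, x)).
Proof.
pose ev (i : gT * C) (h : crossed_alg tau) : k := (h : smash_alg k to) i.
rewrite [LHS](crossed_comulE (fun u v => ev (a, x) u * ev (b, y) v)).
rewrite (bigD1 x) //= [X in _ + X]big1 ?addr0; last first.
  move=> z nz; apply: big1 => c _; apply: big1 => d _.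
  by rewrite /ev !ffunE !xpair_eqE [x == z]eq_sym (negPf nz) andbF scaler0 mul0r.
rewrite (bigD1 a) //= [X in _ + X]big1 ?addr0; last first.
  move=> c nc; apply: big1 => d _.
  by rewrite /ev !ffunE !xpair_eqE [a == c]eq_sym (negPf nc) scaler0 mul0r.
rewrite (bigD1 b) //= big1 ?addr0; last first.
  move=> d nd.
  by rewrite /ev !ffunE !xpair_eqE [b == d]eq_sym (negPf nd) mulr0.
rewrite /ev !ffunE !xpair_eqE !eqxx /= [_ *: 1]mulr1 mulrC.
by rewrite eq_sym.
Qed.

Lemma bilinear_coef (to : groupAction [set: C] [set: gT])
    (tau : normalized_cocycle k to) i j :
  bilinear_for *:%R *:%R (fun u v : crossed_alg tau =>
    (u : smash_alg k to) i * (v : smash_alg k to) j : k^o).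
Proof.
split=> [v c u u'|u c v v'] /=.
  by rewrite !ffunE mulrDl [in RHS]/GRing.scale /= mulrA.
by rewrite !ffunE mulrDr [in RHS]/GRing.scale /= mulrCA.
Qed.

Lemma crossed_cocommutativeP (to : groupAction [set: C] [set: gT])
    (tau : normalized_cocycle k to) : abelian [set: gT] ->
  cocommutative (crossed_alg tau) <-> forall x a b, tau x a b = tau x b a.
Proof.
move=> abG.
have mulC (a b : gT) : (a * b = b * a)%g.
  by apply: (centsP abG); rewrite finset.in_setT.
split=> [cH x a b|sym h W B bB]; last first.
  rewrite [LHS](crossed_comulE B) [RHS]big_map /= [RHS](crossed_comulE (fun x y => B y x)).
  apply: eq_bigr => x _; rewrite exchange_big; apply: eq_bigr => a _ /=.
  apply: eq_bigr => b _; rewrite (bilZl bB) (bilZr bB) sym mulC //.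
(* All coordinates of this element in degree x are 1, so its coproduct displays the values of
   tau(x). *)
pose h : crossed_alg tau := \sum_a smash_elt k to a x.
have H := cH h _ _ (bilinear_coef tau (a, x) (b, x)).
rewrite [RHS]big_map /= in H.
have E := crossed_comul_coef h x b x a.
have := etrans (esym (crossed_comul_coef h x a x b)) (etrans H (etrans _ E)).
rewrite eqxx !mul1r (mulC b); move=> /(_ (eq_bigr _ (fun i _ => mulrC _ _))).
have -> : (h : smash_alg k to) (a * b, x)%g = 1.
  rewrite sum_ffunE (bigD1 (a * b)%g) //= ffunE eqxx big1 ?addr0 //.
  by move=> c /negPf nc; rewrite ffunE xpair_eqE eq_sym nc.
by rewrite !mulr1.
Qed.

End CrossedAlgebras.

(** [B2cc] does not relate the functions eta(x) for different x, so each tau(x) can be trivialized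
    independently. *)
Lemma crossed_cocommutative_B2cc (k : closedFieldType) (gT C : finGroupType)
    (to : groupAction [set: C] [set: gT]) (tau : normalized_cocycle k to) :
  abelian [set: gT] -> cocommutative (crossed_alg tau) <-> B2cc to tau.
Proof.
move=> abG; have Zt := ncocycle_Z2c tau.
split=> [/(crossed_cocommutativeP _ abG) sym|[_ [eta [e0 Et]]]].
  split=> //; have [tc _] := Zt.
  have H x : exists e : gT -> k, (forall a, e a != 0) /\
      forall a b, tau x a b = e a * e b * (e (a * b)%g)^-1.
    by have [e e0 eE] := sym_cocycle_coboundary abG (tc x) (sym x); exists e.
  have [eta etaP] := choice H.
  exists eta; split=> [x a|]; first exact: (etaP x).1.
  apply/funext => x; apply/funext => a; apply/funext => b.
  exact: (etaP x).2.
apply/(crossed_cocommutativeP _ abG) => x a b; rewrite Et /deltaG.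
by rewrite (centsP abG a _ b) ?finset.in_setT // [eta x a * _]mulrC.
Qed.

(** * Hopf maps from k^G to H(tau, to) *)

Section CrossedCoordinates.
Context (k : fieldType) (gT C : finGroupType).
Context (to : groupAction [set: C] [set: gT]) (tau : normalized_cocycle k to).
Implicit Types (h : crossed_alg tau) (u : fun_alg k gT).
Local Notation coef h i := ((h : smash_alg k to) i).

Lemma crossed_inc_mulE u h a z :
  coef (crossed_inc tau u * h) (a, z) = u a * coef h (a, z).
Proof.
rewrite ffunE (bigD1 1%g) //= ffunE eqxx mulr1 act1 invg1 mul1g big1 ?addr0 //.
by move=> y /negPf ny; rewrite ffunE /= ny mulr0 mul0r.
Qed.

Lemma crossed_mul_incE u h a z :
  coef (h * crossed_inc tau u) (a, z) = coef h (a, z) * u (to a z).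
Proof.
rewrite ffunE (bigD1 z) //= ffunE /= mulVg eqxx mulr1 big1 ?addr0 //.
by move=> y ny; rewrite ffunE /= -eq_mulVg1 (negPf ny) !mulr0.
Qed.

Lemma crossed_inc_section b x :
  crossed_inc tau (idem k b) * crossed_section tau x = smash_elt k to b x.
Proof.
apply/ffunP => -[a z]; rewrite crossed_inc_mulE !ffunE xpair_eqE /=.
by case: (a == b); rewrite ?mul1r ?mul0r.
Qed.

Lemma fun_alg_cocommutative : abelian [set: gT] -> cocommutative (fun_alg k gT).
Proof.
move=> abG u W B bB; rewrite [LHS](fun_comulE B) [RHS]big_map /=.
rewrite [RHS](fun_comulE (fun x y => B y x)) exchange_big.
apply: eq_bigr => a _; apply: eq_bigr => b _ /=.
by rewrite (bilZl bB) (bilZr bB) (centsP abG b _ a) ?finset.in_setT.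
Qed.

(** By tau(xy) = tau(x) (x.tau(y)), symmetry of tau(x) would pass to all powers of x, and x <> 1
    generates C. *)
Lemma noncocommutative_sections : abelian [set: gT] -> prime #|C| ->
  ~ cocommutative (crossed_alg tau) ->
  forall x, x != 1%g -> exists a b, tau x a b != tau x b a.
Proof.
move=> abG Cp ncH x x1; apply: contrapT => sx; apply: ncH.
have sym a b : tau x a b = tau x b a.
  by apply: contrapT => /eqP nab; apply: sx; exists a, b.
apply/(crossed_cocommutativeP _ abG) => y a b.
have /cycleP[i ->] : y \in <[x]>%g.
  suff -> : <[x]>%g = [set: C] :> {set C} by rewrite finset.in_setT.
  apply/eqP; rewrite eqEcard finset.subsetT cardsT /=.
  have : (#[x]%g %| #|C|)%N by rewrite -cardsT cardSg ?finset.subsetT.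
  case/primeP: Cp => _ /[apply] /pred2P[/eqP|<-]; last by rewrite orderE.
  by rewrite order_eq1 (negPf x1).
have [_ tM] := ncocycle_Z2c tau.
elim: i a b => [|i IH] a b; last by rewrite expgS !tM sym IH.
rewrite expg0; have t1 c d : tau 1%g c d = 1.
  have := tM 1%g 1%g c d; rewrite mulg1 !act1 => E.
  by apply: (mulfI (((ncocycle_Z2c tau).1 1%g).1 c d)); rewrite -E mulr1.
by rewrite !t1.
Qed.

(* The image of k^G is a cocommutative subcoalgebra; a component of it on some
   x <> 1 could be moved to any p_c x by the coproduct, which would make
   tau(x) symmetric. *)
Lemma hopf_map_fun_crossed (F : {lrmorphism fun_alg k gT -> crossed_alg tau}) :
  abelian [set: gT] -> prime #|C| -> ~ cocommutative (crossed_alg tau) ->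
  hopf_map F -> forall u, exists v, F u = crossed_inc tau v.
Proof.
move=> abG Cp ncH [Fcomul _] u; apply: crossed_inc_supp => c x x1.
apply: contrapT => /eqP hcx.
have [a [b /eqP]] := noncocommutative_sections abG Cp ncH x1; apply.
have sym v : tau x a b * coef (F v) ((a * b)%g, x)
    = tau x b a * coef (F v) ((a * b)%g, x).
  have E := crossed_comul_coef (F v) x a x b.
  have E' := crossed_comul_coef (F v) x b x a.
  have H1 := Fcomul v _ _ (bilinear_coef tau (a, x) (b, x)).
  have H2 := Fcomul v _ _ (bilinear_coef tau (b, x) (a, x)).
  rewrite [RHS]big_map /= in H1; rewrite [RHS]big_map /= in H2.
  have B := bilinear_comp (bilinear_coef tau (a, x) (b, x))
    (@linearP _ _ _ _ F) (@linearP _ _ _ _ F).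
  have S := fun_alg_cocommutative abG v B.
  rewrite [RHS]big_map /= in S.
  have := etrans (esym E) (etrans H1 (etrans S (etrans _ (etrans (esym H2) E')))).
  rewrite eqxx !mul1r (centsP abG b _ a) ?finset.in_setT //; apply.
  by apply: eq_bigr => i _; exact: mulrC.
(* Since a b d = c, applying the coordinate (d, x) to the second factor of the coproduct moves the
   nonzero coordinate of [F u] at (c, x) to (a b, x), up to a value of tau. *)
pose d := ((a * b)^-1 * c)%g.
pose v := \sum_(i <- comul u) coef (F i.2) (d, x) *: i.1.
have Fv : coef (F v) ((a * b)%g, x) = tau x (a * b)%g d * coef (F u) (c, x).
  rewrite /v linear_sum sum_ffunE /=.
  have E := crossed_comul_coef (F u) x (a * b)%g x d.
  have H := Fcomul u _ _ (bilinear_coef tau ((a * b)%g, x) (d, x)).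
  rewrite [RHS]big_map /= in H.
  rewrite /d mulKVg eqxx mul1r in E; rewrite -E; apply: etrans (esym H).
  by apply: eq_bigr => i _; rewrite linearZ ffunE mulrC.
have := sym v; rewrite Fv => /mulIf; apply.
by rewrite mulf_neq0 // ((ncocycle_Z2c tau).1 x).1.
Qed.

End CrossedCoordinates.

(** * Isomorphisms between noncocommutative H(tau, to) *)

Section FunctionAlgebraMaps.
Context (k : fieldType) (gT : finGroupType).

Lemma fun_comul_coef (u : fun_alg k gT) (c d : gT) (phi psi : fun_alg k gT -> k) :
  (forall v, phi v = v c) -> (forall v, psi v = v d) ->
  \sum_(i <- comul u) phi i.1 * psi i.2 = u (c * d)%g.
Proof.
move=> phiE psiE; rewrite [LHS](fun_comulE (fun x y => phi x * psi y)).
rewrite (bigD1 c) //= [X in _ + X]big1 ?addr0; last first.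
  move=> a na; apply: big1 => b _.
  by rewrite phiE !ffunE [c == a]eq_sym (negPf na) scaler0 mul0r.
rewrite (bigD1 d) //= big1 ?addr0; last first.
  by move=> b nb; rewrite psiE !ffunE [d == b]eq_sym (negPf nb) mulr0.
by rewrite phiE psiE !ffunE !eqxx mulr1 [LHS]mulr1.
Qed.

(** The idempotents p_a sum to 1, so phi is nonzero on one of them; then u p_a = u(a) p_a gives
    phi(u) = u(a). *)
Lemma fun_alg_hom_point (phi : fun_alg k gT -> k) :
  scalar phi -> {morph phi : u v / u * v} -> phi 1 = 1 ->
  exists a, forall u, phi u = u a.
Proof.
move=> phiL phiM phi1.
have phi0 : phi 0 = 0 by have := phiL (-1) 0 0; rewrite scaler0 addr0 mulN1r addNr.
have [a na] : exists a, phi (idem k a) != 0.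
  apply: contrapT => /forallNP n; have := oner_neq0 k; rewrite -phi1.
  rewrite [1 : fun_alg k gT]fun_idem_sum.
  suff -> : phi (\sum_a (1 : fun_alg k gT) a *: idem k a) = 0 by rewrite eqxx.
  apply: (big_ind (fun v => phi v = 0)) => // [u v pu pv|a _].
    by rewrite -[u]scale1r phiL pu pv mulr0 addr0.
  rewrite -[_ *: _]addr0 phiL phi0 addr0; have /negP/negPn/eqP -> := n a.
  exact: mulr0.
exists a => u; apply: (mulIf na); rewrite -phiM.
suff -> : u * idem k a = u a *: idem k a + 0 by rewrite phiL phi0 addr0.
rewrite addr0; apply/ffunP => b; rewrite !ffunE.
by have [->|_] := eqVneq b a; rewrite ?mulr0 //; apply/esym/mulr0.
Qed.

End FunctionAlgebraMaps.

Section IsomorphismClassification.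
Context (k : fieldType) (gT C : finGroupType).
Context (to to' : groupAction [set: C] [set: gT]).
Context (tau : normalized_cocycle k to) (tau' : normalized_cocycle k to').
Local Notation coef h i := ((h : smash_alg k to') i).

Lemma isomorphic_crossed : abelian [set: gT] -> prime #|C| ->
  ~ cocommutative (crossed_alg tau') ->
  hopf_isomorphic (crossed_alg tau) (crossed_alg tau') ->
  exists alpha l eta, [/\ alpha \in Aut [set: C], l \in isoms to (twist to' alpha),
    cochain1 to' eta &
    forall x a b, tau' x a b = act_pair l alpha tau x a b * deltaG eta x a b].
Proof.
move=> abG Cp ncH [f [fcomul fcounit] [g fK gK]].
have nt x a : tau x a 1%g = 1 by have [] := ncocycle_normalized tau x a.
have nt' x a : tau' x a 1%g = 1 by have [] := ncocycle_normalized tau' x a.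
have t1 a b : tau' 1%g a b = 1.
  have [tc tM] := ncocycle_Z2c tau'.
  have := tM 1%g 1%g a b; rewrite mulg1 !act1 => E.
  by apply: (mulfI ((tc 1%g).1 a b)); rewrite -E mulr1.
pose F : {lrmorphism fun_alg k gT -> crossed_alg tau'} := f \o crossed_inc tau.
have FH : hopf_map F.
  apply: hopf_map_comp; [exact: crossed_inc_hopf|by split].
have [phi phiE] := choice (hopf_map_fun_crossed abG Cp ncH FH).
have phiC u a : phi u a = coef (F u) (a, 1%g) by rewrite phiE ffunE eqxx mulr1.
have phiM u v a : phi (u * v) a = phi u a * phi v a.
  have FM : F (u * v) = F u * F v by exact: rmorphM.
  by rewrite phiC FM phiE crossed_inc_mulE -phiC.
(* For fixed a, the map [phi _ a] is a character of k^G, hence evaluation at a point mu(a): phi is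
   the pullback along mu. *)
have [mu muE] : exists mu : gT -> gT, forall a u, phi u a = u (mu a).
  suff H : forall a, exists b, forall u, phi u a = u b.
    by have [mu muE] := choice H; exists mu.
  move=> a; apply: fun_alg_hom_point.
  - move=> c u v; have FP : F (c *: u + v) = c *: F u + F v by exact: linearP.
    by rewrite !phiC FP !ffunE.
  - by move=> u v; rewrite phiM.
  - have F1 : F 1 = 1 by exact: rmorph1.
    by rewrite phiC F1 ffunE eqxx.
have FE u a z : coef (F u) (a, z) = u (mu a) * (z == 1%g)%:R by rewrite phiE ffunE muE.
have muM : {morph mu : a b / (a * b)%g}.
  move=> a b; apply/eqP; pose w := idem k (mu (a * b)%g).
  have H := FH.1 w _ _ (bilinear_coef tau' (a, 1%g) (b, 1%g)).
  rewrite [RHS]big_map in H.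
  have := etrans (esym (crossed_comul_coef (F w) 1%g a 1%g b)) H.
  rewrite (@fun_comul_coef _ _ _ (mu a) (mu b) (fun v => coef (F v) (a, 1%g))
    (fun v => coef (F v) (b, 1%g))).
  - rewrite t1 !mul1r phiE !ffunE eqxx /= muE ffunE !eqxx mulr1 [X in X * _]mulr1n => /esym.
    by rewrite eq_sym; case: eqP => // _ /esym/eqP; rewrite !mulr1 oner_eq0.
  - by move=> v; rewrite FE eqxx mulr1.
  - by move=> v; rewrite FE eqxx mulr1.
have mu1 : mu 1%g = 1%g by apply: (mulgI (mu 1%g)); rewrite -muM !mulg1.
have mu_surj b : exists a, mu a = b.
  apply: contrapT => /forallNP nb.
  have : F (idem k b) = 0.
    apply/ffunP => -[a z]; rewrite FE !ffunE (_ : mu a == b = false) ?mul0r //.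
    exact/eqP/nb.
  rewrite -(raddf0 f) => /(can_inj fK)/ffunP/(_ (b, 1%g))/eqP.
  by rewrite !ffunE !eqxx mulr1 oner_eq0.
have mu_inj : injective mu.
  by have [nu nuE] := choice mu_surj; apply: (can_inj (canF_sym nuE)).
have phi_surj w : exists u, phi u = w.
  have [nu nuE] := choice mu_surj; exists [ffun a => w (nu a)].
  by apply/ffunP => a; rewrite muE ffunE (canF_sym nuE).
pose v x := f (crossed_section tau x).
have vM x y : v (x * y)%g = v x * v y by rewrite /v -crossed_sectionM rmorphM.
have fE b x a z : coef (f (smash_elt k to b x)) (a, z) = (mu a == b)%:R * coef (v x) (a, z).
  have -> : f (smash_elt k to b x) = F (idem k b) * v x.
    by rewrite -(crossed_inc_section tau); exact: rmorphM.
  rewrite phiE crossed_inc_mulE muE.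
  by rewrite ffunE.
(* The coefficient of p_a y (x) p_b z in the coproduct of v(x), computed on the left by carrying
   over the coproduct of H(tau, to). *)
have vD x a y b z : coef (v x) (a, y) * coef (v x) (b, z) * tau x (mu a) (mu b)
    = (y == z)%:R * (tau' y a b * coef (v x) ((a * b)%g, y)).
  rewrite -crossed_comul_coef.
  have H := fcomul (crossed_section tau x) _ _ (bilinear_coef tau' (a, y) (b, z)).
  rewrite [RHS]big_map in H; rewrite [RHS]H.
  rewrite [RHS](crossed_comulE (fun p q => coef (f p) (a, y) * coef (f q) (b, z))).
  rewrite (bigD1 x) //= [X in _ + X]big1 ?addr0; last first.
    move=> w /negPf nw; apply: big1 => c _; apply: big1 => d _.
    by rewrite ffunE /= nw mulr0 scale0r raddf0 ffunE mul0r.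
  rewrite (bigD1 (mu a)) //= [X in _ + X]big1 ?addr0; last first.
    move=> c nc; apply: big1 => d _; rewrite linearZ ffunE fE eq_sym (negPf nc).
    by rewrite mul0r scaler0 mul0r.
  rewrite (bigD1 (mu b)) //= big1 ?addr0; last first.
    by move=> d nd; rewrite [X in _ * X]fE eq_sym (negPf nd) mul0r mulr0.
  rewrite linearZ ffunE !fE !eqxx !mul1r ffunE eqxx mulr1 /GRing.scale /=.
  by rewrite -[RHS]mulrA mulrC.
have v11 : v 1%g = 1.
  rewrite /v (_ : crossed_section tau 1%g = 1) ?rmorph1 //.
have vv x a : exists y, coef (v x) (a, y) != 0.
  apply: contrapT => /forallNP va.
  have : coef (v x * v x^-1%g) (a, 1%g) = 1 by rewrite -vM mulgV v11 ffunE eqxx.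
  rewrite ffunE big1 => [/esym/eqP|y _]; first by rewrite oner_eq0.
  by have /negP/negPn/eqP -> := va y; rewrite mul0r.
(* For b = 1, where tau and tau' take the value 1, [vD] shows that the degree y of a nonzero
   coordinate does not depend on a: v(x) is homogeneous, of degree [al x]. *)
have v1 x a y z : coef (v x) (a, y) != 0 -> coef (v x) (1%g, z) = (y == z)%:R.
  move=> vn; have := vD x a y 1%g z; rewrite mu1 nt nt' mulr1 mul1r mulg1.
  by rewrite [RHS]mulrC => /(mulfI vn).
have [al alE] := choice (fun x => vv x 1%g).
have va x a y : coef (v x) (a, y) != 0 -> y = al x.
  move=> vn; have E := v1 x a y (al x) vn; have := alE x; rewrite E.
  by case: (eqVneq y) => // _; rewrite eqxx.
have va0 x a : coef (v x) (a, al x) != 0.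
  by have [y vy] := vv x a; rewrite -(va _ _ _ vy).
have v0 x a y : y != al x -> coef (v x) (a, y) = 0.
  by move=> ny; apply/eqP; apply: contraNT ny => /va ->.
have vxy x y a : coef (v (x * y)%g) (a, al x * al y)%g
    = coef (v x) (a, al x) * coef (v y) (to' a (al x), al y).
  rewrite vM ffunE (bigD1 (al x)) //= big1 ?addr0 ?mulKg // => z nz.
  by rewrite v0 ?mul0r.
have alM : {morph al : x y / (x * y)%g}.
  by move=> x y; apply/esym/(va _ 1%g); rewrite vxy mulf_neq0.
(* If [al x] is 1, then v(x) lies in k^G, which is the image of k^G under f; by injectivity x lies
   in k^G. *)
have al1 x : al x = 1%g -> x = 1%g.
  move=> ax; have [u uE] := phi_surj [ffun a => coef (v x) (a, 1%g)].
  have : v x = f (crossed_inc tau u).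
    rewrite -[f _]/(F u) phiE uE; apply/ffunP => -[a z]; rewrite !ffunE.
    by have [->|nz] := eqVneq z 1%g; rewrite ?mulr1 // mulr0 v0 ?ax.
  move/(can_inj fK)/ffunP/(_ (1%g, x))/eqP; rewrite !ffunE eqxx.
  by have [->|_] := eqVneq x 1%g; rewrite ?mulr0 ?oner_eq0.
have al_inj : injective al.
  have a1 : al 1%g = 1%g by apply: (mulgI (al 1%g)); rewrite -alM !mulg1.
  move=> x y E; apply/eqP; rewrite eq_mulgV1; apply/eqP/al1.
  apply: (mulIg (al y)); rewrite -alM mulgKV mul1g //.
(* Functions are pulled back along mu, so l is its inverse. For y = alpha(x), eta(y) is the
   coefficient function of v(x). *)
pose alpha := perm al_inj; pose l := (perm mu_inj)^-1%g.
have lV a : (l^-1)%g a = mu a by rewrite invgK permE.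
exists alpha, l, (fun y a => coef (v ((alpha^-1)%g y)) (a, y)).
have alV y : al ((alpha^-1)%g y) = y by rewrite -[al _](permE al_inj) permKV.
have Aa : alpha \in Aut [set: C] by apply/AutTP => x y; rewrite !permE alM.
have /AutTP aVM : (alpha^-1)%g \in Aut [set: C] by rewrite groupV.
split=> //.
- suff li : (l^-1)%g \in isoms to' (twist to (alpha^-1)%g).
    by have := isoms_inv li; rewrite !invgK.
  apply/isomsP; split=> [a b|a x]; first by rewrite !lV muM.
  rewrite !lV /twist; set y := (alpha^-1)%g x; have yE : al y = x by exact: alV.
  (* The relation v(y) F(u) = F(y.u) v(y), read at (a, x) for the idempotent u at mu(a <| x),
     detects equivariance because v(y) has a nonzero coordinate there. *)
  apply/eqP; set b := mu _; pose u := idem k b.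
  have fM p q : f (p * q) = f p * f q by exact: rmorphM.
  have : v y * F u = F [ffun a => u (to a y)] * v y.
    by apply: etrans (esym (fM _ _)) (etrans _ (fM _ _)); rewrite crossed_section_inc.
  rewrite !phiE => /ffunP/(_ (a, x)).
  rewrite crossed_inc_mulE crossed_mul_incE !muE -/b !ffunE eqxx mulr1.
  move=> E; have := va0 y a; rewrite yE; apply: contraR.
  by rewrite E eq_sym => /negPf ->; rewrite mul0r.
- split=> [y a|x y a]; first by rewrite -{2}[y]alV va0.
  by rewrite aVM -{2}[x]alV -{2}[y]alV vxy !alV.
move=> y a b; set x := (alpha^-1)%g y; have xE : al x = y by exact: alV.
have := vD x a y b y; rewrite eqxx mul1r /deltaG.
rewrite /act_pair /act_Aut /act_perm !lV -/x => E.
have vn c : coef (v x) (c, y) != 0 by rewrite -xE va0.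
by rewrite [_ * (_ / _)]mulrC mulrAC E mulfK.
Qed.

End IsomorphismClassification.

(** * Extensions *)

Lemma comul_bilinear_linear (k : fieldType) (H : hopfAlgType k) (W : lmodType k)
    (B : H -> H -> W) : bilinear_for *:%R *:%R B ->
  linear (fun h : H => \sum_(i <- comul h) B i.1 i.2).
Proof.
move=> bB c u v /=; rewrite (comul_linear c u v _ _ bB) big_cat big_map /=.
by rewrite scaler_sumr; congr (_ + _); apply: eq_bigr => i _; rewrite (bilZl bB).
Qed.

Lemma comul_coassoc (k : fieldType) (H : hopfAlgType k) (W : lmodType k)
    (f : H -> H -> H -> W) (h : H) : trilinear f ->
  \sum_(i <- comul h) \sum_(j <- comul i.1) f j.1 j.2 i.2
  = \sum_(i <- comul h) \sum_(j <- comul i.2) f i.1 j.1 j.2.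
Proof. by move=> tf; have := comulA h _ _ tf; rewrite !big_allpairs_dep. Qed.

(** * The C-grading of an extension *)

Section Homogeneous.
Context (k : fieldType) (gT C : finGroupType) (E : extension k gT C).
Implicit Types (h g : E) (x y : C).
Local Notation inc := (ext_inc E).
Local Notation pr := (ext_proj E).

Local Notation gcf x z := ((z : {ffun C -> k^o}) x : k).

(** The right coaction (id (x) pi) Delta of kC amounts to a C-grading of E; these are the elements
    of degree x. *)
Definition ext_homog x h : Prop :=
  tensor_eq [seq (i.1, pr i.2) | i <- comul h] [:: (h, grp_elt k x)].

Lemma ext_homogE x h (W : lmodType k) (f : E -> grp_alg k C -> W) :
  ext_homog x h -> bilinear_for *:%R *:%R f ->
  \sum_(i <- comul h) f i.1 (pr i.2) = f h (grp_elt k x).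
Proof. by move=> hx bf; have := hx W f bf; rewrite big_map big_seq1. Qed.

Lemma ext_homogI x h :
  (forall (W : lmodType k) (f : E -> grp_alg k C -> W), bilinear_for *:%R *:%R f ->
    \sum_(i <- comul h) f i.1 (pr i.2) = f h (grp_elt k x)) -> ext_homog x h.
Proof. by move=> H W f bf; rewrite big_map big_seq1; exact: H. Qed.

Lemma bilinear_pr (W : lmodType k) (f : E -> grp_alg k C -> W) :
  bilinear_for *:%R *:%R f -> bilinear_for *:%R *:%R (fun u v : E => f u (pr v)).
Proof. by move=> bf; apply: (bilinear_comp bf (g := id)) => //; apply: linearP. Qed.

Lemma ext_homogZ x c h : ext_homog x h -> ext_homog x (c *: h).
Proof.
move=> hx; apply: ext_homogI => W f bf.
have [_ lZ _] := linear_factsP (comul_bilinear_linear (bilinear_pr bf)).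
by rewrite lZ (ext_homogE hx bf) (bilZl bf).
Qed.

Lemma ext_homogM x y h g :
  ext_homog x h -> ext_homog y g -> ext_homog (x * y)%g (h * g).
Proof.
move=> hx gy; apply: ext_homogI => W f bf.
rewrite (comulM h g _ _ (bilinear_pr bf)) big_allpairs_dep /=.
transitivity (\sum_(i <- comul h) f (i.1 * g) (pr i.2 * grp_elt k y)).
  apply: eq_bigr => i _.
  rewrite -(ext_homogE (f := fun u w => f (i.1 * u) (pr i.2 * w)) gy); last first.
    by apply: bilinear_comp => // c u v; rewrite mulrDr scalerAr.
  by apply: eq_bigr => j _; rewrite rmorphM.
rewrite (ext_homogE (f := fun u w => f (u * g) (w * grp_elt k y)) hx) ?grp_eltM //.
by apply: bilinear_comp => // c u v; rewrite mulrDl scalerAl.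
Qed.

Lemma ext_proj_inc (u : fun_alg k gT) : pr (inc u) = (counit u)%:A.
Proof.
suff K : pr (inc u - (counit u)%:A) = 0.
  by rewrite -[RHS](rmorph_alg pr); apply: subr0_eq; rewrite -K;
    exact: (esym (rmorphB pr _ _)).
apply: (proj2 (ext_ker _)); exists [:: (u - (counit u)%:A, 1)] => [i|].
  rewrite inE => /eqP -> /=; rewrite /counit /= /fun_counit !ffunE.
  by rewrite /GRing.scale /= mulr1 subrr.
by rewrite big_seq1 mulr1 rmorphB [X in _ = _ - X]linearZ rmorph1.
Qed.

Lemma ext_homog_inc (u : fun_alg k gT) : ext_homog 1%g (inc u).
Proof.
apply: ext_homogI => W f bf; have [icomul _] := ext_inc_hopf E.
rewrite (icomul u _ _ (bilinear_pr bf)) big_map /=.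
rewrite -{2}(counitr u) linear_sum (bil_suml bf); apply: eq_bigr => i _.
by rewrite ext_proj_inc (bilZr bf) linearZ (bilZl bf).
Qed.

Definition ext_comp x h : E := \sum_(i <- comul h) gcf x (pr i.2) *: i.1.

Lemma bilinear_ext_comp x :
  bilinear_for *:%R *:%R (fun (h : E) (z : grp_alg k C) => gcf x z *: h).
Proof.
split=> [z c u v|u c z z'] /=; first by rewrite scalerDr !scalerA mulrC.
by rewrite !ffunE scalerDl scalerA.
Qed.

Lemma ext_comp_linear x : linear (ext_comp x).
Proof. exact: (comul_bilinear_linear (bilinear_pr (bilinear_ext_comp x))). Qed.

Lemma ext_comp_homog x y h : ext_homog x h -> ext_comp y h = (y == x)%:R *: h.
Proof.
move=> hx; rewrite /ext_comp (ext_homogE hx (bilinear_ext_comp y)).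
by rewrite ffunE.
Qed.

Lemma ext_comp_sum h : h = \sum_x ext_comp x h.
Proof.
rewrite exchange_big -{1}(counitr h); apply: eq_bigr => i _ /=.
by rewrite -scaler_suml; congr (_ *: _); rewrite -(ext_proj_hopf E).2.
Qed.

Lemma ext_comp_is_homog x h : ext_homog x (ext_comp x h).
Proof.
apply: ext_homogI => W f bf.
have [_ _ lsum] := linear_factsP (comul_bilinear_linear (bilinear_pr bf)).
have [_ lZ _] := linear_factsP (comul_bilinear_linear (bilinear_pr bf)).
rewrite /ext_comp lsum; under eq_bigr => i _ do rewrite lZ scaler_sumr.
rewrite (comul_coassoc h (f := fun a b c => gcf x (pr c) *: f a (pr b))); last first.
  split=> [v w|u w|u v] c a b /=.
  - by rewrite (bilDl bf) (bilZl bf) scalerDr !scalerA mulrC.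
  - by rewrite linearP (bilDr bf) (bilZr bf) scalerDr !scalerA mulrC.
  - by rewrite linearP !ffunE scalerDl scalerA.
rewrite (bil_suml bf); apply: eq_bigr => i _; rewrite (bilZl bf).
have bB : bilinear_for *:%R *:%R (fun a b : grp_alg k C => gcf x b *: f i.1 a).
  split=> [v c a b|a c v w] /=.
    by rewrite (bilDr bf) (bilZr bf) scalerDr !scalerA mulrC.
  by rewrite !ffunE scalerDl scalerA.
have := (ext_proj_hopf E).1 i.2 _ _ bB; rewrite [RHS]big_map /= => <-.
rewrite [LHS](grp_comulE (fun a b : grp_alg k C => gcf x b *: f i.1 a)).
rewrite (bigD1 x) //= big1 ?addr0 => [|y /negPf ny].
  by rewrite ffunE eqxx scale1r (bilZr bf).
by rewrite ffunE eq_sym ny scale0r.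
Qed.

(** By coassociativity the coaction on h can be applied to the second factor alone, which therefore
    keeps degree x. The first factor is not so constrained: its degrees carry the second action of
    the matched pair. *)
Lemma ext_homog_comulr x y h (W : lmodType k) (B : E -> E -> W) :
  ext_homog x h -> bilinear_for *:%R *:%R B ->
  \sum_(i <- comul h) B i.1 (ext_comp y i.2)
  = (y == x)%:R *: \sum_(i <- comul h) B i.1 i.2.
Proof.
move=> hx bB; rewrite /ext_comp.
under eq_bigr => i _ do rewrite (bil_sumr bB).
under eq_bigr => i _ do under eq_bigr => j _ do rewrite (bilZr bB).
rewrite -(comul_coassoc h (f := fun a b c => gcf y (pr c) *: B a b)); last first.
  split=> [v w|u w|u v] c a b /=.
  - by rewrite (bilDl bB) (bilZl bB) scalerDr !scalerA mulrC.
  - by rewrite (bilDr bB) (bilZr bB) scalerDr !scalerA mulrC.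
  - by rewrite linearP !ffunE scalerDl scalerA.
under eq_bigr => i _ do rewrite -scaler_sumr.
rewrite (ext_homogE (f := fun u (z : grp_alg k C) =>
  gcf y z *: \sum_(j <- comul u) B j.1 j.2) hx).
  by rewrite ffunE.
split=> [z c u v|u c z z'] /=; last by rewrite !ffunE scalerDl scalerA.
by rewrite (comul_bilinear_linear bB) scalerDr !scalerA mulrC.
Qed.

(* By normality ker(pi) = A^+ E is contained in E A^+, with A the image of k^G. *)
Lemma ext_ker_mul_integral h : pr h = 0 -> h * inc (idem k 1%g) = 0.
Proof.
move/(proj1 (ext_ker _)) => [s s0 ->]; rewrite mulr_suml big_seq big1 // => -[v g] /s0 /= v0.
have inc1 w : counit w = 0 -> inc w * inc (idem k 1%g) = 0.
  move=> w0; rewrite -rmorphM (_ : w * _ = 0) ?rmorph0 //; apply/ffunP => a.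
  rewrite !ffunE; have [->|_] := eqVneq a 1%g; last exact: mulr0.
  by move: w0; rewrite /counit /= /fun_counit => ->; rewrite mul0r.
have prM a b : pr (a * b) = pr a * pr b by exact: rmorphM.
(* With e = p_1, g_1 S(g_2) v g_3 e is computed in two ways: g_1 S(g_2) collapses to the counit and
   leaves v g e, while S(g_2) v g_3 yields elements of A^+ by normality, and these kill e. *)
have tf : trilinear (fun a b c : E => a * antipode b * inc v * c * inc (idem k 1%g)).
  split=> [b d|a d|a b] c x y /=.
  - by rewrite !mulrDl !scalerAl.
  - by rewrite antipode_linear mulrDr !mulrDl -scalerAr !scalerAl.
  - by rewrite mulrDr mulrDl -scalerAr -scalerAl.
have := comul_coassoc g tf.
under [RHS]eq_bigr => i _.
  have [v' E'] := (ext_normal i.2 v).2.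
  have v'0 : counit v' = 0.
    have := congr1 pr E'; rewrite ext_proj_inc linear_sum big1 => [/ffunP/(_ 1%g)|j _].
      by rewrite !ffunE eqxx => /esym; rewrite [X in X = _]mulr1.
    by rewrite /= !prM ext_proj_inc v0 scale0r mulr0 mul0r.
  have -> : \sum_(j <- comul i.2) i.1 * antipode j.1 * inc v * j.2 * inc (idem k 1%g) = 0.
    under eq_bigr => j _ do rewrite -!mulrA.
    rewrite -mulr_sumr; under eq_bigr => j _ do rewrite !mulrA.
    by rewrite -mulr_suml E' inc1 ?mulr0.
  over.
rewrite [RHS]big1 // => <-; rewrite -{1}(counitl g) mulr_sumr mulr_suml.
apply: eq_bigr => i _; rewrite -!mulr_suml antipoder.
by rewrite -scalerAl mul1r -scalerAr !scalerAl.
Qed.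
End Homogeneous.

(** * Coinvariants: the part of degree 1 is k^G *)

Section Coinvariants.
Context (k : fieldType) (gT C : finGroupType) (E : extension k gT C).
Implicit Types (h g : E).
Local Notation inc := (ext_inc E).
Local Notation pr := (ext_proj E).
Local Notation P a := (inc (idem k a)).

Lemma ext_incM (u v : fun_alg k gT) : inc (u * v) = inc u * inc v.
Proof. exact: rmorphM. Qed.
Lemma ext_inc1 : inc 1 = 1. Proof. exact: rmorph1. Qed.

Lemma ext_idemM a b : P a * P b = (a == b)%:R *: P a.
Proof. by rewrite -ext_incM fun_idemM linearZ. Qed.

Lemma ext_idem_sum : \sum_a P a = 1.
Proof.
rewrite -ext_inc1 [X in inc X]fun_idem_sum linear_sum; apply: eq_bigr => a _.
by rewrite ffunE scale1r.
Qed.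

Lemma ext_idem_neq0 a : P a != 0.
Proof.
apply/eqP; rewrite -(raddf0 inc) => /(@ext_inc_inj _ _ _ E)/ffunP/(_ a)/eqP.
by rewrite !ffunE eqxx oner_eq0.
Qed.

Lemma comul_ext_idem1 (W : lmodType k) (B : E -> E -> W) :
  bilinear_for *:%R *:%R B ->
  \sum_(i <- comul (P 1%g)) B i.1 i.2 = \sum_a B (P a^-1%g) (P a).
Proof.
move=> bB; rewrite ((ext_inc_hopf E).1 _ _ _ bB) [LHS]big_map /=.
rewrite [LHS](fun_comulE (fun x y => B (inc x) (inc y))) exchange_big /=.
apply: eq_bigr => b _; rewrite (bigD1 b^-1%g) //= big1 ?addr0 => [|a na].
  by rewrite ffunE mulVg eqxx scale1r.
rewrite ffunE (_ : (a * b == 1)%g = false) ?scale0r ?raddf0.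
  by rewrite -(scale0r (0 : E)) (bilZl bB) scale0r.
by apply: contraNF na => /eqP ab; apply/eqP/(mulIg b); rewrite mulVg.
Qed.

(* With e = p_1, coinvariance gives h_1 (x) h_2 e = h (x) e, and the coproduct of
   e turns this into
     \sum_a p_{a^-1} (x) h p_a = \sum_a S(h) p_{a^-1} (x) p_a;
   a linear form on the first factor then shows that h p_c is a multiple of p_c. *)
Lemma ext_coinvariants h : ext_homog 1%g h -> exists u, h = inc u.
Proof.
move=> h1; pose e := P 1%g.
(* The degree of h only constrains pi(h_2). Since g e depends on pi(g) alone, h_2 e is recovered
   from pi(h_2) through a linear section [sigma] of pi. *)
have [sec secE] := choice (fun x => ext_proj_surj E (grp_elt k x)).
pose sigma (z : grp_alg k C) : E := \sum_x (z : {ffun C -> k^o}) x *: sec x.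
have sigmaL : linear sigma.
  move=> c z z'; rewrite /sigma scaler_sumr -big_split; apply: eq_bigr => x _.
  by rewrite !ffunE scalerDl scalerA.
have sigma_e g : sigma (pr g) * e = g * e.
  apply/eqP; rewrite -subr_eq0 -mulrBl ext_ker_mul_integral // rmorphB /=.
  apply/eqP; rewrite subr_eq0 {2}[pr g]grp_elt_sum /sigma linear_sum.
  by apply/eqP/eq_bigr => x _; rewrite linearZ /= secE.
have stepA (W : lmodType k) (B : E -> E -> W) : bilinear_for *:%R *:%R B ->
    \sum_(i <- comul h) B i.1 (i.2 * e) = B h e.
  move=> bB; have bf : bilinear_for *:%R *:%R (fun u z => B u (sigma z * e)).
    apply: (bilinear_comp bB (g := id)) => // c u v.
    by rewrite sigmaL mulrDl scalerAl.
  have := ext_homogE h1 bf.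
  under eq_bigr => i _ do rewrite sigma_e.
  move=> ->; have -> : grp_elt k 1%g = pr 1 by rewrite rmorph1.
  by rewrite sigma_e mul1r.
have key (W : lmodType k) (B : E -> E -> W) : bilinear_for *:%R *:%R B ->
    \sum_a B (P a^-1%g) (h * P a) = \sum_a B (antipode h * P a^-1%g) (P a).
  move=> bB.
  have bl c : bilinear_for *:%R *:%R (fun x y => B (c * x) y).
    by apply: (bilinear_comp bB (h := id)) => // d u v; rewrite mulrDr scalerAr.
  have bl' c : bilinear_for *:%R *:%R (fun x y => B x (c * y)).
    by apply: (bilinear_comp bB (g := id)) => // d u v; rewrite mulrDr scalerAr.
  (* S(h_1) (h_2 e)_1 (x) (h_2 e)_2 is computed in two ways: coinvariance gives S(h) e_1 (x) e_2,
     and the antipode identity gives e_1 (x) h e_2. *)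
  have bB' : bilinear_for *:%R *:%R
      (fun u w => \sum_(s <- comul w) B (antipode u * s.1) s.2).
    split=> [w c u v|u] /=; last exact: (comul_bilinear_linear (bl _)).
    rewrite scaler_sumr -big_split; apply: eq_bigr => s _ /=.
    by rewrite antipode_linear mulrDl -scalerAl (bilDl bB) (bilZl bB).
  rewrite -(comul_ext_idem1 (bl (antipode h))) -(stepA _ _ bB').
  have tf : trilinear (fun x y z => \sum_(r <- comul e) B (antipode x * y * r.1) (z * r.2)).
    split=> [y z|x z|x y] c u v; rewrite scaler_sumr -big_split; apply: eq_bigr => s _ /=.
    - by rewrite antipode_linear !mulrDl -!scalerAl (bilDl bB) (bilZl bB).
    - by rewrite mulrDr mulrDl -scalerAr -scalerAl (bilDl bB) (bilZl bB).
    - by rewrite mulrDl -scalerAl (bilDr bB) (bilZr bB).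
  transitivity (\sum_(i <- comul h) \sum_(s <- comul i.2) \sum_(r <- comul e)
      B (antipode i.1 * s.1 * r.1) (s.2 * r.2)); last first.
    apply: eq_bigr => i _; rewrite (comulM i.2 e _ _ (bl _)) big_allpairs_dep /=.
    by apply: eq_bigr => s _; apply: eq_bigr => r _; rewrite mulrA.
  rewrite -(comul_coassoc h tf) -(comul_ext_idem1 (bl' h)).
  transitivity (\sum_(i <- comul h) \sum_(r <- comul e) B ((counit i.1)%:A * r.1) (i.2 * r.2)).
    rewrite [RHS]exchange_big; apply: eq_bigr => r _ /=.
    rewrite -{1}(counitl h) mulr_suml (bil_sumr bB); apply: eq_bigr => i _.
    by rewrite -!scalerAl mul1r (bilZl bB) (bilZr bB).
  apply: eq_bigr => i _; rewrite [RHS]exchange_big; apply: eq_bigr => r _ /=.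
  by rewrite -antipodel mulr_suml (bil_suml bB).
suff hP c : exists d, h * P c = d *: P c.
  have [d dE] := choice hP; exists [ffun c => d c].
  rewrite -[LHS]mulr1 -ext_idem_sum mulr_sumr [X in inc X]fun_idem_sum linear_sum.
  by apply: eq_bigr => c _; rewrite dE ffunE linearZ.
(* Multiplying the second factor by p_c leaves only the term a = c on both sides; [l] then turns the
   first factor into a scalar, nonzero on the left. *)
have [l lL lc] := linear_form_neq0 (ext_idem_neq0 c^-1%g).
have bB : bilinear_for *:%R *:%R (fun x y => l x *: (y * P c)).
  split=> [z b u v|u b z z'] /=; first by rewrite lL scalerDl scalerA.
  by rewrite mulrDl -scalerAl scalerDr !scalerA mulrC.
have := key _ _ bB.
rewrite (bigD1 c) //= big1 ?addr0; last first.
  by move=> a /negPf na; rewrite -mulrA ext_idemM na scale0r mulr0 scaler0.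
rewrite [RHS](bigD1 c) //= [X in _ = _ + X -> _]big1 ?addr0; last first.
  by move=> a /negPf na; rewrite ext_idemM na scale0r scaler0.
rewrite -mulrA !ext_idemM eqxx scale1r => E1.
exists ((l (P c^-1%g))^-1 * l (antipode h * P c^-1%g)).
by rewrite -scalerA -E1 scalerA mulVf // scale1r.
Qed.

End Coinvariants.

(** * Splitting an extension as an algebra *)

Definition multiplicative_section (k : fieldType) (gT C : finGroupType)
    (E : extension k gT C) (to : groupAction [set: C] [set: gT]) (chi : C -> E) :=
  [/\ chi 1%g = 1, {morph chi : x y / (x * y)%g >-> x * y},
      forall x, ext_homog x (chi x), forall x, counit (chi x) = 1 &
      forall x (u : fun_alg k gT),
        chi x * ext_inc E u = ext_inc E [ffun a => u (to a x)] * chi x].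

(* The p-th power of a section over the generator t is a t-invariant unit u0 of
   k^G; dividing by a p-th root of u0, chosen as a function of the values of
   u0 so as to be again t-invariant, makes the section multiplicative. *)
Lemma ext_multiplicative_section (k : closedFieldType) (gT C : finGroupType)
    (E : extension k gT C) (to : groupAction [set: C] [set: gT]) (t : C) :
  [set: C] = <[t]>%g -> ext_action E to ->
  exists chi, @multiplicative_section k gT C E to chi.
Proof.
move=> Ct [chi0 [chiV H]]; have [yyV yVy ht yu] := H t.
have {}ht : ext_homog t (chi0 t) by [].
have cM (a b : E) : counit (a * b) = counit a * counit b by exact: counitM.
have c1 : counit (1 : E) = 1 by exact: counit1.
have cZ (c : k) (a : E) : counit (c *: a) = c * counit a.
  have cl := @counit_linear k E; have c0 : counit (0 : E) = 0.
    by have := cl (-1) 0 0; rewrite scaler0 addr0 mulN1r addNr.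
  by rewrite -[c *: a]addr0 cl c0 addr0.
(* Scaling the counit to 1 gives u0(1) = 1; with the choice r(1) = 1 below, the corrected section
   has counit 1 too. *)
pose c := counit (chi0 t).
have cn : c != 0.
  by apply/eqP => c0; have := oner_neq0 k; rewrite -c1 -yyV cM -/c c0 mul0r eqxx.
pose y := c^-1 *: chi0 t; pose yV := c *: chiV t.
have y1 : y * yV = 1 by rewrite /y /yV -scalerAl -scalerAr scalerA mulVf // scale1r.
have y2 : yV * y = 1 by rewrite /y /yV -scalerAl -scalerAr scalerA mulfV // scale1r.
have cy : counit y = 1 by rewrite cZ mulVf.
have hy : ext_homog t y by exact: ext_homogZ.
have yuE (u : fun_alg k gT) : y * ext_inc E u = ext_inc E [ffun a => u (to a t)] * y.
  by rewrite -yu -scalerAl -scalerAr -!mulrA yVy mulr1.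
have homogX (z : E) n : ext_homog t z -> ext_homog (t ^+ n)%g (z ^+ n).
  move=> hz; elim: n => [|n IH].
    by rewrite expr0 expg0 -(ext_inc1 E); exact: ext_homog_inc.
  by rewrite exprS expgS; exact: ext_homogM.
pose p := #[t]%g.
have [u0 u0E] : exists u0, y ^+ p = ext_inc E u0.
  by apply: ext_coinvariants; rewrite -(expg_order t); exact: homogX.
have u0t a : u0 (to a t) = u0 a.
  have : ext_inc E [ffun a => u0 (to a t)] = ext_inc E u0.
    by rewrite -[LHS]mulr1 -y1 mulrA -yuE -u0E -exprS exprSr -mulrA y1 mulr1.
  by move/(@ext_inc_inj _ _ _ E)/ffunP/(_ a); rewrite ffunE.
have incc u : counit (ext_inc E u) = u 1%g by rewrite (ext_inc_hopf E).2.
have u01 : u0 1%g = 1.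
  rewrite -incc -u0E; elim: (p) => [|n IH]; first by rewrite expr0.
  by rewrite exprS cM cy IH mulr1.
have u0n a : u0 a != 0.
  apply/eqP => u0a; have /eqP := ext_idem_neq0 E a; apply.
  have yp : y ^+ p * yV ^+ p = 1.
    elim: (p) => [|n IH]; first by rewrite !expr0 mulr1.
    by rewrite exprSr exprS mulrA -(mulrA _ y) y1 mulr1.
  rewrite -[LHS]mulr1 -yp mulrA u0E -ext_incM (_ : idem k a * u0 = 0) ?raddf0 ?mul0r //.
  by apply/ffunP => b; rewrite !ffunE; have [->|] := eqVneq b a; rewrite ?u0a ?mulr0 ?mul0r.
have [r rE r1] : exists2 r : k -> k, forall z, r z ^+ p = z & r 1 = 1.
  have [r rE] := choice (fun z => @closed_root_exists k p z (order_gt0 t)).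
  exists (fun z => if z == 1 then 1 else r z); last by rewrite eqxx.
  by move=> z; case: eqP => [->|_]; rewrite ?expr1n ?rE.
have rn z : z != 0 -> r z != 0.
  by move=> z0; apply: contraNneq z0 => E0; rewrite -(rE z) E0 expr0n gtn_eqF ?order_gt0.
pose v : fun_alg k gT := [ffun a => (r (u0 a))^-1].
have yv : GRing.comm y (ext_inc E v).
  rewrite /GRing.comm yuE; congr (ext_inc E _ * _).
  by apply/ffunP => a; rewrite !ffunE u0t.
pose X := ext_inc E v * y.
have Xp : X ^+ p = 1.
  rewrite exprMn_comm; last exact/commr_sym.
  rewrite u0E -rmorphXn -ext_incM -(ext_inc1 E); congr (ext_inc E _).
  apply/ffunP => a; rewrite !ffunE.
  have -> : (v ^+ p) a = (r (u0 a))^-1 ^+ p.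
    elim: (p) => [|n IH]; first by rewrite !expr0 ffunE.
    by rewrite !exprS -IH !ffunE.
  by rewrite exprVn rE mulVf.
have hX : ext_homog t X.
  by rewrite -[t]mul1g; apply: ext_homogM hy; exact: ext_homog_inc.
have cX : counit X = 1 by rewrite cM cy incc ffunE u01 r1 invr1 mulr1.
have XuE n (u : fun_alg k gT) :
    X ^+ n * ext_inc E u = ext_inc E [ffun a => u (to a (t ^+ n)%g)] * X ^+ n.
  elim: n u => [|n IH] u.
    by rewrite expr0 mul1r mulr1; congr (ext_inc E _);
      apply/ffunP => a; rewrite ffunE expg0 act1.
  rewrite exprSr -mulrA -[X * _]mulrA yuE [X in _ * X]mulrA -ext_incM.
  rewrite [v * _](_ : _ = [ffun a => u (to a t)] * v); last first.
    by apply/ffunP => a; rewrite !ffunE mulrC.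
  rewrite ext_incM -[in LHS]mulrA mulrA IH -mulrA; congr (ext_inc E _ * _).
  by apply/ffunP => a; rewrite !ffunE expgSr toM.
have idx x : exists n, x = (t ^+ n)%g.
  by apply/cycleP; rewrite -Ct finset.in_setT.
have [i iE] := choice idx.
have XE m n : (t ^+ m = t ^+ n)%g -> X ^+ m = X ^+ n.
  move/eqP; rewrite eq_expg_mod_order => /eqP mn.
  by rewrite -(expr_mod m Xp) mn expr_mod.
exists (fun x => X ^+ i x); split.
- by rewrite -(expr0 X); apply: XE; rewrite -iE expg0.
- by move=> x z /=; rewrite -exprD; apply: XE; rewrite expgD -!iE.
- by move=> x; rewrite {1}(iE x); exact: homogX.
- by move=> x; elim: (i x) => [|n IH]; rewrite ?expr0 // exprS cM cX IH mulr1.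
- by move=> x u; rewrite XuE -iE.
Qed.

(** * Coordinates on an extension *)

Lemma small_action_trivial (G T : finGroupType) (act : G -> T -> T) :
  (forall x, act 1%g x = x) ->
  (forall a b x, act (a * b)%g x = act a (act b x)) ->
  (forall a, act a 1%g = 1%g) ->
  (forall q : nat, prime q -> (q %| #|G|)%N -> (#|T| <= q)%N) ->
  forall a x, act a x = x.
Proof.
move=> act1 actM actx1 Gq a x.
pose ract y b := act b^-1%g y.
have ract1 y : ract y 1%g = y by rewrite /ract invg1.
have ractM y : act_morph ract y by move=> b c; rewrite /ract invMg actM.
pose to : {action G &-> T} := TotalAction ract1 ractM.
have [->|x1] := eqVneq x 1%g; first exact: actx1.
have no1 : 1%g \notin orbit to [set: G] x.
  apply/orbitP => -[b _ /= E]; case/eqP: x1.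
  by rewrite -(ract1 x) -(mulgV b) ractM [ract x b]E /ract actx1.
have dv : (#|orbit to [set: G] x| %| #|G|)%N by rewrite -[#|G|]cardsT dvdn_orbit.
have lt : (#|orbit to [set: G] x| < #|T|)%N.
  rewrite -[#|T|]cardsT; apply: proper_card; apply/properP; split.
    exact: finset.subsetT.
  by exists 1%g; rewrite ?finset.in_setT.
have ax : act a x \in orbit to [set: G] x.
  by apply/orbitP; exists a^-1%g; rewrite ?finset.in_setT //= /ract invgK.
have [/eqP/cards1P[z oz]|o1] := eqVneq #|orbit to [set: G] x| 1%N.
  by move: ax (orbit_refl to [set: G]%G x); rewrite oz !inE => /eqP -> /eqP ->.
have o0 : (0 < #|orbit to [set: G] x|)%N by apply/card_gt0P; exists (act a x).
have o2 : (1 < #|orbit to [set: G] x|)%N by rewrite ltn_neqAle eq_sym o1 o0.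
(* The least prime divisor q of the orbit length divides #|G|, so #|T| <= q; but q is at most the
   orbit length, which is less than #|T|. *)
have := Gq _ (pdiv_prime o2) (dvdn_trans (pdiv_dvd _) dv).
by rewrite leqNgt (leq_ltn_trans (pdiv_leq _) lt).
Qed.

Section Coordinates.
Context (k : fieldType) (gT C : finGroupType) (E : extension k gT C).
Context (to : groupAction [set: C] [set: gT]) (chi : C -> E).
Context (chiP : multiplicative_section to chi).
Implicit Types w : smash_alg k to.
Local Notation inc := (ext_inc E).

Definition ext_of_smash w : E := \sum_x inc [ffun a => w (a, x)] * chi x.
Local Notation f := ext_of_smash.

Lemma ext_of_smash_linear : linear f.
Proof.
move=> c u v; rewrite scaler_sumr -big_split; apply: eq_bigr => x _ /=.
rewrite scalerAl -linearZ -mulrDl -linearD; congr (inc _ * _).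
by apply/ffunP => a; rewrite !ffunE.
Qed.

Lemma ext_of_smash_monoid : monoid_morphism f.
Proof.
have [chi1 chiM _ _ chi_inc] := chiP; split=> [|u v]; rewrite /f.
  rewrite (bigD1 1%g) //= big1 ?addr0 => [|x /negPf nx].
    rewrite chi1 mulr1 -(ext_inc1 E); congr (inc _); apply/ffunP => a.
    by rewrite !ffunE eqxx.
  rewrite (_ : finfun _ = 0) ?raddf0 ?mul0r //; apply/ffunP => a.
  by rewrite !ffunE nx.
rewrite mulr_suml; under [RHS]eq_bigr => x _ do rewrite mulr_sumr.
transitivity (\sum_z \sum_x inc [ffun a => u (a, x)]
    * inc [ffun a => v (to a x, x^-1 * z)%g] * chi z).
  apply: eq_bigr => z _; rewrite -mulr_suml; congr (_ * _).
  under eq_bigr => x _ do rewrite -ext_incM.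
  rewrite -linear_sum; congr (inc _); apply/ffunP => a.
  by rewrite sum_ffunE !ffunE; apply: eq_bigr => x _; rewrite !ffunE.
rewrite exchange_big; apply: eq_bigr => x _ /=.
rewrite (reindex_inj (mulgI x)); apply: eq_bigr => y _.
rewrite mulKg chiM !mulrA; congr (_ * _); rewrite -!mulrA; congr (_ * _).
by rewrite chi_inc; congr (inc _ * _); apply/ffunP => a; rewrite !ffunE.
Qed.

Lemma ext_of_smashE a x : f (smash_elt k to a x) = inc (idem k a) * chi x.
Proof.
rewrite /f (bigD1 x) //= big1 ?addr0 => [|y /negPf ny].
  by congr (inc _ * _); apply/ffunP => b; rewrite !ffunE xpair_eqE eqxx andbT.
rewrite (_ : finfun _ = 0) ?raddf0 ?mul0r //; apply/ffunP => b.
by rewrite !ffunE xpair_eqE ny andbF.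
Qed.

Lemma ext_comp_of_smash x w : ext_comp x (f w) = inc [ffun a => w (a, x)] * chi x.
Proof.
have [_ _ chih _ _] := chiP; have [_ _ ->] := linear_factsP (ext_comp_linear (E := E) x).
have hz z : ext_homog z (inc [ffun a => w (a, z)] * chi z).
  by rewrite -{1}[z]mul1g; apply: ext_homogM; [exact: ext_homog_inc|exact: chih].
rewrite (bigD1 x) //= (ext_comp_homog x (hz x)) eqxx scale1r big1 ?addr0 // => z nz.
by rewrite (ext_comp_homog x (hz z)) eq_sym (negPf nz) scale0r.
Qed.

Lemma section_mulV x : chi x * chi x^-1%g = 1.
Proof. by have [chi1 chiM _ _ _] := chiP; rewrite -chiM mulgV. Qed.

(** E is the sum of its homogeneous parts, and multiplication by chi(x^-1) carries the part of
    degree x into the coinvariants k^G; hence that part is k^G chi(x). *)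
Lemma ext_of_smash_bij : bijective f.
Proof.
have [chi1 chiM chih _ _] := chiP.
have inj w w' : f w = f w' -> w = w'.
  move=> E1; apply/ffunP => -[a x].
  have := congr1 (fun h => ext_comp x h * chi x^-1%g) E1.
  rewrite !ext_comp_of_smash -!mulrA section_mulV !mulr1.
  move=> /(@ext_inc_inj _ _ _ E)/ffunP/(_ a).
  by rewrite !ffunE.
have surj h : exists w, f w = h.
  have hx x : exists u, ext_comp x h = inc u * chi x.
    have [|u uE] := @ext_coinvariants _ _ _ E (ext_comp x h * chi x^-1%g).
      by rewrite -(mulgV x); apply: ext_homogM; [exact: ext_comp_is_homog|exact: chih].
    by exists u; rewrite -uE -mulrA -chiM mulVg chi1 mulr1.
  have [u uE] := choice hx; exists [ffun i => u i.2 i.1].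
  rewrite [RHS]ext_comp_sum; apply: eq_bigr => x _; rewrite uE; congr (inc _ * _).
  by apply/ffunP => a; rewrite !ffunE.
have [g gK] := choice surj; exists g => // w; exact/inj/gK.
Qed.

End Coordinates.

(** * Structure constants of the coproduct *)

Section StructureConstants.
Context (k : fieldType) (gT C : finGroupType) (E : extension k gT C).
Context (to : groupAction [set: C] [set: gT]) (chi : C -> E).
Context (chiP : multiplicative_section to chi).
Local Notation f := (@ext_of_smash k gT C E to chi).
Context (kap : E -> smash_alg k to) (fK : cancel f kap) (kapK : cancel kap f).
Implicit Types (h g : E) (i j : gT * C).
Local Notation inc := (ext_inc E).
Local Notation e i := (f (smash_elt k to i.1 i.2)).

Lemma ext_coord_linear : linear kap.
Proof.
move=> c u v; apply: (can_inj fK).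
by rewrite kapK ext_of_smash_linear !kapK.
Qed.

Lemma ext_coordM h g : kap (h * g) = kap h * kap g.
Proof. by apply: (can_inj fK); rewrite (ext_of_smash_monoid chiP).2 !kapK. Qed.

Lemma ext_coord_basis h : h = \sum_i (kap h i : k) *: e i.
Proof.
have [_ fZ fsum] := linear_factsP (ext_of_smash_linear (to := to) chi).
rewrite -{1}[h]kapK {1}[kap h]smash_elt_sum pair_big fsum.
by apply: eq_bigr => -[a x] _; rewrite fZ.
Qed.

Lemma bilinear_ext_coord i j : bilinear_for *:%R *:%R (fun h g => kap h i * kap g j : k^o).
Proof.
split=> [v c u u'|u c v v'] /=; rewrite ext_coord_linear !ffunE.
  by rewrite mulrDl -mulrA.
by rewrite mulrDr [in RHS]/GRing.scale /= mulrCA.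
Qed.

Definition comul_coef h i j : k := \sum_(s <- comul h) kap s.1 i * kap s.2 j.
Local Notation D := comul_coef.

Lemma comul_coefE h (W : lmodType k) (B : E -> E -> W) :
  bilinear_for *:%R *:%R B ->
  \sum_(s <- comul h) B s.1 s.2 = \sum_i \sum_j D h i j *: B (e i) (e j).
Proof.
move=> bB; under [RHS]eq_bigr => i _ do under eq_bigr => j _ do rewrite scaler_suml.
under [RHS]eq_bigr => i _ do rewrite exchange_big /=.
rewrite [RHS]exchange_big; apply: eq_bigr => s _ /=.
rewrite {1}[s.1]ext_coord_basis (bil_suml bB); apply: eq_bigr => i _.
rewrite {1}[s.2]ext_coord_basis (bil_sumr bB); apply: eq_bigr => j _.
by rewrite (bilZl bB) (bilZr bB) scalerA.
Qed.

Lemma comul_coef_linear i j : scalar (fun h => D h i j).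
Proof. exact: (comul_bilinear_linear (bilinear_ext_coord i j)). Qed.

Lemma ext_coord_inc (u : fun_alg k gT) h a x : kap (inc u * h) (a, x) = u a * kap h (a, x).
Proof.
have -> : inc u * h = f [ffun i => u i.1 * kap h i].
  rewrite -{1}[h]kapK mulr_sumr; apply: eq_bigr => y _.
  by rewrite mulrA -ext_incM; congr (inc _ * _); apply/ffunP => b; rewrite !ffunE.
by rewrite fK ffunE.
Qed.

Lemma comul_coef_inc (u : fun_alg k gT) h a x b y :
  D (inc u * h) (a, x) (b, y) = u (a * b)%g * D h (a, x) (b, y).
Proof.
rewrite /D (comulM (inc u) h _ _ (bilinear_ext_coord _ _)) big_allpairs_dep /=.
have bB : bilinear_for *:%R *:%R (fun v w => \sum_(t <- comul h)
    kap (v * t.1) (a, x) * kap (w * t.2) (b, y) : k^o).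
  split=> [w c v v'|v c w w'] /=; rewrite scaler_sumr -big_split; apply: eq_bigr => t _ /=.
    by rewrite mulrDl -scalerAl ext_coord_linear !ffunE mulrDl -mulrA.
  by rewrite mulrDl -scalerAl ext_coord_linear !ffunE mulrDr [in RHS]/GRing.scale /= mulrCA.
have := (ext_inc_hopf E).1 u _ _ bB; rewrite [RHS]big_map /= => ->.
rewrite -(@fun_comul_coef k gT u a b (fun v => v a) (fun v => v b)) // mulr_suml.
apply: eq_bigr => i _; rewrite mulr_sumr; apply: eq_bigr => t _.
by rewrite !ext_coord_inc mulrACA.
Qed.

Lemma ext_coord_section x a y : kap (chi x) (a, y) = (y == x)%:R.
Proof.
have -> : chi x = f [ffun i => (i.2 == x)%:R].
  rewrite /ext_of_smash (bigD1 x) //= big1 ?addr0 => [|z /negPf nz].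
    rewrite -[LHS]mul1r -(ext_inc1 E); congr (inc _ * _); apply/ffunP => b.
    by rewrite !ffunE eqxx.
  rewrite (_ : finfun _ = 0) ?raddf0 ?mul0r //; apply/ffunP => b.
  by rewrite !ffunE nz.
by rewrite fK ffunE.
Qed.

Lemma ext_coord_comp h a x : kap (ext_comp x h) (a, x) = kap h (a, x).
Proof.
rewrite -[h in LHS]kapK (ext_comp_of_smash chiP).
by rewrite ext_coord_inc ffunE ext_coord_section eqxx mulr1.
Qed.

(** The second factor has no degree of its own, since [comul_coef_chi] forces it to be x. In the end
    only y = x survives. *)
Definition section_coef x b y c : k := D (chi x) (b, y) (c, x).
Local Notation T := section_coef.

Lemma comul_coef_chi x b y c w : D (chi x) (b, y) (c, w) = (w == x)%:R * T x b y c.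
Proof.
have [_ _ chih _ _] := chiP.
have bB := bilinear_ext_coord (b, y) (c, w).
rewrite /D; under eq_bigr => s _ do rewrite -(ext_coord_comp s.2).
rewrite [LHS](ext_homog_comulr w (chih x) bB).
by have [->|_] := eqVneq w x; rewrite ?scale1r ?mul1r // scale0r mul0r.
Qed.

Lemma comul_coef_basis a x b y c w :
  D (inc (idem k a) * chi x) (b, y) (c, w) = (b * c == a)%g%:R * ((w == x)%:R * T x b y c).
Proof. by rewrite comul_coef_inc ffunE comul_coef_chi. Qed.

(** These are the coefficients of p_b z (x) p_c y (x) p_d x on the two sides of coassociativity for
    chi(x); a single intermediate basis tensor contributes to each. *)
Lemma section_coefA x b z c y d :
  T x (b * c)%g y d * T y b z c = T x b z (c * d)%g * T x c y d.
Proof.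
have tf : trilinear (fun u v w => kap u (b, z) * kap v (c, y) * kap w (d, x) : k^o).
  split=> [v w|u w|u v] r p q; rewrite ext_coord_linear !ffunE /GRing.scale /=; ring.
have := comul_coassoc (chi x) tf.
have bl : bilinear_for *:%R *:%R (fun u w => D u (b, z) (c, y) * kap w (d, x) : k^o).
  split=> [w r p q|u r p q] /=; first by rewrite comul_coef_linear mulrDl -mulrA.
  by rewrite ext_coord_linear !ffunE mulrDr [in RHS]/GRing.scale /= mulrCA.
have br : bilinear_for *:%R *:%R (fun u w => kap u (b, z) * D w (c, y) (d, x) : k^o).
  split=> [w r p q|u r p q] /=; last by rewrite comul_coef_linear mulrDr mulrCA.
  by rewrite ext_coord_linear !ffunE mulrDl [in RHS]/GRing.scale /= mulrA.
under eq_bigr => s _ do rewrite -mulr_suml.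
under [RHS]eq_bigr => s _ do under eq_bigr => r _ do rewrite -mulrA.
under [RHS]eq_bigr => s _ do rewrite -mulr_sumr.
rewrite [LHS](comul_coefE (chi x) bl) [RHS](comul_coefE (chi x) br).
have El a w a' w' : kap (f (smash_elt k to a w)) (a', w') = ((a, w) == (a', w'))%:R.
  by rewrite fK ffunE eq_sym.
rewrite (bigD1 (b * c, y)%g) //= [X in _ + X]big1 ?addr0; last first.
  move=> [a w] naw; apply: big1 => -[a' w'] _; rewrite /= ext_of_smashE.
  rewrite comul_coef_basis eq_sym [y == w]eq_sym; move: naw; rewrite xpair_eqE.
  by case: (a == _); case: (w == _) => //= _; rewrite ?mul0r ?mulr0 ?mul0r scaler0.
rewrite (bigD1 (d, x)) //= [X in _ + X]big1 ?addr0; last first.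
  by move=> [a w] /negPf naw; rewrite /= El naw mulr0 scaler0.
rewrite [RHS](bigD1 (b, z)) //= [X in _ = _ + X -> _]big1 ?addr0; last first.
  by move=> [a w] /negPf naw; apply: big1 => j _; rewrite /= El naw mul0r scaler0.
rewrite [RHS](bigD1 (c * d, x)%g) //= [X in _ = _ + X -> _]big1 ?addr0; last first.
  move=> [a w] naw; rewrite /= !ext_of_smashE comul_coef_basis comul_coef_chi.
  move: naw; rewrite xpair_eqE negb_and => /orP[/negPf na|/negPf nw].
    by rewrite [(c * d)%g == a]eq_sym na mul0r mulr0 scaler0.
  by rewrite nw mul0r scale0r.
rewrite !El !ext_of_smashE !comul_coef_basis !comul_coef_chi !eqxx !mul1r mulr1.
by [].
Qed.

Lemma counit_ext_coord h : counit h = \sum_y kap h (1%g, y).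
Proof.
have [_ _ _ cchi _] := chiP.
have [_ _ csum] := linear_factsP (W := k^o) (@counit_linear k E).
rewrite -{1}[h]kapK csum; apply: eq_bigr => y _.
by rewrite counitM cchi mulr1 (ext_inc_hopf E).2 /counit /= /fun_counit ffunE.
Qed.

Lemma section_coef_1r x b y : T x b y 1%g = (y == x)%:R.
Proof.
have [_ kZ ksum] := linear_factsP ext_coord_linear.
have := congr1 (fun h => kap h (b, y)) (counitr (chi x)).
rewrite ext_coord_section ksum sum_ffunE => <-.
transitivity (\sum_w D (chi x) (b, y) (1%g, w)).
  rewrite (bigD1 x) //= big1 ?addr0 // => w /negPf nw.
  by rewrite comul_coef_chi nw mul0r.
rewrite exchange_big; apply: eq_bigr => s _ /=.
by rewrite kZ ffunE counit_ext_coord scaler_suml; apply: eq_bigr => w _; exact: mulrC.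
Qed.

Lemma section_coef1 b y c : T 1%g b y c = (y == 1%g)%:R.
Proof.
have [chi1 _ _ _ _] := chiP; rewrite /T /D chi1.
rewrite (comul1 _ _ (bilinear_ext_coord (b, y) (c, 1%g))) big_seq1 /= -chi1 !ext_coord_section eqxx.
exact: mulr1.
Qed.

Lemma section_coefM x x' b c w : T (x * x')%g b w c
  = \sum_y T x b y c * T x' (to b y) (y^-1 * w)%g (to c x).
Proof.
have [_ chiM _ _ _] := chiP; rewrite {1}/T /D chiM.
rewrite (comulM _ _ _ _ (bilinear_ext_coord _ _)) big_allpairs_dep /=.
transitivity (\sum_y \sum_v D (chi x) (b, y) (c, v) *
    D (chi x') (to b y, y^-1 * w)%g (to c v, v^-1 * (x * x'))%g).
  under [RHS]eq_bigr => y _ do under eq_bigr => v _ do rewrite mulr_suml.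
  under [RHS]eq_bigr => y _ do rewrite exchange_big /=.
  rewrite [RHS]exchange_big; apply: eq_bigr => s _ /=.
  under [RHS]eq_bigr => y _ do under eq_bigr => v _ do rewrite mulr_sumr.
  under [RHS]eq_bigr => y _ do rewrite exchange_big /=.
  rewrite [RHS]exchange_big; apply: eq_bigr => r _ /=.
  rewrite !ext_coordM !ffunE mulr_suml; apply: eq_bigr => y _.
  by rewrite mulr_sumr; apply: eq_bigr => v _; rewrite /= mulrACA.
apply: eq_bigr => y _; rewrite (bigD1 x) //= big1 ?addr0 => [|v /negPf nv].
  by rewrite mulKg.
by rewrite comul_coef_chi nv !mul0r.
Qed.

(** Otherwise [section_coefM] for x x^-1 = 1 would annihilate a coefficient of the coproduct of 1
    that equals 1. *)
Lemma section_coef_supp x b c : exists y, T x b y c != 0.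
Proof.
apply: contrapT => /forallNP n0.
have := section_coefM x x^-1%g b c 1%g.
rewrite mulgV section_coef1 eqxx big1 => [/eqP|y _]; first by rewrite oner_eq0.
by have /negP/negPn/eqP -> := n0 y; rewrite mul0r.
Qed.

(* The nonzero coefficients of the coproduct of the section describe an action
   of G on the set C fixing 1 (the second action of a matched pair); as p is the
   least prime divisor of #|G|, this action is trivial. *)
Lemma section_coef_diag :
  (forall q : nat, prime q -> (q %| #|gT|)%N -> (#|C| <= q)%N) ->
  forall x b c, [/\ T x b x c != 0, T x 1%g x c = 1 & forall y, y != x -> T x b y c = 0].
Proof.
move=> Cq.
(* Setting c = 1 in [section_coefA] shows that the z with [T x b z d] nonzero is unique and
   independent of b: it is the image of x under d. *)
have Tz x b d z : T x b z d != 0 -> forall y, T x 1%g y d = (z == y)%:R.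
  move=> nz y; have := section_coefA x b z 1%g y d.
  rewrite mulg1 mul1g section_coef_1r.
  have [<-|_] := eqVneq z y; first by move/(mulfI nz).
  by rewrite mulr0 => /esym/eqP; rewrite mulf_eq0 (negPf nz) => /eqP.
have [act actP] := choice (fun dx : gT * C => section_coef_supp dx.2 1%g dx.1).
have actE x b d z : T x b z d != 0 -> act (d, x) = z.
  move/Tz/(_ (act (d, x))) => Tzz; have := actP (d, x); rewrite /= Tzz.
  by have [|_] := eqVneq z (act (d, x)); rewrite ?eqxx.
have actN x b d : T x b (act (d, x)) d != 0.
  by have [z nz] := section_coef_supp x b d; rewrite (actE _ _ _ _ nz).
have triv : forall d x, act (d, x) = x.
  apply: (small_action_trivial (act := fun d x => act (d, x))) => //.
  - by move=> x; apply: (actE _ 1%g); rewrite section_coef_1r eqxx oner_neq0.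
  (* The left side of [section_coefA] is nonzero along x, act(d, x), act(c, act(d, x)), hence so is
     the coefficient for c d on the right. *)
  - move=> c d x; apply: (actE _ 1%g).
    have : T x (1 * c)%g (act (d, x)) d
        * T (act (d, x)) 1%g (act (c, act (d, x))) c != 0 by rewrite mulf_neq0.
    by rewrite section_coefA mulf_eq0 negb_or => /andP[].
  - by move=> d; apply: (actE _ 1%g); rewrite section_coef1 eqxx oner_neq0.
move=> x b c; have n := actN x b c; split.
- by rewrite -{2}(triv c x).
- by rewrite (Tz _ _ _ _ (actN x 1%g c)) triv eqxx.
move=> y ny; apply/eqP; apply: contraNT ny => /actE <-.
by rewrite triv.
Qed.

(** The diagonal coefficients form the cocycle: [section_coefA] becomes the 2-cocycle identity and,
    as all other coefficients vanish, [section_coefM] becomes the rule for tau(xy). The isomorphism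
    sends p_a x to p_a chi(x). *)
Lemma crossed_of_section :
  (forall q : nat, prime q -> (q %| #|gT|)%N -> (#|C| <= q)%N) ->
  exists tau : normalized_cocycle k to, hopf_isomorphic (crossed_alg tau) E.
Proof.
move=> Cq; pose t x b c := T x b x c.
have tn x b c : t x b c != 0 by have [] := section_coef_diag Cq x b c.
have t0 x b y c : y != x -> T x b y c = 0.
  by have [_ _] := section_coef_diag Cq x b c; apply.
have tZ : Z2c to t.
  split=> [x|x y a b].
    by split=> // a b c; rewrite mulrC section_coefA mulrC.
  rewrite /t section_coefM (bigD1 x) //= mulKg big1 ?addr0 // => z nz.
  by rewrite t0 ?mul0r.
have tnorm : normalized t.
  move=> x a; rewrite /t section_coef_1r eqxx; split=> //.
  by have [] := section_coef_diag Cq x 1%g a.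
pose tau := NormalizedCocycle tZ tnorm; exists tau.
apply: (@hopf_isomorphicI _ (crossed_alg tau) E f).
- exact: ext_of_smash_linear.
- exact: ext_of_smash_monoid.
- move=> w W B bB; rewrite [LHS](comul_coefE _ bB) [RHS]big_map /=.
  rewrite [RHS](crossed_comulE (fun u v => B (f u) (f v))).
  have Dw b y c v : D (f w) (b, y) (c, v) = (v == y)%:R * (w (b * c, v)%g * t v b c).
    have [_ _ Dsum] := linear_factsP (W := k^o) (comul_coef_linear (b, y) (c, v)).
    rewrite {1}/ext_of_smash Dsum (bigD1 v) //= big1 ?addr0 => [|z nz].
      rewrite comul_coef_inc ffunE comul_coef_chi eqxx mul1r eq_sym.
      by have [->|ny] := eqVneq y v; rewrite ?mul1r // t0 ?mulr0 ?mul0r.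
    by rewrite comul_coef_inc comul_coef_chi eq_sym (negPf nz) mul0r mulr0.
  have [_ fZ _] := linear_factsP (ext_of_smash_linear (to := to) chi).
  transitivity (\sum_a \sum_x \sum_b (w (a * b, x)%g * t x a b) *:
      B (f (smash_elt k to a x)) (f (smash_elt k to b x))).
    rewrite [RHS]pair_big /=; apply: eq_bigr => -[a x] _ /=.
    transitivity (\sum_b \sum_y D (f w) (a, x) (b, y) *:
      B (f (smash_elt k to a x)) (f (smash_elt k to b y))).
      by rewrite [RHS]pair_bigA; apply: eq_bigr => -[].
    apply: eq_bigr => b _; rewrite (bigD1 x) //= Dw eqxx mul1r big1 ?addr0 // => y /negPf ny.
    by rewrite Dw ny mul0r scale0r.
  rewrite exchange_big; apply: eq_bigr => x _; apply: eq_bigr => a _ /=.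
  by apply: eq_bigr => b _; rewrite fZ (bilZl bB) [t _ _ _ * _]mulrC.
- by move=> w; rewrite counit_ext_coord fK.
- by exists kap.
Qed.

End StructureConstants.

(** * Classification *)

Lemma ext_crossed (k : closedFieldType) (gT C : finGroupType)
    (E : extension k gT C) (to : groupAction [set: C] [set: gT]) (t : C) :
  [set: C] = <[t]>%g -> ext_action E to ->
  (forall q : nat, prime q -> (q %| #|gT|)%N -> (#|C| <= q)%N) ->
  exists tau : normalized_cocycle k to, hopf_isomorphic (crossed_alg tau) E.
Proof.
move=> Ct /(ext_multiplicative_section Ct)[chi chiP] Cq.
have [kap fK kapK] := ext_of_smash_bij chiP.
exact: (crossed_of_section chiP fK kapK Cq).
Qed.

Lemma crossed_isomorphicP (k : fieldType) (gT C : finGroupType)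
    (to to' : groupAction [set: C] [set: gT])
    (tau : normalized_cocycle k to) (tau' : normalized_cocycle k to') :
  abelian [set: gT] -> prime #|C| -> ~ cocommutative (crossed_alg tau') ->
  hopf_isomorphic (crossed_alg tau) (crossed_alg tau') <->
  exists alpha lambda,
    [/\ alpha \in Aut [set: C], lambda \in isoms to (twist to' alpha) &
        cocycle_class to' tau' = cocycle_class to' (act_pair lambda alpha tau)].
Proof.
move=> abG Cp ncH; split=> [/(isomorphic_crossed abG Cp ncH)|].
  move=> [alpha [l [eta [Aa li eta1 tE]]]]; exists alpha, l; split=> //.
  by apply/esym/cocycle_classP; exists eta.
move=> [alpha [l [Aa li /esym/cocycle_classP[eta eta1 tE]]]].
exact: crossed_isomorphic tE.
Qed.

Lemma act_class_refl (gT C : finGroupType)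
    (to : groupAction [set: C] [set: gT]) : act_class to to.
Proof. by exists 1%g; rewrite ?group1 //; apply/set0Pn; exists 1%g; exact: isoms1. Qed.

Lemma ext_equiv_refl (k : fieldType) (gT C : finGroupType)
    (E : extension k gT C) : ext_equiv E E.
Proof.
exists idfun; last by split.
by split; [split=> // h W f bf; rewrite big_map|exists id].
Qed.

(** Transport along l and alpha turns tau' into a cocycle for [to], so the single action [to]
    represents its whole class. *)
Lemma act_class_crossed (k : fieldType) (gT C : finGroupType)
    (to to' : groupAction [set: C] [set: gT]) (tau' : normalized_cocycle k to') :
  act_class to to' -> exists tau : normalized_cocycle k to,
    hopf_isomorphic (crossed_alg tau') (crossed_alg tau).
Proof.
move=> [alpha Aa /set0Pn[l li]].
exists (NormalizedCocycle (Z2c_act li Aa (ncocycle_Z2c tau'))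
  (normalized_act alpha (isoms_Aut li) (ncocycle_normalized tau'))).
apply: (crossed_isomorphic Aa li (cochain1_one k to)) => x a b.
by rewrite deltaG1 mulr1.
Qed.

Theorem theorem4p12 (k : closedFieldType) (k_char0 : [pchar k] =i pred0)
    (gT : finGroupType) (gT_abelian : abelian [set: gT])
    (p : nat) (p_prime : prime p) (p_dvd : (p %| #|gT|)%N)
    (p_min : forall q : nat, prime q -> (q %| #|gT|)%N -> (p <= q)%N)
    (C : finGroupType) (t : C) (C_cyclic : [set: C] = <[t]>%g)
    (t_order : #[t]%g = p) :
  (forall (to to' : groupAction [set: C] [set: gT])
      (tau : normalized_cocycle k to) (tau' : normalized_cocycle k to'),
    ~ cocommutative (crossed_alg tau) ->
    ~ cocommutative (crossed_alg tau') ->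
    (hopf_isomorphic (crossed_alg tau) (crossed_alg tau') <->
     exists alpha lambda,
       [/\ alpha \in Aut [set: C],
           lambda \in isoms to (twist to' alpha) &
           cocycle_class to' tau'
           = cocycle_class to' (act_pair lambda alpha tau)]))
  /\
  (forall to : groupAction [set: C] [set: gT],
    in_bijection (noncc_orbits k to) (Ext_noncocomm_types k to)).
Proof.
have cardC : #|C| = p by rewrite -cardsT C_cyclic -t_order.
have Cp : prime #|C| by rewrite cardC.
split=> [to to' tau tau' _ ncH|to]; first exact: crossed_isomorphicP.
pose orb (tau : normalized_cocycle k to) := calG_orbit to (cocycle_class to tau).
have orb_iso (tau tau' : normalized_cocycle k to) : ~ cocommutative (crossed_alg tau') ->
    hopf_isomorphic (crossed_alg tau) (crossed_alg tau') <-> orb tau = orb tau'.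
  move=> ncH; rewrite crossed_isomorphicP //; split=> [[alpha [l [Aa li E]]]|E].
    apply: calG_orbit_eq; apply/calG_orbitP; exists l, alpha; split=> //.
    by rewrite (cocycle_class_act _ li Aa).
  have : orb tau (cocycle_class to tau') by rewrite E; exact: calG_orbit_refl.
  move/calG_orbitP => [l [alpha [Aa li Ec]]]; exists alpha, l; split=> //.
  by rewrite Ec (cocycle_class_act _ li Aa).
have nccP (tau : normalized_cocycle k to) :
    ~ (orb tau `<=` @H2cc k gT C to)%classic <-> ~ cocommutative (crossed_alg tau).
  by rewrite crossed_cocommutative_B2cc //; apply: noncc_orbitP; exact: ncocycle_Z2c.
have orbP O : noncc_orbits k to O ->
    exists2 tau : normalized_cocycle k to, O = orb tau & ~ cocommutative (crossed_alg tau).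
  move=> [[c [s /(@normalize_cocycle k gT C to)[tau tauE] <-] OE] Onc].
  have OE' : O = orb tau by rewrite OE -tauE.
  by exists tau => //; apply/nccP; rewrite -OE'.
(* An orbit is sent to the union of the isomorphism types of its members, which avoids choosing a
   representative; by [FE] this is a single type on the orbits concerned. *)
pose F O (K : hopfAlgType k) := exists tau : normalized_cocycle k to,
  O = orb tau /\ hopf_isomorphic (crossed_alg tau) K.
have FE (tau : normalized_cocycle k to) : ~ cocommutative (crossed_alg tau) ->
    F (orb tau) = @hopf_isomorphic k (crossed_alg tau).
  move=> ncH; apply/funext => K; apply/propext; split=> [[tau' [E]]|]; last by exists tau.
  apply: hopf_isomorphic_trans; apply: hopf_isomorphic_sym.
  by apply/(orb_iso _ _ ncH).
exists F; split=> [O /orbP[tau -> ncH]|O O' /orbP[tau -> ncH] /orbP[tau' -> ncH']|T].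
- rewrite FE //; exists (ext_equiv (crossed_ext tau)), (crossed_ext tau); split=> //.
  + exists (crossed_ext tau), to; split=> //; first exact: act_class_refl.
    exact: crossed_ext_action.
  + exact: ext_equiv_refl.
- rewrite !FE // => E; apply/(orb_iso _ _ ncH'); rewrite E.
  exact: hopf_isomorphic_refl.
move=> [X [E [[E0 [to' [tt' actE XE]]]]]]; rewrite {X}XE => -[f [fH fbij] _] ncE ->.
have E0E : hopf_isomorphic E0 E by exists f.
(* E is equivalent to E0, whose action to' is only in the class of [to]: E0 is brought to the form
   H(tau', to') and then moved to the action [to]. *)
have [|tau' tau'E0] := ext_crossed C_cyclic actE; first by rewrite cardC.
have [tau tau'E] := act_class_crossed tau' tt'.
have tauE : hopf_isomorphic (crossed_alg tau) E.
  apply: hopf_isomorphic_trans E0E; apply: hopf_isomorphic_trans tau'E0.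
  exact: hopf_isomorphic_sym.
have ncH : ~ cocommutative (crossed_alg tau) by move/(cocommutative_iso tauE).
exists (orb tau); last by rewrite FE //; exact: hopf_isomorphic_types.
split; last exact/nccP.
by exists (cocycle_class to tau) => //; exists tau => //; exact: ncocycle_Z2c.
Qed.
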